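(* Let $G$ be a finite group. Then $G\in D(1)$ if and only if one of the following statements holds: (1) $G$ is a nilpotent group and either $G=C_4$ or $G=Q_8$; (2) $G$ is a non-nilpotent solvable group, and either $G=E_{2^s}\rtimes C_q$ is a Frobenius group with $s$ a positive integer and $q=2^s-1$ a Mersenne prime, or $G=C_q\rtimes C_4$ is a Frobenius group with $q$ a prime satisfying $q\equiv 1\pmod 4$, or $G=D_{18}$; (3) $G$ is a non-solvable group and either $G=A_5$ or $G=PSL(2,7)$.
   Context: For a group $G$ put $G^{*}=G\setminus\{1\}$. An element $x\in G^{*}$ is called deficient if $\langle x\rangle < C_G(x)$ (proper inclusion), and non-deficient if $\langle x\rangle = C_G(x)$; the conjugacy class $x^G$ is called deficient (non-deficient) if $x$ is. For a non-negative integer $j$, $G\in D(j)$ means that exactly $j$ non-trivial conjugacy classes of $G$ are deficient. $C_n$ denotes the cyclic group of order $n$, $D_n$ the dihedral group of order $n$ (so $D_{18}$ has order 18), $Q_8$ the quaternion group of order 8, $E_{p^s}$ the elementary abelian group of order $p^s$, and $A_5$ the alternating group of degree 5. The phrase ''$G=A\rtimes B$ is a Frobenius group'' means that $G$ is a finite Frobenius group with kernel $A$ and a complement $B$. Equalities of groups with named groups mean isomorphism. *)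

(* Defs.v *)
From HB Require Import structures.
From mathcomp Require Import all_boot all_order all_algebra.
From mathcomp Require Import all_fingroup all_solvable.

Set Implicit Arguments.
Unset Strict Implicit.
Unset Printing Implicit Defensive.

Local Open Scope group_scope.

Section Deficient.

Variable gT : finGroupType.
Implicit Types G : {group gT}.

Definition deficient G (x : gT) : bool :=
  (x \in G^#) && (<[x]> \proper 'C_G[x]).

(* Deficiency depends only on the conjugacy class (deficientJ below), so these
   are the classes all of whose elements are deficient. *)
Definition deficient_classes G : {set {set gT}} :=
  [set x ^: G | x in [set y | deficient G y]].

(* inD j G is G \in D(j). *)
Definition inD (j : nat) G : Prop := #|deficient_classes G| = j.

Lemma deficientJ G x g : g \in G -> deficient G (x ^ g) = deficient G x.
Proof.
move=> Gg; rewrite /deficient !inE conjg_eq1 groupJr //.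
have -> : 'C_G[x ^ g] = 'C_G[x] :^ g.
  by rewrite conjIg conjGid // -normJ conjg_set1.
by rewrite cycleJ !properEcard conjSg !cardJg.
Qed.

End Deficient.

Section NamedGroups.

Variable gT : finGroupType.
Implicit Types G : {group gT}.

Definition is_cyclic_of_order (n : nat) G : Prop := cyclic G /\ #|G| = n.

Definition is_elementary_abelian (p s : nat) G : Prop :=
  p.-abelem G /\ #|G| = (p ^ s)%N.

End NamedGroups.

(* As for {'GL_n[F]}, matrices have size n.-1.+1, so n = 0 is read as n = 1. *)
Definition SL (n : nat) (F : finFieldType) : {set {'GL_n[F]}} :=
  [set u : {'GL_n[F]} | (\det (GLval u) == 1)%R].

Lemma SL_group_set n F : group_set (SL n F).
Proof.
apply/group_setP; split=> [|u v]; rewrite !inE.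
  by rewrite GL_1E det1.
by rewrite GL_MxE det_mulmx => /eqP-> /eqP->; rewrite GRing.mulr1.
Qed.

Canonical SL_group n F := Group (SL_group_set n F).

Definition PSL (n : nat) (F : finFieldType) : {set coset_of 'Z(SL n F)} :=
  SL n F / 'Z(SL n F).

Canonical PSL_group n F := Eval hnf in [group of PSL n F].

(* Main.v *)
Require Import Defs.
From mathcomp Require Import all_boot all_order all_algebra.
From mathcomp Require Import all_fingroup all_solvable.
From mathcomp Require Import vcharacter zify.

(** Write D for the property of having exactly one deficient class.

    A non-trivial element generating a proper subgroup of a cyclic group [<[y]>]
    is deficient, and so is a non-trivial element that commutes with some element
    outside the subgroup it generates.  This makes D equivalent to a statement about
    centralizers ([inD1_structure]): for one prime [p], the elements of order [p]
    form a single class and are deficient, and every other non-trivial element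
    generates its own centralizer.  Hence element orders are prime or [p ^ 2]
    ([odp_order]), and an element of prime order [r != p] generates a Sylow
    [r]-subgroup.

    For odd [p] there is an involution [t], because elements of order [p] are
    conjugate to their inverses; [t] generates its centralizer, so [G] is a
    Frobenius group whose abelian kernel is inverted by [t].  The conjugates of an
    element [x] of order [p] are then [x] and [x^-1], so [p = 3], and the kernel is
    cyclic of order 9 ([odd_deficient_order]).

    For [p = 2], a Sylow 2-subgroup [P] either has a single involution, or is
    elementary abelian, or is dihedral of order 8 ([Sylow2_shape]).
    - With a single involution, [P] is cyclic of order 4 or quaternion of order 8,
      and is either [G] or a Frobenius complement, whose kernel has prime order and
      forces [P] to be cyclic ([unique_involution_case]).
    - If [P] is elementary abelian and normal, a complement acts regularly on the
      involutions, and it has prime order: a group [R ><| B] with [B] semiregular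
      on [R] cannot act on an abelian group of order prime to [#|R|] with both [R]
      and [B] free of fixed points ([regular_semidirect_exponent],
      [normal_abelem_case]).
    - In the remaining cases, count the pairs of involutions by their product [w]
      ([sum_inverters]). As centralizers are known, the number of pairs with
      product [w] depends only on whether [w] is inverted by an involution
      ([card_inverters_real]), and the count becomes an equation in [#|G|], [#|P|]
      and the odd primes [r] for which elements of order [r] are inverted. It
      forces [#|G| = 60] ([abelem_order60]), respectively [#|G| = 168]
      ([dihedral_order168]), and shows that some element [b] of order 3 is
      inverted by an involution [t]. Let [U] be a Sylow 2-subgroup, respectively a
      Sylow 7-subgroup, normalized by [b], and [N = U <[b]>]. Then [G] is the
      union of [N] and of [N t U], and computing [t u t] in this decomposition
      yields [(t u) ^ 3 = 1] for a suitable [t] ([cubic_relation]). Together with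
      the relations of [N] this bounds the order of the group by 60, respectively
      168 ([card_gen_bound]). Two groups that satisfy such relations and reach the
      bound are isomorphic: both are images of the subgroup of their product
      generated by the pairs of generators, whose order is bounded as well
      ([presented_isog]). So [G] is isomorphic to any other group of its kind, and
      the alternating group of degree 5, respectively [PSL 2 'F_7], is one.

    Conversely, [inD1_criterion] reduces D to three local conditions on a Sylow
    2-subgroup and on the elements of odd prime order.  These follow from the
    structure of the solvable groups in the list, and from computations with
    explicit permutations and matrices for the two simple groups. *)

Set Implicit Arguments.
Unset Strict Implicit.
Unset Printing Implicit Defensive.

Local Open Scope group_scope.

(** * Groups with a single deficient class *)

Section Structure.
Variable gT : finGroupType.
Implicit Types (G P : {group gT}) (x y z : gT).

Lemma inD1P G :
  inD 1 G <-> exists2 x, deficient G x & forall y, deficient G y -> y \in x ^: G.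
Proof.
rewrite /inD; split=> [/eqP/cards1P[C defC] | [x dx ux]].
  have /imsetP[x]: C \in deficient_classes G by rewrite defC inE.
  rewrite inE => dx defCx; exists x => // y dy.
  have: y ^: G \in deficient_classes G by apply/imsetP; exists y; rewrite ?inE.
  by rewrite defC inE defCx => /eqP <-; apply: class_refl.
apply/eqP/cards1P; exists (x ^: G); apply/setP=> C; rewrite inE.
apply/imsetP/eqP=> [[y] | ->]; last by exists x; rewrite ?inE.
by rewrite inE => dy ->; apply/class_eqP/ux.
Qed.

(** The form that membership in D takes: the deficient class is the set of all
  elements of order [p]. *)
Definition one_deficient_prime p G x :=
  [/\ x \in G, #[x] = p, <[x]> \proper 'C_G[x],
      forall y, y \in G -> #[y] = p -> y \in x ^: G
    & forall y, y \in G -> y != 1 -> #[y] != p -> 'C_G[y] = <[y]>].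

Lemma sub_cent1_cycle G y : y \in G -> <[y]> \subset 'C_G[y].
Proof. by move=> Gy; rewrite subsetI !cycle_subG Gy cent1id. Qed.

Lemma not_deficient G y :
  y \in G -> y != 1 -> ~~ deficient G y -> 'C_G[y] = <[y]>.
Proof.
move=> Gy ny; rewrite /deficient !inE ny Gy /= properE sub_cent1_cycle //=.
by rewrite negbK => sC; apply/eqP; rewrite eqEsubset sC sub_cent1_cycle.
Qed.

(** The whole of [<[y]>] centralizes [z]. *)
Lemma deficient_power G y z :
  y \in G -> z \in <[y]> -> z != 1 -> <[z]> != <[y]> -> deficient G z.
Proof.
move=> Gy yz nz neq.
have Gz: z \in G by move: yz; apply/subsetP; rewrite cycle_subG.
rewrite /deficient !inE nz Gz /=.
have sC: <[y]> \subset 'C_G[z].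
  rewrite subsetI !cycle_subG Gy /= cent1C.
  by move: yz; apply/subsetP; rewrite cycle_subG cent1id.
by apply: proper_sub_trans sC; rewrite properEneq neq cycle_subG.
Qed.

(** Let [P] be a Sylow subgroup containing [y]. Its centre centralizes [y], so it
  lies in [<[y]>] and, having prime order, equals it; hence [P] centralizes [y] and
  lies in [<[y]>]. *)
Lemma self_cent_prime_Sylow G y :
  y \in G -> prime #[y] -> 'C_G[y] = <[y]> -> #[y].-Sylow(G) <[y]>.
Proof.
move=> Gy pr_y Cy.
have [P sylP sP] : {P : {group gT} | #[y].-Sylow(G) P & <[y]> \subset P}.
  by apply: Sylow_superset; rewrite ?cycle_subG // /pgroup -orderE pnat_id.
have Py: y \in P by rewrite -cycle_subG.
have [sPG pP _] := and3P sylP.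
have ntP: P :!=: 1 by apply/trivgPn; exists y; rewrite -?order_gt1 ?prime_gt1.
have ntZ: 'Z(P) != 1 by rewrite center_nil_eq1 ?(pgroup_nil pP).
have [_ p_dv_Z _] := pgroup_pdiv (pgroupS (center_sub P) pP) ntZ.
have defZ: 'Z(P) = <[y]>.
  apply/eqP; rewrite eqEcard -orderE (dvdn_leq _ p_dv_Z) // andbT.
  rewrite -Cy subsetI (subset_trans (center_sub P)) //= sub_cent1.
  by apply: subsetP Py; rewrite centsC subsetIr.
suffices -> : <[y]> = P by [].
apply/eqP; rewrite eqEsubset sP -Cy subsetI sPG sub_cent1.
by have /setIP[_ //] : y \in 'Z(P) by rewrite defZ cycle_id.
Qed.

(** The deficient [x] has prime order, since its powers of prime order would
  otherwise be deficient of a smaller order. If some [y] of the same order [p] were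
  not deficient, [<[y]>] would be a Sylow subgroup of order [p], so the centralizer
  of [x] would contain an element of another prime order; that element is
  centralized by [x], hence deficient, and cannot be conjugate to [x]. *)
Lemma inD1_structure G :
  inD 1 G <-> exists p x, prime p /\ one_deficient_prime p G x.
Proof.
split=> [/inD1P[x dx ux] | [p] [x] [pr_p] [Gx ox prop cx cy]]; last first.
  apply/inD1P; have nx: x != 1 by rewrite -order_gt1 ox prime_gt1.
  exists x => [|y]; first by rewrite /deficient !inE nx Gx.
  case/andP; rewrite !inE => /andP[ny Gy] dy.
  have [oy | oy] := eqVneq #[y] p; first exact: cx.
  by move: dy; rewrite (cy y) // properxx.
have [/setD1P[nx Gx] prop] := andP dx.
have ordx y : deficient G y -> #[y] = #[x].
  by move/ux/imsetP=> [g _ ->]; rewrite orderJ.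
have pr_x: prime #[x].
  have [r pr_r rx] := pdivP (etrans (order_gt1 x) nx).
  have [z zx oz] : {z | z \in <[x]> & #[z] = r} := Cauchy pr_r rx.
  have nz: z != 1 by rewrite -order_gt1 oz prime_gt1.
  have [e | ne] := eqVneq <[z]> <[x]>; first by rewrite orderE -e -orderE oz.
  by rewrite -(ordx z) ?oz //; apply: deficient_power ne.
have ndef y : y \in G -> y != 1 -> #[y] != #[x] -> 'C_G[y] = <[y]>.
  move=> Gy ny oy; apply: not_deficient => //.
  by apply: contra oy => /ordx/eqP.
exists #[x], x; split=> //; split=> // y Gy oy.
apply: ux; apply: contraT => ndy.
have ny: y != 1 by rewrite -order_gt1 oy prime_gt1.
have Cy := not_deficient Gy ny ndy.
have sylP := self_cent_prime_Sylow Gy (etrans (congr1 prime oy) pr_x) Cy.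
have oP: #|<[y]>| = #[x] by rewrite -orderE.
rewrite oy in sylP.
(* As the Sylow [p]-subgroups have order [p], the centralizer of [x] is larger than
  [<[x]>] only if its order has another prime divisor. *)
have [r [pr_r rC] nrx]: exists2 r, prime r /\ r %| #|'C_G[x]| & r != #[x].
  case: (boolP (#[x].-group 'C_G[x])) => [pC | ].
    have := proper_card prop; rewrite -orderE ltnNge.
    have [Q sylQ sCQ] := Sylow_superset (subsetIl G 'C[x]) pC.
    by rewrite -oP (card_Hall sylP) -(card_Hall sylQ) subset_leq_card.
  rewrite /pgroup /pnat cardG_gt0 /= => /allPn[r].
  by rewrite mem_primes => /and3P[? _ ?]; exists r.
have [z] := Cauchy pr_r rC.
case/setIP=> Gz Cz oz.
have nz: z != 1 by rewrite -order_gt1 oz prime_gt1.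
have Cz' : 'C_G[z] = <[z]> by apply: ndef; rewrite ?oz.
have: x \in <[z]> by rewrite -Cz' // inE Gx cent1C.
by move/order_dvdG; rewrite -orderE oz dvdn_prime2 // eq_sym (negPf nrx).
Qed.
End Structure.

(** * Orders and centralizers *)

Section Orders.
Variable gT : finGroupType.
Implicit Types (G P K : {group gT}) (x y z t : gT).

(** As [t] fixes no non-trivial element of [K], the map [k |-> [~ k, t]] is
  injective on [K], hence onto, and [t] inverts each [[~ k, t]]. A group on which
  inversion is an automorphism is abelian. *)
Lemma involution_inverts K t :
  #[t] = 2 -> t \in 'N(K) -> 'C_K[t] = 1 ->
  abelian K /\ {in K, forall k, k ^ t = k^-1}.
Proof.
move=> ot nKt CKt.
have tt: t * t = 1 by apply/eqP; rewrite -expg2 -order_dvdn ot.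
have inj: {in K &, injective (fun k => [~ k, t])}.
  move=> a b Ka Kb /= /eqP; rewrite !commgEl => /eqP e.
  apply/eqP; rewrite eq_mulgV1 -in_set1 -[[set 1]]CKt inE groupM ?groupV //=.
  apply/cent1P/commgP/conjg_fixP; rewrite conjMg conjVg.
  have -> : a ^ t = a * (b^-1 * b ^ t) by rewrite -e mulKVg.
  by rewrite -mulgA mulgK.
have imK: [set [~ k, t] | k in K] = K.
  apply/eqP; rewrite eqEcard card_in_imset // leqnn andbT.
  by apply/subsetP=> _ /imsetP[k Kk ->]; rewrite commgEl groupM ?groupV ?memJ_norm.
have inv: {in K, forall k, k ^ t = k^-1}.
  move=> k; rewrite -{1}imK => /imsetP[a Ka ->].
  by rewrite commgEl conjMg invMg invgK conjVg -conjgM tt conjg1.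
split=> //; apply/centsP=> a Ka b Kb; apply: invg_inj.
by rewrite -inv ?groupM // conjMg !inv // invMg.
Qed.

(** If [g] inverts [x] then [g ^+ 2] centralizes [x], and [g] is a power of [g ^+ 2]
  because its order is odd. *)
Lemma odd_real_trivial G x : odd #|G| -> x \in G -> x^-1 \in x ^: G -> x = 1.
Proof.
move=> oddG Gx /imsetP[g Gg e].
have xg2: x ^ (g ^+ 2) = x by rewrite expgS expg1 conjgM -e conjVg -e invgK.
have cgx: g \in 'C[x].
  have og: odd #[g] by rewrite (oddSg _ oddG) ?cycle_subG.
  have -> : g = (g ^+ 2) ^+ (#[g].+1)./2.
    by rewrite -expgM mul2n even_halfK /= ?og // expgS expg_order mulg1.
  by rewrite groupX // cent1C; apply/cent1P/commgP/conjg_fixP.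
have ex: x^-1 = x by rewrite e; apply/conjg_fixP/commgP/cent1P; rewrite cent1C.
apply/eqP; rewrite -order_eq1 -dvdn1.
have: #[x] %| 2 by rewrite order_dvdn expgS expg1 -{1}ex mulVg.
have: odd #[x] by rewrite (oddSg _ oddG) ?cycle_subG.
by rewrite dvdn1; case: #[x] => [|[|[|n]]] // _ /dvdn_leq; move/(_ isT).
Qed.

Variables (p : nat) (G : {group gT}) (x : gT).
Hypotheses (pr_p : prime p) (D : one_deficient_prime p G x).

Lemma odp_cent y : y \in G -> y != 1 -> #[y] != p -> 'C_G[y] = <[y]>.
Proof. by case: D => _ _ _ _; apply. Qed.

Lemma odp_conj y : y \in G -> #[y] = p -> y \in x ^: G.
Proof. by case: D => _ _ _ + _; apply. Qed.

Lemma odp_Sylow y : y \in G -> prime #[y] -> #[y] != p -> #[y].-Sylow(G) <[y]>.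
Proof.
by move=> Gy pr oy; apply/self_cent_prime_Sylow/odp_cent => //; rewrite -order_gt1 prime_gt1.
Qed.

(** An element of another prime order in the centralizer would itself be centralized
  by [y], hence deficient. *)
Lemma odp_cent_pgroup y : y \in G -> #[y] = p -> p.-group 'C_G[y].
Proof.
move=> Gy oy; apply/pgroupP=> r pr_r rC; rewrite !inE; apply: contraT => nrp.
have [z /setIP[Gz Cz] oz] := Cauchy pr_r rC.
have Cz': 'C_G[z] = <[z]> by apply: odp_cent; rewrite -?order_gt1 ?oz ?prime_gt1.
have: y \in <[z]> by rewrite -Cz' inE Gy cent1C.
by move/order_dvdG; rewrite -orderE oy oz dvdn_prime2 // eq_sym (negPf nrp).
Qed.

(** A power of [y] of prime order [r != p] generates its own centralizer, which
  contains [y]; so [#[y] = r]. If [#[y]] is [p ^ n] with [n > 2], then [y ^+ p] has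
  order different from [p] and is centralized by [y], which is not one of its
  powers. *)
Lemma odp_order y : y \in G -> y != 1 -> prime #[y] \/ #[y] = (p ^ 2)%N.
Proof.
move=> Gy ny; have [r pr_r ry] := pdivP (etrans (order_gt1 y) ny).
have key q : prime q -> q %| #[y] -> #[y] = q \/ q = p.
  move=> pr_q qy; have [z yz oz] : {z | z \in <[y]> & #[z] = q} := Cauchy pr_q qy.
  have Gz: z \in G by apply: subsetP yz; rewrite cycle_subG.
  have nz: z != 1 by rewrite -order_gt1 oz prime_gt1.
  have [e | ne] := eqVneq q p; [by right | left].
  have Cz: 'C_G[z] = <[z]> by apply: odp_cent; rewrite // oz.
  have: y \in <[z]>.
    by rewrite -Cz inE Gy cent1C; apply: subsetP yz; rewrite cycle_subG cent1id.
  by move/order_dvdG; rewrite -orderE oz => yq; apply/eqP; rewrite eqn_dvd yq.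
have [-> | erp] := key r pr_r ry; first by left.
have py: p %| #[y] by rewrite -erp.
have [yp | ] := boolP (p.-nat #[y]); last first.
  rewrite /pnat order_gt0 /= => /allPn[q]; rewrite mem_primes => /and3P[pr_q _ qy] nqp.
  by have [-> | e] := key q pr_q qy; [left | rewrite e inE eqxx in nqp].
have [n oy] : {n | #[y] = (p ^ n)%N} by case/p_natP: yp => // n; exists n.
case: n oy => [|[|[|n]]] oy.
- by rewrite oy dvdn1 in py; have := prime_gt1 pr_p; rewrite (eqP py).
- by left; rewrite oy.
- by right.
have p_gt1 := prime_gt1 pr_p; have p_gt0 := ltnW p_gt1.
have oz: #[y ^+ p] = (p ^ n.+2)%N by rewrite orderXdiv // oy expnS mulKn.
have Cz: 'C_G[y ^+ p] = <[y ^+ p]>.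
  apply: odp_cent; rewrite ?groupX // -?order_gt1 ?oz.
    by rewrite (ltn_exp2l 0) // -{1}(expn0 p) ltn_exp2l.
  by rewrite -{2}(expn1 p) eqn_exp2l.
have: y \in <[y ^+ p]> by rewrite -Cz inE Gy cent1C groupX // cent1id.
by move/order_dvdG; rewrite -orderE oz oy dvdn_Pexp2l // ltnn.
Qed.
End Orders.

(** * Deficient elements of odd order *)

Section OddCase.
Variable gT : finGroupType.
Implicit Types (G P K H : {group gT}) (x y z t : gT).

(** If [H] contains non-trivial elements [h] and [h ^ g], powers of both are equal
  to the unique involution [t] of [H], so [g] centralizes [t] and lies in [H]. Hence
  [H] is a Frobenius complement, and [t] acts on the kernel without fixed points. *)
Lemma unique_involution_Frobenius G H t :
    2.-group H -> H \subset G -> H :!=: G -> t \in H -> #[t] = 2 ->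
    (forall u, u \in H -> #[u] = 2 -> u = t) -> 'C_G[t] = H ->
  exists K : {group gT},
    [/\ [Frobenius G = K ><| H], abelian K & {in K, forall k, k ^ t = k^-1}].
Proof.
move=> H2 sHG neHG Ht ot uniq_t Ct.
have nt: t != 1 by rewrite -order_gt1 ot.
have FrobH: [Frobenius G with complement H].
  rewrite /Frobenius_group_with_complement neHG; apply/normedTI_memJ_P.
  split=> //; first by apply/set0Pn; exists t; rewrite !inE nt.
  move=> h g /setD1P[nh Hh] Gg; rewrite !inE conjg_eq1 nh /=.
  apply/idP/idP=> [Hhg | Hg]; last by rewrite groupJ.
  have [i oi]: exists i, #[h ^+ i] = 2.
    have [n oh] : {n | #[h] = (2 ^ n)%N}.
      by case/p_natP: (mem_p_elt H2 Hh) => // n; exists n.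
    case: n oh => [|n] oh; first by move: nh; rewrite -order_eq1 oh.
    by exists (2 ^ n)%N; rewrite orderXdiv oh ?dvdn_exp2l // expnS mulnK ?expn_gt0.
  have e1: h ^+ i = t by apply: uniq_t; rewrite ?groupX.
  have e2: t ^ g = t by apply: uniq_t; rewrite ?orderJ // -e1 conjXg groupX.
  by rewrite -Ct inE Gg cent1C; apply/cent1P/commgP/conjg_fixP.
have [K FrobG] := Frobenius_kernel_exists FrobH; exists K.
have [defG ntK ntH _ _] := Frobenius_context FrobG.
have [_ _ _ nKH _] := sdprod_context defG.
have [] := @involution_inverts _ K t ot; rewrite ?(subsetP nKH) //.
by apply: (Frobenius_reg_ker FrobG); rewrite !inE nt.
Qed.
(** The centre of a nilpotent group meets the kernel, on which the complement acts
  without fixed points. *)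
Lemma Frobenius_not_nilpotent G K H : [Frobenius G = K ><| H] -> ~~ nilpotent G.
Proof.
move=> FrobG; have [defG ntK ntH _ _] := Frobenius_context FrobG.
have [nsKG sHG _ _ _] := sdprod_context defG.
apply/negP=> nilG; have /trivgPn[z /setIP[Kz /setIP[_ Cz]] nz] := meet_center_nil nilG nsKG ntK.
have /trivgPn[h Hh nh] := ntH.
have: z \in 'C_K[h] by rewrite inE Kz cent1C (subsetP _ _ (subsetP sHG h Hh)) ?sub_cent1.
by rewrite (Frobenius_reg_ker FrobG) ?inE ?nh // (negPf nz).
Qed.

Lemma Frobenius_abelian_solvable G K H :
  [Frobenius G = K ><| H] -> abelian K -> abelian H -> solvable G.
Proof.
move=> FrobG abK abH; have [defG _ _ _ _] := Frobenius_context FrobG.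
have [nsKG _ _ _ _] := sdprod_context defG.
rewrite (series_sol nsKG) abelian_sol //=.
by rewrite -(isog_sol (sdprod_isog defG)) abelian_sol.
Qed.

Variables (G : {group gT}) (p : nat) (x : gT).
Hypotheses (pr_p : prime p) (D : one_deficient_prime p G x).

(** There is an involution [t] by [odd_real_trivial], and it generates its
  centralizer, so [G = K ><| <[t]>] with [K] abelian and inverted by [t]. Then [x]
  is conjugate to [x] and [x^-1] only; these being all the elements of order [p],
  the subgroup [K] has just one subgroup of order [p], so [p = 3] and [K] is cyclic.
  Its order is not [p], as [x] is deficient, so it is 9. *)
Lemma odd_deficient_order : odd p -> [/\ ~~ nilpotent G, solvable G & G \isog 'D_18].
Proof.
move=> odd_p; have [Gx ox prop _ _] := D.
have evG: ~~ odd #|G|.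
  apply/negP=> oddG; have x1: x = 1.
    apply: (odd_real_trivial oddG Gx).
    by apply: (odp_conj D); rewrite ?groupV ?orderV.
  by have := prime_gt1 pr_p; rewrite -ox x1 order1.
have [t Gt ot] : {t | t \in G & #[t] = 2} by apply: Cauchy; rewrite ?dvdn2.
have nt: t != 1 by rewrite -order_gt1 ot.
have np2: p != 2 by apply: contraTneq odd_p => ->.
have Ct: 'C_G[t] = <[t]> by apply: (odp_cent D); rewrite // ot eq_sym.
have neTG: <[t]> != G.
  apply: contraTneq (order_dvdG Gx) => <-.
  by rewrite -orderE ot ox dvdn_prime2.
have [||u|K [FrobG abK inv]] := unique_involution_Frobenius _ _ neTG (cycle_id t) ot _ Ct.
- by rewrite /pgroup -orderE ot pnat_id.
- by rewrite cycle_subG.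
- by rewrite /= cycle2g // !inE => /orP[] /eqP -> //; rewrite order1.
have [defG ntK _ _ _] := Frobenius_context FrobG.
split; [exact: Frobenius_not_nilpotent FrobG | |].
  exact: Frobenius_abelian_solvable FrobG abK (cycle_abelian t).
have [nsKG sTG defKT nKT tiKT] := sdprod_context defG.
have sKG := normal_sub nsKG.
have oG: #|G| = (#|K| * 2)%N by rewrite -(sdprod_card defG) -orderE ot.
have oddK: odd #|K|.
  by have := Frobenius_coprime FrobG; rewrite -orderE ot coprimen2.
have tt: t * t = 1 by apply/eqP; rewrite -expg2 -order_dvdn ot.
have Kt: t \notin K.
  apply/negP=> Kt; have: odd #|<[t]>| by apply: oddSg oddK; rewrite cycle_subG.
  by rewrite -orderE ot.
have Vt : t^-1 = t by apply: (mulIg t); rewrite mulVg tt.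
have oKt k : k \in K -> #[k * t] = 2.
  move=> Kk; apply: nt_prime_order => //.
    by rewrite expg2 -mulgA -{1}Vt -/(k ^ t) inv // mulgV.
  by apply: contra Kt => /eqP/(canRL (mulKg _))->; rewrite mulg1 groupV.
have GK y : y \in G -> y \in K \/ exists2 k, k \in K & y = k * t.
  rewrite -defKT => /mulsgP[k u Kk]; rewrite /= cycle2g // !inE.
  by case/orP=> /eqP -> ->; [left; rewrite mulg1 | right; exists k].
have oddGK y : y \in G -> odd #[y] -> y \in K.
  by move=> /GK[] // [k Kk ->]; rewrite oKt.
have Kx: x \in K by rewrite oddGK // ox.
have KC: K \subset 'C_G[x].
  by rewrite subsetI sKG sub_cent1 (subsetP abK).
have pK : p.-group K := pgroupS KC (odp_cent_pgroup pr_p D Gx ox).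
have conjG y : y \in K -> #[y] = p -> y = x \/ y = x^-1.
  move=> Ky oy; have [g Gg ->] := imsetP (odp_conj D (subsetP sKG y Ky) oy).
  have xK k : k \in K -> x ^ k = x.
    move=> Kk; apply/conjg_fixP/commgP/cent1P; rewrite cent1C.
    by have /setIP[] := subsetP KC k Kk.
  have [Kg | [k Kk ->]] := GK g Gg; first by left; apply: xK.
  by right; rewrite conjgM xK // inv.
have nx: x != 1 by rewrite -order_gt1 ox prime_gt1.
have [p3 oOhm]: p = 3 /\ #|'Ohm_1(K)| = p.
  have sOhm: 'Ohm_1(K) \subset [set 1; x; x^-1].
    rewrite (OhmEabelian pK) ?(abelianS (Ohm_sub 1 K)) //.
    apply/subsetP=> y; rewrite !inE => /andP[Ky yp].
    have [-> // | ny] := eqVneq y 1; rewrite ?eqxx //=.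
    have oy: #[y] = p by apply: nt_prime_order => //; apply/eqP.
    by have [-> | ->] := conjG y Ky oy; rewrite eqxx ?orbT.
  have le3: #|'Ohm_1(K)| <= 3.
    by rewrite (leq_trans (subset_leq_card sOhm)) // -setUA cardsU1 cards2; case: (_ \notin _); case: (_ != _).
  have pO: p %| #|'Ohm_1(K)|.
    have Ox: x \in 'Ohm_1(K).
      rewrite (OhmEabelian pK); last exact: abelianS (Ohm_sub 1 K) abK.
      by rewrite !inE Kx /= expn1 -ox expg_order.
    by have := order_dvdG Ox; rewrite ox.
  have leO := dvdn_leq (cardG_gt0 _) pO.
  have p3: p = 3 by move: odd_p (prime_gt1 pr_p) (leq_trans leO le3); case: (p) => [|[|[|[|n]]]].
  by split=> //; apply/eqP; rewrite eqn_leq leO andbT {1}p3.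
have cycK: cyclic K.
  by have /orP[// | ] := introT (prime_Ohm1P pK ntK) oOhm; rewrite p3.
have sCK: 'C_G[x] \subset K.
  apply/subsetP=> y Cy; apply: oddGK; first by case/setIP: Cy.
  rewrite odd_2'nat; apply: sub_in_pnat (mem_p_elt (odp_cent_pgroup pr_p D Gx ox) Cy).
  by move=> q _; rewrite p3 !inE => /eqP ->.
have oK: #|K| = 9.
  have [c defK] := cyclicP cycK; have Kc: c \in K by rewrite defK cycle_id.
  have nc: c != 1 by rewrite -cycle_eq1 -defK.
  have [pr_c | oc] := odp_order pr_p D (subsetP sKG c Kc) nc; last first.
    by rewrite defK -orderE oc p3.
  have oK: #|K| = #[x].
    rewrite defK -orderE; apply/esym/eqP; rewrite -dvdn_prime2 ?ox //.
    by rewrite -ox [#[c]]orderE -defK order_dvdG.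
  by have := proper_card prop; rewrite ltnNge -orderE -oK subset_leq_card.
have [c defK] := cyclicP cycK.
have oc: #[c] = 9 by rewrite orderE -defK.
have Kc: c \in K by rewrite defK cycle_id.
have oct : #[c * t] = 2 by apply: oKt.
(* The involutions [t] and [c * t] generate [G], which is therefore dihedral. *)
have defG2 : G :=: <<[set t; c * t]>>.
  apply/eqP; rewrite eqEsubset; apply/andP; split; last first.
    by rewrite gen_subG subUset !sub1set Gt groupM // (subsetP sKG).
  have Tt: t \in <<[set t; c * t]>> by rewrite mem_gen ?set21.
  rewrite -{1}defKT mulG_subG defK !cycle_subG Tt andbT.
  have Tct: c * t \in <<[set t; c * t]>> by rewrite mem_gen ?set22.
  by have := groupM Tct (groupVr Tt); rewrite mulgK.
have := @involutions_gen_dihedral _ t (c * t) ot oct.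
rewrite -defG2 oG oK; apply.
by rewrite eq_sym -{2}(mul1g t) (inj_eq (mulIg t)) -order_gt1 oc.
Qed.
End OddCase.

(** * Sylow 2-subgroups with one involution *)

Section UniqueInvolution.
Variable gT : finGroupType.
Implicit Types (G P K H : {group gT}) (x y z t : gT).

Variables (G : {group gT}) (x : gT).
Hypothesis D : one_deficient_prime 2 G x.

(** All involutions are conjugate, and one of them is central in a Sylow
  2-subgroup. *)
Lemma cent1_involution_Sylow u : u \in G -> #[u] = 2 -> 2.-Sylow(G) 'C_G[u].
Proof.
move=> Gu ou; have [P sylP] := Sylow_exists 2 G.
have [sPG pP _] := and3P sylP.
have ntP: P :!=: 1.
  rewrite -rank_gt0 (rank_Sylow sylP) p_rank_gt0 mem_primes cardG_gt0.
  by have := order_dvdG Gu; rewrite ou.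
have ntZ: 'Z(P) != 1 by rewrite center_nil_eq1 ?(pgroup_nil pP).
have [_ dvZ _] := pgroup_pdiv (pgroupS (center_sub P) pP) ntZ.
have [z /setIP[Pz Cz] oz] := Cauchy (isT : prime 2) dvZ.
have Gz := subsetP sPG z Pz.
have [a Ga ->] := imsetP (odp_conj D Gu ou).
have [b Gb defz] := imsetP (odp_conj D Gz oz).
have -> : x = z ^ b^-1 by rewrite defz conjgK.
rewrite -conjgM; set g := _ * a; have Gg: g \in G by rewrite groupM ?groupV.
have -> : 'C_G[z ^ g] = 'C_G[z] :^ g by rewrite conjIg conjGid // -normJ conjg_set1.
rewrite pHallJ //; have pC := odp_cent_pgroup (isT : prime 2) D Gz oz.
suffices defC : P :=: 'C_G[z] by move: sylP; rewrite /pHall defC.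
have sPC: P \subset 'C_G[z] by rewrite subsetI sPG sub_cent1.
exact/esym/(sub_pHall sylP pC sPC)/subsetIl.
Qed.

Lemma deficient_cent_gt2 u : u \in G -> #[u] = 2 -> 2 < #|'C_G[u]|.
Proof.
move=> Gu ou; have [Gx ox prop _ _] := D.
rewrite (card_Hall (cent1_involution_Sylow Gu ou)).
rewrite -(card_Hall (cent1_involution_Sylow Gx ox)) -[in X in X < _]ox.
exact: proper_card.
Qed.

(** A 2-group with one involution is cyclic or generalized quaternion, and its
  elements have order dividing 4 here. If [P != G], then [P] is the complement of a
  Frobenius group with abelian kernel [K]. Any non-trivial [k \in K] generates its
  own centralizer, hence generates [K], and has prime order. Then [P] acts
  faithfully on a cyclic group, so it is abelian, which excludes the quaternion
  group. *)
Lemma unique_involution_case P t :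
    2.-Sylow(G) P -> t \in P -> #[t] = 2 -> (forall u, u \in P -> #[u] = 2 -> u = t) ->
  (nilpotent G /\ (is_cyclic_of_order 4 G \/ G \isog 'Q_8)) \/
  [/\ ~~ nilpotent G, solvable G &
   exists (q : nat) (A B : {group gT}),
     [/\ prime q, q = 1 %[mod 4],
         is_cyclic_of_order q A /\ is_cyclic_of_order 4 B &
         [Frobenius G = A ><| B]]].
Proof.
move=> sylP Pt ot uniq_t; have [sPG pP _] := and3P sylP.
have Gt := subsetP sPG t Pt.
have Ct : 'C_G[t] = P.
  apply: (sub_pHall sylP (odp_cent_pgroup (isT : prime 2) D Gt ot)); rewrite ?subsetIl //.
  rewrite subsetI sPG; apply/subsetP=> g Pg; rewrite cent1C.
  by apply/cent1P/commgP/conjg_fixP/uniq_t; rewrite ?orderJ ?groupJ.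
have ntP: P :!=: 1 by apply/trivgPn; exists t; rewrite -?order_gt1 ?ot.
have orders y : y \in P -> #[y] %| 4.
  move=> Py; have [-> | ny] := eqVneq y 1; first by rewrite order1.
  have [pr_y | -> //] := odp_order (isT : prime 2) D (subsetP sPG y Py) ny.
  by have := mem_p_elt pP Py; rewrite /p_elt pnatE // inE => /eqP ->.
have cycP : cyclic P -> #|P| = 4.
  case/cyclicP=> y defP; have Py: y \in P by rewrite defP cycle_id.
  have := deficient_cent_gt2 Gt ot; rewrite Ct defP -orderE => lt2.
  apply/eqP; rewrite eqn_leq (dvdn_leq _ (orders y Py)) //=.
  by move: (orders y Py) lt2; case: #[y] => [|[|[|[|]]]].
have /orP shapeP : cyclic P || (2 == 2) && (extremal_class P == Quaternion).
  apply/(prime_Ohm1P pP ntP); rewrite (OhmE 1 pP) expn1.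
  suffices -> : <<'Ldiv_2(P)>> = <[t]> by rewrite -orderE ot.
  apply/eqP; rewrite eqEsubset cycle_subG gen_subG; apply/andP; split.
    apply/subsetP=> u; rewrite !inE => /andP[Pu /eqP u2].
    have [-> // | nu] := eqVneq u 1; rewrite (uniq_t u) ?cycle_id //.
    exact: nt_prime_order.
  by rewrite mem_gen // !inE Pt -ot expg_order /=.
have [defP | neP] := eqVneq (P : {set gT}) G.
  left; split; first by rewrite /= -defP (pgroup_nil pP).
  case: shapeP => [cyc | /eqP/quaternion_classP[n n_gt2 isoP]].
    by left; split; rewrite -defP ?cycP.
  right; have [[c y] [oP Pc oc _] _] := generators_quaternion n_gt2 isoP.
  have : #[c] %| 4 by apply: orders.
  rewrite oc => dv4; suffices n3 : n = 3 by rewrite -defP; rewrite n3 in isoP.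
  by case: n {isoP oP oc} n_gt2 dv4 => [|[|[|[|n]]]] //= _; rewrite (@dvdn_Pexp2l 2 _ 2).
right; have [K [FrobG abK inv]] := unique_involution_Frobenius pP sPG neP Pt ot uniq_t Ct.
have [defG ntK _ _ _] := Frobenius_context FrobG.
have [nsKG _ _ nKP _] := sdprod_context defG.
have sKG := normal_sub nsKG.
have /trivgPn[k Kk nk] := ntK; have Gk := subsetP sKG k Kk.
have oddK: odd #|K|.
  have := Frobenius_coprime FrobG; rewrite coprime_sym => co.
  by have [_ dv2 _] := pgroup_pdiv pP ntP; have := coprime_dvdl dv2 co; rewrite coprime2n.
have oddk: odd #[k] by apply: oddSg oddK; rewrite cycle_subG.
have defK: K :=: <[k]>.
  apply/eqP; rewrite eqEsubset cycle_subG Kk andbT -(odp_cent D Gk nk).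
    by rewrite subsetI sKG sub_cent1 (subsetP abK).
  by apply: contraTneq oddk => ->.
have pr_k: prime #[k].
  by have [// | e] := odp_order (isT : prime 2) D Gk nk; rewrite e in oddk.
have abP: abelian P.
  apply/centsP=> a Pa b Pb; apply/eqP; rewrite eq_mulgV1; apply: contraT => nab.
  have kX g : g \in P -> exists i, k ^ g = k ^+ i.
    move=> Pg; have : k ^ g \in K by rewrite memJ_norm ?(subsetP nKP).
    by rewrite defK => /cycleP[i ->]; exists i.
  have [[i ki] [j kj]] := (kX a Pa, kX b Pb).
  have: k \in 'C_K[a * b * (b * a)^-1].
    rewrite inE Kk /= cent1C; apply/cent1P/commute_sym/commgP/conjg_fixP.
    have e : k ^ (a * b) = k ^ (b * a).
      by rewrite !conjgM ki kj !conjXg ki kj -!expgM mulnC.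
    by rewrite conjgM e conjgK.
  by rewrite (Frobenius_reg_ker FrobG) ?inE ?nab ?groupM ?groupV ?groupM // (negPf nk).
have cP: cyclic P.
  case: shapeP => // /eqP/quaternion_classP[n n_gt2 isoP].
  have [[c y] [_ Pc oc /setDP[Py _]] [_ _ cy]] := generators_quaternion n_gt2 isoP.
  have e : c ^ y = c by apply/conjg_fixP/commgP/(centsP abP).
  rewrite cy in e; have: #[c] %| 2 by rewrite order_dvdn expg2 -{1}e mulVg.
  by rewrite oc; case: n n_gt2 {isoP oc} => [|[|[|n]]] //= _; rewrite (@dvdn_Pexp2l 2 _ 1).
split; [exact: Frobenius_not_nilpotent FrobG | exact: Frobenius_abelian_solvable FrobG abK abP |].
exists #|K|, K, P; split=> //.
- by rewrite defK.
- have := Frobenius_dvd_ker1 FrobG; rewrite (cycP cP) => dv.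
  by apply/eqP; rewrite eqn_mod_dvd ?subn1 ?cardG_gt0.
- by rewrite /is_cyclic_of_order defK cycle_cyclic -defK cycP.
Qed.
End UniqueInvolution.

(** * Regular actions on abelian groups *)

Section Norm.
Import FiniteModule GRing.Theory.
Variables (gT : finGroupType) (A R B : {group gT}).
Hypotheses (abA : abelian A) (nAR : R \subset 'N(A)) (nAB : B \subset 'N(A)).
Hypotheses (nRB : B \subset 'N(R)) (regR : 'C_A(R) = 1) (regB : 'C_A(B) = 1).
Hypothesis regRB : semiregular R B.

(** The sum is fixed by [S], and only the neutral element is. *)
Lemma orbit_sum0 (S : {group gT}) (v : fmod_of abA) :
  S \subset 'N(A) -> 'C_A(S) = 1 -> (\sum_(h in S) v ^@ h = 0)%R.
Proof.
move=> nAS CAS; set w := (\sum_(h in S) _)%R.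
have fixw k : k \in S -> (w ^@ k = w)%R.
  move=> Sk; rewrite /w (big_morph (actr^~ k) (actAr k) (act0r _ k)).
  rewrite [in RHS](reindex_inj (mulIg k)) /=.
  apply: eq_big => [h | h Sh]; first by rewrite groupMr.
  by rewrite actrM ?(subsetP nAS).
apply: fmod_inj; rewrite fmval0; apply/set1P; rewrite -[[set 1]]CAS inE fmodP.
apply/centP=> k Sk; apply/commgP/conjg_fixP.
by rewrite -fmvalJ ?(subsetP nAS) // fixw.
Qed.

(** Sum [v ^@ (b ^ k)] over [b \in B] and [k \in R]. For fixed [k] this is a sum
  over a conjugate of [B], so it vanishes. For fixed [b != 1] the map
  [k |-> [~ b, k]] permutes [R], so the sum is that of [v ^@ b] over [R] and
  vanishes too. What remains, for [b = 1], is [#|R|] times [v]. *)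
Lemma regular_semidirect_exponent : {in A, forall a, a ^+ #|R| = 1}.
Proof.
move=> a Aa; pose v := fmod abA a.
have: (\sum_(k in R) \sum_(b in B) v ^@ (b ^ k) = 0)%R.
  apply: big1 => k Rk; have nAk := subsetP nAR k Rk.
  have -> : (\sum_(b in B) v ^@ (b ^ k) = (\sum_(b in B) v ^@ k^-1%g ^@ b) ^@ k)%R.
    rewrite (big_morph (actr^~ k) (actAr k) (act0r _ k)).
    apply: eq_bigr => b Bb; have nAb := subsetP nAB b Bb.
    by rewrite -!actrM ?groupM ?groupV.
  by rewrite orbit_sum0 // act0r.
rewrite exchange_big (bigD1 1) //= [X in (_ + X)%R]big1 ?addr0 => [|b /andP[Bb nb]].
  rewrite (eq_bigr (fun=> v)) => [|k _]; last by rewrite conj1g actr1.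
  by rewrite sumr_const => /(congr1 val) /=; rewrite -[val _]/(fmval _) fmvalZ fmodK.
have nAb := subsetP nAB b Bb; have nRb := subsetP nRB b Bb.
have inj : {in R &, injective (fun k => [~ b, k])}.
  move=> k l Rk Rl /= e; apply/eqP; rewrite eq_mulgV1 -in_set1.
  have Bnb : b \in B^# by rewrite !inE nb.
  rewrite -[[set 1]](regRB Bnb) inE groupM ?groupV //=.
  rewrite cent1C; apply/cent1P/commgP/conjg_fixP; rewrite conjgM.
  by apply: (canLR (conjgK _)); move: e; rewrite !commgEl => /mulgI.
have imR : [set [~ b, k] | k in R] = R.
  apply/eqP; rewrite eqEcard card_in_imset // leqnn andbT.
  by apply/subsetP=> _ /imsetP[k Rk ->]; rewrite commgEr groupM ?memJ_norm ?groupV.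
transitivity (\sum_(k in R) v ^@ b ^@ [~ b, k])%R.
  apply: eq_bigr => k Rk.
  have Rbk : [~ b, k] \in R by rewrite -imR imset_f.
  by rewrite conjg_mulR actrM // (subsetP nAR).
rewrite -(big_imset (fun r => v ^@ b ^@ r)%R inj) /= imR.
exact: orbit_sum0.
Qed.
End Norm.

Section SelfCentralizing.
Variable gT : finGroupType.
Implicit Types (G P K H : {group gT}) (x y z t : gT).

(** Subgroups generated by non-trivial elements are Sylow subgroups, so an element
  that normalizes [<[y]>] from outside has another order. If [<[y]>] is its own
  normalizer, it is a proper Frobenius complement or all of [H]; in the former case,
  the Frattini argument for a Sylow subgroup [<[r]>] of the kernel gives an element
  of order [#[y]] that normalizes [<[r]>]. *)
Lemma prime_order_or_Frobenius_pair H :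
    H :!=: 1 -> {in H^#, forall y, prime #[y] /\ 'C_H[y] = <[y]>} ->
  prime #|H| \/ exists r b, [/\ r \in H^#, b \in H^#, b \in 'N(<[r]>) & #[b] != #[r]].
Proof.
move=> /trivgPn[y Hy ny] selfC.
have sylH z : z \in H^# -> #[z].-Sylow(H) <[z]>.
  by move=> H1z; have [pr Cz] := selfC z H1z; have [_ Hz] := setD1P H1z; apply: self_cent_prime_Sylow.
have H1y: y \in H^# by rewrite !inE ny.
have [pr_y Cy] := selfC y H1y.
have sylY := sylH y H1y; have [sYH _ _] := and3P sylY.
have [sNY | /subsetPn[b /setIP[Hb nYb] Yb]] := boolP ('N_H(<[y]>) \subset <[y]>); last first.
  right; exists y, b; split=> //.
    by rewrite !inE Hb andbT; apply: contraNneq Yb => ->.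
  apply: contra Yb => /eqP oby.
  have sylN: #[y].-Sylow('N_H(<[y]>)) <[y]>.
    by apply: pHall_subl sylY; rewrite ?subsetIl // subsetI sYH normG.
  rewrite (mem_normal_Hall sylN) ?normal_subnorm ?in_setI ?Hb //.
  by rewrite /p_elt oby pnat_id.
have [defH | neqH] := eqVneq <[y]> (H : {set gT}); first by left; rewrite -defH -orderE.
have FrobH : [Frobenius H with complement <[y]>].
  rewrite /Frobenius_group_with_complement neqH; apply/normedTI_memJ_P; split=> //.
    by apply/set0Pn; exists y; rewrite !inE ny cycle_id.
  move=> h g /setD1P[nh Yh] Hg; rewrite !inE conjg_eq1 nh /=.
  apply/idP/idP=> [Yhg | Yg]; last by rewrite groupJ.
  apply: (subsetP sNY); rewrite inE Hg; apply/normP.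
  have eqY z : z \in <[y]> -> z != 1 -> <[z]> = <[y]>.
    move=> Yz nz; apply/eqP; rewrite eqEcard cycle_subG Yz /= -!orderE; apply: eq_leq; apply/eqP.
    have Hz : z \in H by apply: (subsetP sYH).
    have [pr_z _] : prime #[z] /\ 'C_H[z] = <[z]> by apply: selfC; rewrite !inE nz.
    by rewrite eq_sym -dvdn_prime2 // [#[y]]orderE order_dvdG.
  by rewrite -(eqY h Yh nh) -cycleJ [LHS]eqY // ?eqY // conjg_eq1.
right; have [K FrobG] := Frobenius_kernel_exists FrobH.
have [defG ntK _ _ _] := Frobenius_context FrobG.
have [nsKH _ _ _ _] := sdprod_context defG; have sKH := normal_sub nsKH.
have /trivgPn[r Kr nr] := ntK; have Hr := subsetP sKH r Kr.
have H1r : r \in H^# by rewrite !inE nr.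
have [pr_r _] := selfC r H1r.
have sylK : #[r].-Sylow(K) <[r]>.
  by apply: pHall_subl (sylH r H1r); rewrite ?cycle_subG.
have := Frattini_arg nsKH sylK => defF.
have co: coprime #[y] #|K| by rewrite coprime_sym orderE (Frobenius_coprime FrobG).
have dvY: #[y] %| #|'N_H(<[r]>)|.
  by rewrite -(Gauss_dvdr _ co) mul_cardG defF dvdn_mulr ?order_dvdG.
have [b /setIP[Hb nRb] ob] := Cauchy pr_y dvY.
exists r, b; split=> //; first by rewrite !inE Hb -order_gt1 ob prime_gt1.
rewrite ob; apply: contraTneq (order_dvdG Kr) => <-.
by rewrite -prime_coprime.
Qed.
End SelfCentralizing.

(** * Elementary abelian Sylow 2-subgroups *)

Section Elementary.
Variable gT : finGroupType.
Implicit Types (K H : {group gT}) (y z t u : gT).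
Variables (G P : {group gT}) (x : gT).
Hypothesis D : one_deficient_prime 2 G x.
Hypothesis sylP : 2.-Sylow(G) P.

Lemma abelem_involution u : 2.-abelem P -> u \in P^# -> #[u] = 2.
Proof. by move=> abP /setD1P[nu Pu]; apply: abelem_order_p abP Pu nu. Qed.

Lemma abelem_cent1 u : 2.-abelem P -> u \in P^# -> 'C_G[u] = P.
Proof.
move=> abP P1u; have [sPG _ _] := and3P sylP; have [nu Pu] := setD1P P1u.
have Gu := subsetP sPG u Pu.
have ou := abelem_involution abP P1u.
apply/esym/eqP; rewrite eqEcard subsetI sPG sub_cent1 (subsetP (abelem_abelian abP)) //=.
by rewrite (card_Hall sylP) (card_Hall (cent1_involution_Sylow D Gu ou)).
Qed.

(** As [P] is the centralizer of each of its involutions, an element of [G] that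
  conjugates one of them to another normalizes [P]. So [N_G(P)] is transitive on the
  involutions of [P], with stabilizer [P]. *)
Lemma card_norm_abelem : 2.-abelem P -> P :!=: 1 -> #|'N_G(P)| = (#|P| * #|P|.-1)%N.
Proof.
move=> abP /trivgPn[u Pu nu]; have [sPG _ _] := and3P sylP.
have P1u : u \in P^# by rewrite !inE nu.
have sPN : P \subset 'N_G(P) by rewrite subsetI sPG normG.
have cl : u ^: 'N_G(P) = P^#.
  apply/setP=> v; apply/imsetP/setD1P=> [[g /setIP[Gg nPg] ->] | [nv Pv]].
    by rewrite conjg_eq1 memJ_norm.
  have P1v : v \in P^# by rewrite !inE nv.
  have Gu := subsetP sPG u Pu; have Gv := subsetP sPG v Pv.
  have [a Ga eu] := imsetP (odp_conj D Gu (abelem_involution abP P1u)).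
  have [b Gb ev] := imsetP (odp_conj D Gv (abelem_involution abP P1v)).
  exists (a^-1 * b); last by rewrite conjgM eu conjgK.
  have e : u ^ (a^-1 * b) = v by rewrite conjgM eu conjgK.
  have Gab : a^-1 * b \in G by rewrite groupM ?groupV.
  rewrite inE Gab; apply/normP; rewrite -{1}(abelem_cent1 abP P1u) -(abelem_cent1 abP P1v).
  by rewrite -e conjIg conjGid // -normJ conjg_set1.
have C : 'C_('N_G(P))[u] = P.
  apply/eqP; rewrite eqEsubset; apply/andP; split.
    apply: subset_trans (setSI _ (subsetIl G 'N(P))) _.
    by rewrite (abelem_cent1 abP P1u).
  by rewrite subsetI sPN sub_cent1 (subsetP (abelem_abelian abP)).
rewrite -(Lagrange sPN) -[X in #|_ : X|]C index_cent1 cl; congr (_ * _)%N.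
by rewrite [in RHS](cardsD1 1 P) group1.
Qed.

(** A complement [H] of [P] has order [#|P|.-1], and each of its non-trivial
  elements has prime order and generates its own centralizer. By
  [prime_order_or_Frobenius_pair] and [regular_semidirect_exponent], [#|H|] is
  prime. *)
Lemma normal_abelem_case :
    2.-abelem P -> P <| G ->
  [/\ ~~ nilpotent G, solvable G &
     exists (s q : nat) (A B : {group gT}),
       [/\ 0 < s, q = (2 ^ s - 1)%N, prime q,
           is_elementary_abelian 2 s A /\ is_cyclic_of_order q B &
           [Frobenius G = A ><| B]]].
Proof.
move=> abP nsPG; have [Gx ox _ _ _] := D.
have [sPG pP _] := and3P sylP.
have Px : x \in P by rewrite (mem_normal_Hall sylP) // /p_elt ox pnat_id.
have P1x : x \in P^# by rewrite !inE Px -order_gt1 ox.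
have ntP : P :!=: 1 by apply/trivgPn; exists x; rewrite -?order_gt1 ?ox.
have P_gt2 : 2 < #|P| by rewrite -(abelem_cent1 abP P1x) (deficient_cent_gt2 D).
have oN := card_norm_abelem abP ntP.
have defN : 'N_G(P) = G by apply/setIidPl/normal_norm.
have evP : ~~ odd #|P|.
  by have [_ dv _] := pgroup_pdiv pP ntP; rewrite -dvdn2.
have /splitsP[H] := SchurZassenhaus_split (pHall_Hall sylP) nsPG.
case/complP=> tiPH defPH.
have nPH : H \subset 'N(P) by rewrite (subset_trans _ (normal_norm nsPG)) // -defPH mulG_subr.
have sHG : H \subset G by rewrite -defPH mulG_subr.
have defG : P ><| H = G by rewrite sdprodE.
have oH : #|H| = #|P|.-1.
  apply/eqP; rewrite -(eqn_pmul2l (cardG_gt0 P)) -oN defN.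
  by rewrite -(sdprod_card defG).
have oddH : odd #|H|.
  by rewrite oH -subn1 oddB ?cardG_gt0 // (negPf evP).
have ntH : H :!=: 1 by rewrite -cardG_gt1 oH; case: #|P| P_gt2 => [|[|[|]]].
have H1 h : h \in H^# -> [/\ h \in G, prime #[h], odd #[h] & 'C_G[h] = <[h]>].
  case/setD1P=> nh Hh; have Gh := subsetP sHG h Hh.
  have oddh : odd #[h] by apply: oddSg oddH; rewrite cycle_subG.
  have [pr_h | e] := odp_order (isT : prime 2) D Gh nh; last by rewrite e in oddh.
  by split=> //; apply: (odp_cent D) => //; apply: contraTneq oddh => ->.
have reg h : h \in H^# -> 'C_P(<[h]>) = 1.
  move=> H1h; have [_ _ _ Ch] := H1 h H1h; have [_ Hh] := setD1P H1h.
  apply/trivgP; rewrite /= cent_cycle -tiPH subsetI subsetIl /=.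
  rewrite (@subset_trans _ _ <[h]>) ?cycle_subG // -Ch.
  by rewrite setSI.
have pr_H : prime #|H|.
  have [h H1h | // | [r [b [H1r H1b nrb neq]]]] := prime_order_or_Frobenius_pair ntH.
    have [Gh pr_h _ Ch] := H1 h H1h; split=> //.
    have [_ Hh] := setD1P H1h.
    have sH : <[h]> \subset H by rewrite cycle_subG.
    apply/eqP; rewrite eqEsubset sub_cent1_cycle // andbT -Ch.
    by rewrite setSI.
  have [[Gr pr_r oddr Cr] [Gb pr_b oddb Cb]] := (H1 r H1r, H1 b H1b).
  have [[nr Hr] [nb Hb]] := (setD1P H1r, setD1P H1b).
  have nP h : h \in H -> <[h]> \subset 'N(P) by move=> Hh; rewrite cycle_subG (subsetP nPH).
  have regrb : semiregular <[r]> <[b]>.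
    move=> c /setD1P[nc bc]; apply/trivgP.
    have Hc : c \in H by apply: subsetP bc; rewrite cycle_subG.
    have H1c : c \in H^# by rewrite !inE nc.
    have [_ _ _ Cc] := H1 c H1c.
    have sc : <[c]> \subset <[b]> by rewrite cycle_subG.
    have co : coprime #|<[r]>| #|<[b]>|.
      by rewrite -!orderE prime_coprime // dvdn_prime2 // eq_sym.
    rewrite -(coprime_TIg co) subsetI subsetIl /= (subset_trans _ sc) // -Cc.
    by rewrite setSI // cycle_subG.
  have nRb : <[b]> \subset 'N(<[r]>) by rewrite cycle_subG.
  have := regular_semidirect_exponent (abelem_abelian abP) (nP r Hr) (nP b Hb) nRb
    (reg r H1r) (reg b H1b) regrb Px.
  move/eqP; rewrite -order_dvdn ox -orderE dvdn2.
  by rewrite oddr.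
have FrobG : [Frobenius G = P ><| H].
  apply/prime_FrobeniusP => //; split=> //.
  have /trivgPn[h Hh nh] := ntH.
  have H1h : h \in H^# by rewrite !inE nh.
  apply/trivgP; rewrite -(reg h H1h) setIS // centS // cycle_subG //.
have oPs : #|P| = (2 ^ logn 2 #|P|)%N := card_pgroup pP.
split; first exact: Frobenius_not_nilpotent FrobG.
  by apply: Frobenius_abelian_solvable FrobG (abelem_abelian abP) (cyclic_abelian (prime_cyclic pr_H)).
exists (logn 2 #|P|), #|H|, P, H; split=> //.
- by case: (logn 2 _) oPs => // o1; rewrite o1 in P_gt2.
- by rewrite -oPs oH subn1.
- by split; split=> //; apply: prime_cyclic.
Qed.
End Elementary.

(** * The three shapes of a Sylow 2-subgroup *)

Section Shape.
Variable gT : finGroupType.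
Implicit Types (K H : {group gT}) (a b c e g h v y z t u : gT).

Lemma cycle4_involution h v : #[h] = 4 -> v \in <[h]> -> #[v] = 2 -> v = h ^+ 2.
Proof.
move=> oh hv ov; have oh2 : #[h ^+ 2] = 2 by rewrite orderXdiv oh.
have : <[v]> == <[h ^+ 2]>.
  by rewrite (eq_subG_cyclic (cycle_cyclic h)) ?cycle_subG ?mem_cycle // -!orderE ov oh2.
have nv : v != 1 by rewrite -order_gt1 ov.
by rewrite eqEsubset cycle_subG /= => /andP[+ _]; rewrite cycle2g // !inE (negPf nv) => /eqP.
Qed.

Lemma involution_pair_inverts h u :
  #[u] = 2 -> h ^ u = h^-1 -> #[h * u] %| 2.
Proof.
move=> ou hu; rewrite order_dvdn expg2.
have Vu : u^-1 = u by apply: (mulIg u); rewrite mulVg -expg2 -ou expg_order.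
have e : u * (h * u) = h^-1 by rewrite -hu /conjg Vu.
by rewrite -mulgA e mulgV.
Qed.

Lemma cycle4_generator h g : #[h] = 4 -> g \in <[h]> -> #[g] = 4 -> g = h \/ g = h^-1.
Proof.
move=> oh /cyclePmin[i]; rewrite oh => lt4 -> og.
case: i lt4 og => [|[|[|[|i]]]] // _; rewrite ?expg0 ?expg1.
- by rewrite order1.
- by left.
- by rewrite orderXdiv oh.
by move=> _; right; apply/eqP; rewrite eq_sym eq_invg_mul -expgS -oh expg_order.
Qed.

Lemma involution_inv a : a * a = 1 -> a^-1 = a.
Proof. by move=> a2; apply: (mulIg a); rewrite mulVg. Qed.

Lemma order2_mul a : #[a] = 2 -> a * a = 1.
Proof. by move=> oa; rewrite -expg2 -oa expg_order. Qed.

Lemma involutions_commute a b : a * a = 1 -> b * b = 1 -> (a * b) * (a * b) = 1 -> commute a b.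
Proof.
move=> a2 b2 /involution_inv; rewrite invMg (involution_inv a2) (involution_inv b2).
exact: esym.
Qed.

Variables (G P : {group gT}) (x : gT).
Hypothesis D : one_deficient_prime 2 G x.
Hypothesis sylP : 2.-Sylow(G) P.

Lemma Sylow2_order y : y \in P -> y != 1 -> #[y] = 2 \/ #[y] = 4.
Proof.
move=> Py ny; have [sPG pP _] := and3P sylP.
have [pr_y | -> //] := odp_order (isT : prime 2) D (subsetP sPG y Py) ny; last by right.
by left; have := mem_p_elt pP Py; rewrite /p_elt pnatE // inE => /eqP.
Qed.

Lemma order4_cent h : h \in G -> #[h] = 4 -> 'C_G[h] = <[h]>.
Proof. by move=> Gh oh; apply: (odp_cent D); rewrite -?order_gt1 ?oh. Qed.

(** Let [z] be a central involution of [P] and [u] another one, and suppose that [P]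
  has elements of order 4. Such an element [h] generates its centralizer, so
  [z = h ^+ 2] and [u] does not commute with [h]. Hence [E = C_P(u)] has exponent 2
  and is proper, and some [h] of order 4 normalizes [E]. The element [u * u ^ h] of
  [E] is fixed by [h], so it is [z], which means that [u] inverts [h]. *)
Lemma Sylow2_shape :
 [\/ exists t, [/\ t \in P, #[t] = 2 & forall u, u \in P -> #[u] = 2 -> u = t],
     2.-abelem P
   | #|P| = 8 /\ exists h u, [/\ h \in P, u \in P, #[h] = 4, #[u] = 2 & h ^ u = h^-1]].
Proof.
have [sPG pP _] := and3P sylP; have [Gx ox _ _ _] := D.
have ntP : P :!=: 1.
  rewrite -rank_gt0 (rank_Sylow sylP) p_rank_gt0 mem_primes cardG_gt0.
  by have := order_dvdG Gx; rewrite ox.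
have ntZ: 'Z(P) != 1 by rewrite center_nil_eq1 ?(pgroup_nil pP).
have [_ dvZ _] := pgroup_pdiv (pgroupS (center_sub P) pP) ntZ.
have [z /setIP[Pz Cz] oz] := Cauchy (isT : prime 2) dvZ.
have [uniq | /forall_inPn[u Pu]] := boolP [forall (u | u \in P), (#[u] == 2) ==> (u == z)].
  constructor 1; exists z; split=> // u Pu ou.
  by have /forall_inP/(_ u Pu) := uniq; rewrite ou => /eqP.
rewrite negb_imply => /andP[/eqP ou nuz].
have [exp2 | /subsetPn[y Py]] := boolP (P \subset [set y | y ^+ 2 == 1]).
  constructor 2; apply/abelemP => //; split=> [|a Pa].
    apply/centsP=> a Pa b Pb.
    have sq c : c \in P -> c * c = 1 by move/(subsetP exp2); rewrite inE => /eqP.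
    by apply: involutions_commute; rewrite sq ?groupM.
  by have := subsetP exp2 a Pa; rewrite inE => /eqP.
rewrite inE => y2; constructor 3.
have sq h : h \in P -> #[h] = 4 -> z = h ^+ 2.
  move=> Ph oh; apply: cycle4_involution => //.
  rewrite -(order4_cent (subsetP sPG h Ph) oh) inE (subsetP sPG) //=.
  by rewrite cent1C (subsetP _ h Ph) // sub_cent1.
have not_comm h : h \in P -> #[h] = 4 -> h \notin 'C[u].
  move=> Ph oh; apply: contra nuz; rewrite (sq h Ph oh) cent1C => Cu; apply/eqP.
  apply: cycle4_involution => //.
  by rewrite -(order4_cent (subsetP sPG h Ph) oh) inE (subsetP sPG).
have oy : #[y] = 4.
  have ny : y != 1 by apply: contraNneq y2 => ->; rewrite expg1n.
  by have [e | //] := Sylow2_order Py ny; rewrite -e expg_order eqxx in y2.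
pose E := 'C_P[u].
have prE : E \proper P.
  by rewrite properE subsetIl; apply/subsetPn; exists y; rewrite // inE Py not_comm.
have Eu : u \in E by rewrite inE Pu cent1id.
have invE e : e \in E -> e * e = 1.
  case/setIP=> Pe Ce; have [-> | ne] := eqVneq e 1; first by rewrite mulg1.
  have [oe | oe] := Sylow2_order Pe ne; first by rewrite -expg2 -oe expg_order.
  by rewrite (negPf (not_comm e Pe oe)) in Ce.
have [h /setIP[Ph nEh] [Eh oh]] : exists2 h, h \in 'N_P(E) & h \notin E /\ #[h] = 4.
  have /properP[_ [h Nh Eh]] := nilpotent_proper_norm (pgroup_nil pP) prE.
  have [Ph nEh] := setIP Nh.
  have nh : h != 1 by apply: contraNneq Eh => ->.
  have [oh | oh] := Sylow2_order Ph nh; last by exists h.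
  have NE : E \subset 'N_P(E) by rewrite subsetI subsetIl normG.
  (* If [h] were an involution outside [E], then [h * u] has order 4, since [h] does
    not commute with [u]. *)
  exists (h * u); first by rewrite groupM // (subsetP NE).
  have Ehu : h * u \notin E by rewrite groupMr.
  split=> //; have Phu : h * u \in P by rewrite groupM.
  have nhu : h * u != 1 by apply: contraNneq Ehu => ->.
  have [ohu | //] := Sylow2_order Phu nhu.
  case/negP: Eh; rewrite inE Ph; apply/cent1P.
  by apply: involutions_commute; apply: order2_mul.
have u2 := order2_mul ou; have Vu := involution_inv u2.
have z2 : z = h ^+ 2 by apply: sq.
have nhu := not_comm h Ph oh.
have Gh := subsetP sPG h Ph.
have hu : h ^ u = h^-1.
  pose c := u * u ^ h.
  have Euh : u ^ h \in E by rewrite memJ_norm.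
  have Ec : c \in E by rewrite groupM.
  have ch : c ^ h = c.
    rewrite conjMg -conjgM -expg2 -z2.
    have -> : u ^ z = u by apply/conjg_fixP/commgP/esym/(centP Cz).
    by case/setIP: Euh => _ /cent1P.
  have nc : c != 1.
    apply: contra nhu => /eqP c1; rewrite cent1C; apply/cent1P/commgP/conjg_fixP.
    by rewrite -[RHS]Vu; apply: (mulgI u); rewrite mulgV.
  have cz : c = z.
    rewrite z2; apply: cycle4_involution => //.
      rewrite -(order4_cent Gh oh) inE (subsetP sPG) ?(subsetP (subsetIl P 'C[u])) //=.
      by rewrite cent1C; apply/cent1P/commute_sym/commgP/conjg_fixP.
    by apply: nt_prime_order => //; rewrite expg2 invE.
  have uh : u ^ h = u * z by rewrite -cz mulgA u2 mul1g.
  have e1 : u * h = h * u * z by rewrite conjgC uh mulgA.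
  have Czu : commute z u by apply: (centP Cz).
  have -> : h ^ u = h * z by rewrite conjgE Vu mulgA e1 -!mulgA Czu (mulgA u u) u2 mul1g.
  by apply/eqP; rewrite eq_sym eq_invg_mul z2 -!expgS -oh expg_order.
split; last by exists h, u.
(* The normalizer [M] of [<[h]>] in [P] has order 8, as [<[h]>] is the centralizer
  of [h]. Its elements outside [<[h]>] have order 2, so whatever normalizes [M]
  normalizes [<[h]>]; normalizers grow in [P], so [M = P]. *)
pose M := 'N_P(<[h]>).
have nu1 : u \notin <[h]>.
  by apply: contra nhu => uh; rewrite cent1C (subsetP _ u uh) // cycle_subG cent1id.
have Mu : u \in M by rewrite inE Pu; apply/normP; rewrite -cycleJ hu cycleV.
have sM : <[h]> \subset M by rewrite subsetI normG cycle_subG Ph.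
have sMu : <[h]> :* u \subset M.
  by apply/subsetP=> _ /rcosetP[k hk ->]; rewrite groupM // (subsetP sM).
have leM : #|M| <= 8.
  have Mh : h \in M by rewrite -cycle_subG.
  have -> : #|M| = (#|'C_M[h]| * #|h ^: M|)%N by rewrite -index_cent1 Lagrange ?subsetIl.
  apply: (@leq_mul _ _ 4 2).
    rewrite -oh orderE -(order4_cent Gh oh) subset_leq_card // setSI //.
    by rewrite (subset_trans _ sPG) ?subsetIl.
  apply: (@leq_trans #|[set h; h^-1]|); last by rewrite cards2; case: (_ != _).
  apply/subset_leq_card/subsetP=> _ /imsetP[g /setIP[Pg nhg] ->].
  have [||-> | ->] := @cycle4_generator h (h ^ g) oh; rewrite ?orderJ ?set21 ?set22 //.
  by rewrite memJ_norm ?cycle_id.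
have oM : <[h]> :|: <[h]> :* u = M /\ #|M| = 8.
  have oU : #|<[h]> :|: <[h]> :* u| = 8.
    rewrite cardsU card_rcoset -orderE oh disjoint_setI0 ?cards0 //.
    apply/pred0P=> k /=; apply/negP=> /andP[hk /rcosetP[l hl e]].
    by case/negP: nu1; rewrite -(mulKg l u) -e groupM ?groupV.
  have sUM : <[h]> :|: <[h]> :* u \subset M by rewrite subUset sM.
  have eU : <[h]> :|: <[h]> :* u = M by apply/eqP; rewrite eqEcard sUM oU.
  by split=> //; rewrite -eU.
have [eM oM8] := oM; rewrite -oM8.
have [-> // | neq] := eqVneq M P.
have prM : M \proper P by rewrite properEneq neq subsetIl.
have /properP[_ [g /setIP[Pg nMg] /negP[]]] := nilpotent_proper_norm (pgroup_nil pP) prM.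
rewrite inE Pg; apply/normP.
have Mhg : h ^ g \in M by rewrite memJ_norm // -cycle_subG.
suffices hgh : h ^ g \in <[h]>.
  rewrite -cycleJ; have [|->|->] := cycle4_generator oh hgh; rewrite ?orderJ ?cycleV //.
move: Mhg; rewrite -{1}eM => /setUP[// | /rcosetP[k hk e]].
have : #[h ^ g] %| 2.
  rewrite e; apply: involution_pair_inverts => //.
  by have /cycleP[i ->] := hk; rewrite conjXg hu expgVn.
by rewrite orderJ oh.
Qed.
End Shape.

(** * Products of two involutions *)

Section Inverters.
Variable gT : finGroupType.
Implicit Types (G K H : {group gT}) (a b c g h u v w y z : gT).

Definition involutions (A : {set gT}) := [set u in A | #[u] == 2].

(** The pairs of involutions of [A] whose product is [w]: [u] is paired with
  [u * w]. Each such [u] inverts [w]. *)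
Definition inverters (A : {set gT}) w :=
  [set u in involutions A | u * w \in involutions A].

Lemma mem_involutions (A : {set gT}) u : (u \in involutions A) = (u \in A) && (#[u] == 2).
Proof. by rewrite inE. Qed.

(** Every ordered pair of involutions has exactly one product. *)
Lemma sum_inverters G : (\sum_(w in G) #|inverters G w| = #|involutions G| ^ 2)%N.
Proof.
under eq_bigr => w _ do rewrite -sum1dep_card.
rewrite (exchange_big_dep (mem (involutions G))) /=; last by move=> w u _; rewrite inE => /andP[].
rewrite (eq_bigr (fun=> #|involutions G|)) => [|u Ju].
  by rewrite sum_nat_const mulnn.
rewrite sum1dep_card -[RHS](card_imset _ (mulgI u^-1)).
apply: eq_card => w; apply/idP/imsetP => [| [v Jv ->]]; rewrite !inE.
  by case/andP=> Gw /andP[_ Juw]; exists (u * w); rewrite ?inE // mulKg.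
have [/andP[Gu ou] /andP[Gv ov]] : (u \in G) && (#[u] == 2) /\ (v \in G) && (#[v] == 2).
  by rewrite -!mem_involutions.
by rewrite mulKVg groupM ?groupV // Gu ou Gv ov.
Qed.

Lemma inverters1 G : inverters G 1 = involutions G.
Proof. by apply/setP=> u; rewrite !inE mulg1 andbb. Qed.

Lemma invertersJ G w g : g \in G -> #|inverters G (w ^ g)| = #|inverters G w|.
Proof.
move=> Gg; rewrite -[RHS](card_imset _ (conjg_inj g)); apply: eq_card => u.
apply/idP/imsetP=> [|[v + ->]]; rewrite !inE; last by rewrite -conjMg !orderJ !groupJr.
case/and3P=> /andP[Gu ou] Guw ouw.
exists (u ^ g^-1); rewrite ?conjgKV // !inE orderJ ou groupJ ?groupV //=.
by rewrite -(orderJ _ g) conjMg conjgKV ouw -(groupJr _ Gg) conjMg conjgKV Guw.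
Qed.

Lemma inverts_of_pair G w u : u \in inverters G w -> w ^ u = w^-1.
Proof.
rewrite !inE => /and3P[/andP[_ /eqP/order2_mul u2] _ /eqP/order2_mul uw2].
rewrite conjgE (involution_inv u2); apply: (mulIg w); rewrite mulVg -uw2.
by rewrite !mulgA.
Qed.

(** The group generated by [w] and [u] is dihedral, and [w] is not an involution. *)
Lemma inverter_mulX G w u j :
  2 < #[w] -> u \in inverters G w -> u * w ^+ j \in involutions G.
Proof.
move=> w_gt2 Iu; have wu := inverts_of_pair Iu.
have /andP[Gu /eqP ou] : (u \in G) && (#[u] == 2) by move: Iu; rewrite !inE => /andP[].
have Gw : w \in G.
  by move: Iu; rewrite !inE => /andP[_ /andP[Guw _]]; rewrite groupMl in Guw.
rewrite inE groupM ?groupX //=; apply/eqP/nt_prime_order => //.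
  have u2 := order2_mul ou.
  have e : u * (w ^+ j * u) = (w ^+ j)^-1.
    by rewrite -{1}(involution_inv u2) -conjgE conjXg wu expgVn.
  by rewrite expg2 mulgA -(mulgA u) e mulVg.
apply: contraTneq w_gt2 => e; rewrite -leqNgt dvdn_leq // order_dvdn expg2.
have eu : u = (w ^+ j)^-1 by apply: (mulIg (w ^+ j)); rewrite e mulVg.
have cwu : w ^ u = w by apply/conjg_fixP/commgP; rewrite eu; apply/commuteV/commuteX.
by rewrite -{1}cwu wu mulVg.
Qed.

(** The quotient of two elements inverting [w] centralizes [w], so the set is a
  coset of [<[w]>]. *)
Lemma card_inverters_real G w u :
    'C_G[w] = <[w]> -> w \in G -> 2 < #[w] -> u \in inverters G w ->
  #|inverters G w| = #[w].
Proof.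
move=> Cw Gw w_gt2 Iu; have wu := inverts_of_pair Iu.
have /andP[Gu /eqP ou] : (u \in G) && (#[u] == 2) by move: Iu; rewrite !inE => /andP[].
rewrite orderE -(card_lcoset <[w]> u); apply: eq_card => v; rewrite mem_lcoset -Cw.
apply/idP/idP=> [Iv | ].
  have Gv : v \in G by move: Iv; rewrite !inE => /andP[/andP[]].
  rewrite inE groupM ?groupV //= cent1C; apply/cent1P/commgP/conjg_fixP.
  have wV : w ^ u^-1 = w^-1.
    by apply: (conjg_inj u); rewrite conjgKV conjVg wu invgK.
  by rewrite conjgM wV conjVg (inverts_of_pair Iv) invgK.
rewrite Cw => uv; have {uv} [i ->]: exists i, v = u * w ^+ i.
  by have /cycleP[i e] := uv; exists i; rewrite -e mulKVg.
by rewrite inE (inverter_mulX _ w_gt2 Iu) -mulgA -expgSr (inverter_mulX _ w_gt2 Iu).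
Qed.

Lemma prime_cycle_eq y z : prime #[y] -> z \in <[y]> -> z != 1 -> <[z]> = <[y]>.
Proof.
move=> pr_y yz nz; apply/eqP; rewrite eqEcard cycle_subG yz /= -!orderE eq_leq //.
have : #[z] %| #[y] by rewrite [#[y]]orderE order_dvdG.
by case/primeP: pr_y => _ /(_ #[z]) H /H; rewrite order_eq1 (negPf nz) => /eqP.
Qed.

Section D.
Variables (G : {group gT}) (x : gT).
Hypothesis D : one_deficient_prime 2 G x.

Section W.
Variable w : gT.
Hypotheses (Gw : w \in G) (pr_w : prime #[w]) (w2 : #[w] != 2).

Let nw : w != 1. Proof. by rewrite -order_gt1 prime_gt1. Qed.
Let Cw : 'C_G[w] = <[w]>. Proof. exact: (odp_cent D). Qed.
Let sWG : <[w]> \subset G. Proof. by rewrite cycle_subG. Qed.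
Let oddw : odd #[w]. Proof. by have [/eqP|] := even_prime pr_w; rewrite ?(negPf w2). Qed.

(** The conjugates of [<[w]>] intersect trivially, and by Sylow they contain all
  elements of order [#[w]]. *)
Lemma card_order_prime :
  (#|[set y in G | #[y] == #[w]]| * #|'N_G(<[w]>)| = #[w].-1 * #|G|)%N.
Proof.
have TI : normedTI <[w]>^# G 'N_G(<[w]>).
  apply/normedTI_memJ_P; split; rewrite ?subsetIl //.
    by apply/set0Pn; exists w; rewrite !inE nw cycle_id.
  move=> a g /setD1P[na wa] Gg; rewrite in_setD1 conjg_eq1 na in_setI Gg /=.
  apply/idP/idP=> [wag | /normP nwg]; last by rewrite -nwg memJ_conjg.
  apply/normP; rewrite -{1}(prime_cycle_eq pr_w wa na) -cycleJ (prime_cycle_eq pr_w wag) //.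
  by rewrite conjg_eq1.
have defS : class_support <[w]>^# G = [set y in G | #[y] == #[w]].
  apply/setP=> y; apply/imset2P/setIdP=> [[a g /setD1P[na wa] Gg ->] | [Gy /eqP oy]].
    split; first by rewrite groupJ // (subsetP sWG).
    by rewrite orderJ !orderE (prime_cycle_eq pr_w wa na).
  have sylw := odp_Sylow D Gw pr_w w2.
  have sYG : <[y]> \subset G by rewrite cycle_subG.
  have pY : #[w].-group <[y]> by rewrite /pgroup -orderE oy pnat_id.
  have [g Gg sy] := Sylow_Jsub sylw sYG pY.
  exists (y ^ g) g^-1; rewrite ?groupV ?conjgK // !inE conjg_eq1 -order_eq1 oy order_eq1 nw.
  by rewrite -cycle_subG cycleJ.
rewrite -defS (card_support_normedTI TI) -mulnA (mulnC #|G : _|) Lagrange ?subsetIl //.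
by rewrite orderE [in RHS](cardsD1 1) group1.
Qed.

Variable u : gT.
Hypothesis Iu : u \in inverters G w.
Let wu : w ^ u = w^-1 := inverts_of_pair Iu.
Let Ju : u \in involutions G. Proof. by move: Iu; rewrite !inE => /andP[]. Qed.
Let Gu : u \in G. Proof. by case/setIdP: Ju. Qed.
Let ou : #[u] = 2. Proof. by case/setIdP: Ju => _ /eqP. Qed.

Let regW a : #[a] = 2 -> a \in G -> 'C_(<[w]>)[a] = 1.
Proof.
move=> oa Ga; apply/trivgP/subsetP=> c /setIP[wc Cc]; rewrite inE; apply: contraT => nc.
have eC := prime_cycle_eq pr_w wc nc.
have Gc := subsetP sWG c wc.
have oc : #[c] = #[w] by rewrite !orderE eC.
have: a \in <[w]> by rewrite -eC -(odp_cent D Gc nc) ?oc // inE Ga cent1C.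
by move/order_dvdG; rewrite oa -orderE dvdn2 oddw.
Qed.

(** The involution [a] acts on [<[w]>] without fixed points, so it inverts [w], as
  [u] does. Hence [u * a] is in [<[w]>], and it commutes with [u]. *)
Lemma inverter_unique a : a \in 'C_('N_G(<[w]>))[u] -> #[a] = 2 -> a = u.
Proof.
case/setIP=> /setIP[Ga nwa] Cau oa.
have [_ inv] := involution_inverts oa nwa (regW oa Ga).
have wua : w ^ (u * a) = w by rewrite conjgM wu conjVg inv ?cycle_id ?invgK.
have wua' : u * a \in <[w]>.
  by rewrite -Cw inE groupM //= cent1C; apply/cent1P/commgP/conjg_fixP.
have : u * a \in 'C_<[w]>[u] by rewrite inE wua' /= groupM ?cent1id.
rewrite regW // => /set1P/(canRL (mulKg u)) ->.
by rewrite mulg1 involution_inv // order2_mul.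
Qed.

(** The elements of the normalizer conjugate [u] to the elements inverting [w],
  which form the coset [u <[w]>], and already [<[w]>] is transitive on this
  coset. *)
Lemma card_norm_real : #|'N_G(<[w]>)| = (#[w] * #|'C_('N_G(<[w]>))[u]|)%N.
Proof.
have nwu : u \in 'N(<[w]>) by apply/normP; rewrite -cycleJ wu cycleV.
have Nu : u \in 'N_G(<[w]>) by rewrite inE Gu.
rewrite -(Lagrange (subsetIl 'N_G(<[w]>) 'C[u])) index_cent1 mulnC; congr (_ * _)%N.
apply/eqP; rewrite eqn_leq; apply/andP; split.
  rewrite orderE -(card_lcoset <[w]> u) subset_leq_card //.
  apply/subsetP=> _ /imsetP[n /setIP[Gn nwn] ->]; rewrite mem_lcoset -Cw.
  rewrite inE groupM ?groupV ?groupJ //= cent1C; apply/cent1P/commgP/conjg_fixP.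
  have wV : w ^ u^-1 = w^-1.
    by apply: (conjg_inj u); rewrite conjgKV conjVg wu invgK.
  rewrite conjgM wV conjVg.
  have /cycleP[i e] : w ^ n^-1 \in <[w]> by rewrite memJ_norm ?cycle_id ?groupV.
  have -> : w ^ (u ^ n) = w^-1; last by rewrite invgK.
  rewrite [u ^ n]conjgE !conjgM e conjXg wu expgVn conjVg -e conjgKV //.
rewrite orderE.
have <- : #|u ^: <[w]>| = #|<[w]>|.
  by rewrite -index_cent1 /= (regW ou Gu) indexg1.
by apply/subset_leq_card/imsetS; rewrite subsetI sWG normG.
Qed.
End W.
End D.
End Inverters.

(** * Counting by element orders *)

Section Counts.
Variable gT : finGroupType.
Implicit Types (a b c g h u v w y z : gT).

Definition of_order (G : {group gT}) n := [set y in G | #[y] == n].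

(** The odd primes [r] for which some element of order [r] is inverted by an
  involution; by [card_inverters_odd] this then holds for all elements of order
  [r]. *)
Definition real_primes (G : {group gT}) :=
  [seq r <- primes #|G| | (r != 2) && [exists w in of_order G r, inverters G w != set0]].

Lemma sum_of_order (G : {group gT}) n (f : gT -> nat) :
  (\sum_(w in of_order G n) f w = \sum_(w in G) (#[w] == n) * f w)%N.
Proof.
rewrite (eq_bigl (fun w => (w \in G) && (#[w] == n))) => [|w]; last by rewrite inE.
by rewrite big_mkcondr; apply: eq_bigr => w _; case: eqP; rewrite ?mul1n.
Qed.

Variables (G : {group gT}) (x : gT).
Hypothesis D : one_deficient_prime 2 G x.

Lemma real_primesP r :
  reflect (exists w u, [/\ w \in G, prime #[w], #[w] != 2, #[w] = r & u \in inverters G w])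
          (r \in real_primes G).
Proof.
rewrite mem_filter mem_primes; apply: (iffP idP).
  case/andP=> /andP[r2 /exists_inP[w /setIdP[Gw /eqP ow] /set0Pn[u Iu]]] /and3P[pr_r _ _].
  by exists w, u; rewrite ow.
case=> w [u [Gw pr_w w2 <- Iu]]; rewrite w2 pr_w cardG_gt0 order_dvdG // !andbT.
by apply/exists_inP; exists w; rewrite ?inE ?Gw ?eqxx //; apply/set0Pn; exists u.
Qed.

(** Sylow subgroups of order [#[w]] are conjugate, so one element of that order is
  inverted by an involution if and only if all are. *)
Lemma card_inverters_odd w :
    w \in G -> prime #[w] -> #[w] != 2 ->
  #|inverters G w| = if #[w] \in real_primes G then #[w] else 0%N.
Proof.
move=> Gw pr_w w2; have nw : w != 1 by rewrite -order_gt1 prime_gt1.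
have gt2 : 2 < #[w] by rewrite ltn_neqAle eq_sym w2 prime_gt1.
case: real_primesP => [[w0 [u [Gw0 pr_w0 w02 e Iu]]] | nex]; last first.
  apply/eqP; rewrite cards_eq0; apply/set0Pn=> -[u Iu]; case: nex.
  by exists w, u.
have sylw := odp_Sylow D Gw pr_w w2; have := odp_Sylow D Gw0 pr_w0 w02.
rewrite e => sylw0; have [g Gg eg] := Sylow_trans sylw0 sylw.
have /cycleP[i ew] : w \in <[w0 ^ g]> by rewrite cycleJ -eg cycle_id.
rewrite ew -conjXg invertersJ // conjXg -ew.
have gt20 : 2 < #[w0] by rewrite e.
have w0i : #[w0 ^+ i] = #[w] by rewrite ew -conjXg orderJ.
rewrite (@card_inverters_real _ _ _ u) ?w0i ?groupX //.
  by apply: (odp_cent D); rewrite ?groupX // -?order_gt1 w0i // ltnW.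
by rewrite inE -[X in X \in _](mulg1 u) -(expg0 w0) !(inverter_mulX _ gt20 Iu).
Qed.

Lemma odd_primes_sum (f : nat -> nat) w :
  w \in G -> (\sum_(r <- real_primes G) (#[w] == r) * f r)%N
     = if #[w] \in real_primes G then f #[w] else 0%N.
Proof.
move=> Gw; have uq : uniq (real_primes G) by rewrite filter_uniq ?primes_uniq.
case: ifP => [Lw | nLw].
  rewrite (bigD1_seq #[w]) //= eqxx mul1n big1 ?addn0 // => r.
  by rewrite eq_sym => /negPf->.
rewrite big1_seq // => r /= Lr; case: eqP => // e; by rewrite e Lr in nLw.
Qed.

Lemma order_split w : w \in G ->
  [\/ w = 1, #[w] = 2, #[w] = 4 | [/\ prime #[w], #[w] != 2 & w != 1]].
Proof.
move=> Gw; have [-> | nw] := eqVneq w 1; first by constructor 1.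
have [pr_w | e] := odp_order (isT : prime 2) D Gw nw; last by constructor 3.
by have [e | ne] := eqVneq #[w] 2; [constructor 2 | constructor 4].
Qed.

Lemma real_primes_odd r : r \in real_primes G -> [/\ r != 1%N, r != 2 & r != 4].
Proof. by case/real_primesP=> w [u [_ pr_w w2 <- _]]; split=> //; apply: contraTneq pr_w => ->. Qed.

(** This is [sum_inverters] with the products sorted by their order: 1, 2, 4 or an
  odd prime. *)
Lemma involution_count :
  (#|involutions G| ^ 2 = #|involutions G| + \sum_(w in of_order G 2) #|inverters G w|
    + \sum_(w in of_order G 4) #|inverters G w|
    + \sum_(r <- real_primes G) #|of_order G r| * r)%N.
Proof.
rewrite -sum_inverters.
transitivity (\sum_(w in G) ((w == 1%g) * #|inverters G w| + (#[w] == 2) * #|inverters G w|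
   + (#[w] == 4) * #|inverters G w| + \sum_(r <- real_primes G) (#[w] == r) * r))%N.
  apply: eq_bigr => w Gw; rewrite (odd_primes_sum id Gw).
  have [-> | e | e | [pr_w w2 nw]] := order_split Gw.
  - rewrite eqxx order1 /= !mul0n mul1n !addn0; case: ifP; rewrite ?addn0 //.
    by case/real_primes_odd; rewrite eqxx.
  - rewrite -order_eq1 e /=; case: ifP => [/real_primes_odd[]|]; rewrite ?eqxx //.
    by rewrite !mul0n mul1n !addn0.
  - rewrite -order_eq1 e /=; case: ifP => [/real_primes_odd[]|]; rewrite ?eqxx //.
    by rewrite !mul0n mul1n !addn0.
  have -> : (#[w] == 4) = false by apply: contraTF pr_w => /eqP->.
  by rewrite (negPf nw) (negPf w2) !mul0n -card_inverters_odd.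
rewrite !big_split /=; congr (_ + _ + _ + _)%N.
- rewrite (bigD1 1) //= eqxx mul1n inverters1 big1 ?addn0 // => w /andP[_ /negPf->].
  by rewrite mul0n.
- by rewrite sum_of_order.
- by rewrite sum_of_order.
rewrite exchange_big /=; apply: eq_bigr => r _; rewrite -big_distrl /=; congr (_ * _)%N.
by rewrite -sum1_card sum_of_order; apply: eq_bigr => w _; rewrite muln1.
Qed.

Lemma order_count :
  1 + #|of_order G 2| + #|of_order G 4| + \sum_(r <- real_primes G) #|of_order G r| <= #|G|.
Proof.
have -> : (1 + #|of_order G 2| + #|of_order G 4| + \sum_(r <- real_primes G) #|of_order G r| =
  \sum_(w in G) ((w == 1%g) + (#[w] == 2) + (#[w] == 4)
   + \sum_(r <- real_primes G) (#[w] == r) * 1))%N.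
  rewrite !big_split /=; congr (_ + _ + _ + _)%N.
  - by rewrite (bigD1 1) //= eqxx big1 // => w /andP[_ /negPf->].
  - by rewrite -sum1_card sum_of_order; apply: eq_bigr => w _; rewrite muln1.
  - by rewrite -sum1_card sum_of_order; apply: eq_bigr => w _; rewrite muln1.
  rewrite exchange_big /=; apply: eq_bigr => r _.
  by rewrite -sum1_card sum_of_order.
rewrite -sum1_card; apply: leq_sum => w Gw; rewrite (odd_primes_sum (fun=> 1%N) Gw).
have [-> | e | e | [pr_w w2 nw]] := order_split Gw.
- by rewrite eqxx order1; case: ifP => [/real_primes_odd[]|].
- by rewrite -order_eq1 e; case: ifP => [/real_primes_odd[]|].
- by rewrite -order_eq1 e; case: ifP => [/real_primes_odd[]|].
have -> : (#[w] == 4) = false by apply: contraTF pr_w => /eqP->.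
by rewrite (negPf nw) (negPf w2); case: ifP.
Qed.
End Counts.

(** * The count for elementary abelian Sylow 2-subgroups *)

Section InvolutionCount.
Variable gT : finGroupType.
Implicit Types (a b c g h u v w y z : gT).
Variables (G : {group gT}) (x : gT).
Hypothesis D : one_deficient_prime 2 G x.

Lemma involutions_class : involutions G = x ^: G.
Proof.
have [Gx ox _ cx _] := D; apply/setP=> u; apply/setIdP/imsetP => [[Gu /eqP ou] | [g Gg ->]].
  exact/imsetP/cx.
by rewrite groupJ // orderJ ox.
Qed.

Lemma involutions_of_order2 : of_order G 2 = involutions G. Proof. by []. Qed.

Lemma card_involutions (P : {group gT}) : 2.-Sylow(G) P -> (#|involutions G| * #|P| = #|G|)%N.
Proof.
move=> sylP; have [Gx ox _ _ _] := D.
rewrite (card_Hall sylP) -(card_Hall (cent1_involution_Sylow D Gx ox)).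
by rewrite involutions_class -index_cent1 mulnC Lagrange ?subsetIl.
Qed.

(** Here [u] inverts an element [w] of order [r], and [E] is the centralizer of [u]
  in [N_G(<[w]>)]. It acts on [<[w]>] without fixed points, as an element of [E]
  commuting with a generator of [<[w]>] would be in [<[w]>], whose non-trivial
  elements do not commute with [u]; so its order divides [r.-1]. *)
Lemma real_prime_card r : r \in real_primes G ->
  exists (E : {group gT}) u,
   [/\ [/\ prime r, 2 < r & r %| #|G|],
       (#|of_order G r| * (r * #|E|) = r.-1 * #|G|)%N, #|E| %| r.-1
     & [/\ u \in involutions G, E \subset 'C_G[u], u \in E & forall a, a \in E -> #[a] = 2 -> a = u]].
Proof.
case/real_primesP=> w [u [Gw pr_w w2 er Iu]].
have nw : w != 1 by rewrite -order_gt1 prime_gt1.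
have gt2 : 2 < #[w] by rewrite ltn_neqAle eq_sym w2 prime_gt1.
have Ju : u \in involutions G by move: Iu; rewrite !inE => /andP[].
have [Gu /eqP ou] := setIdP Ju.
have wu := inverts_of_pair Iu.
have nwu : u \in 'N(<[w]>) by apply/normP; rewrite -cycleJ wu cycleV.
exists 'C_('N_G(<[w]>))[u]%G, u; rewrite -er; split.
- by rewrite pr_w order_dvdG.
- by rewrite -(card_order_prime D Gw pr_w w2) -(card_norm_real D Gw pr_w w2 Iu).
- rewrite orderE; apply: regular_norm_dvd_pred.
    by rewrite (subset_trans (subsetIl _ _)) ?subsetIr.
  move=> a /setD1P[na /setIP[/setIP[Ga nwa] Cua]]; apply/trivgP/subsetP=> c.
  case/setIP=> wc Cac; rewrite inE; apply: contraT => nc.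
  have ec := prime_cycle_eq pr_w wc nc.
  have Gc : c \in G by rewrite -cycle_subG ec cycle_subG.
  have wa : a \in <[w]>.
    have Cc : 'C_G[c] = <[c]> by apply: (odp_cent D) => //; rewrite orderE ec -orderE.
    by rewrite -ec -Cc inE Ga cent1C.
  have ea := prime_cycle_eq pr_w wa na.
  have : u \in <[a]>.
    have Ca : 'C_G[a] = <[a]> by apply: (odp_cent D) => //; rewrite orderE ea -orderE.
    by rewrite -Ca inE Gu cent1C.
  rewrite ea => /order_dvdG; rewrite ou -orderE dvdn_prime2 // eq_sym.
  by rewrite (negPf w2).
split=> //; last by move=> a; apply: (inverter_unique D Gw pr_w w2 Iu).
  by rewrite setSI ?subsetIl.
by rewrite !in_setI Gu nwu cent1id.
Qed.

(** For [k] elements of order [r] in a group of order [m], with [r * e] the order of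
  the normalizer of a subgroup of order [r]: a lower bound [c / d] for
  [r.-1 / (r * e)] bounds the fraction [k / m]. *)
Lemma order_fraction (r e k m c d : nat) :
  (0 < r * e -> k * (r * e) = r.-1 * m -> c * (r * e) <= d * r.-1 -> c * m <= d * k)%N.
Proof.
move=> pos E le; rewrite -(leq_pmul2r pos).
have -> : (d * k * (r * e) = d * r.-1 * m)%N by rewrite -mulnA E mulnA.
by rewrite mulnAC leq_mul2r le orbT.
Qed.

(** The product of two distinct involutions is an involution if and only if they
  commute. *)
Lemma involutions_of_cent w : w \in involutions G ->
  inverters G w = involutions 'C_G[w] :\ w.
Proof.
case/setIdP=> Gw /eqP ow; have w2 := order2_mul ow.
apply/setP=> u; rewrite in_setD1 inE !mem_involutions in_setI; apply/idP/idP.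
  case/and3P=> /andP[Gu ou] Guw ouw; rewrite Gu ou !andbT /=.
  have u2 := order2_mul (eqP ou); have uw2 := order2_mul (eqP ouw).
  apply/andP; split; first by apply: contraTneq ouw => ->; rewrite w2 order1.
  by apply/cent1P; apply: involutions_commute.
case/and3P=> uw /andP[Gu Cu] ou; rewrite Gu ou groupM //=; apply/eqP.
have u2 := order2_mul (eqP ou).
apply: nt_prime_order => //.
  by rewrite expgMn ?expg2 ?u2 ?w2 ?mulg1 //; apply/esym/cent1P; rewrite cent1C.
by apply: contra uw => /eqP e; apply/eqP/(mulIg w); rewrite e w2.
Qed.

Lemma card_involutionsJ (A : {set gT}) g : #|involutions (A :^ g)| = #|involutions A|.
Proof.
rewrite -[RHS](cardJg _ g); apply: eq_card => u.
by rewrite mem_conjg !inE mem_conjg orderJ.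
Qed.

Lemma sum_inverters_involutions (P : {group gT}) : 2.-Sylow(G) P ->
  (\sum_(w in of_order G 2) #|inverters G w| = #|involutions G| * #|involutions P|.-1)%N.
Proof.
move=> sylP; rewrite -sum_nat_const; apply: eq_bigr => w Jw.
rewrite involutions_of_cent //; have /setIdP[Gw /eqP ow] := Jw.
have [g _ defP] := Sylow_trans sylP (cent1_involution_Sylow D Gw ow).
rewrite -(card_involutionsJ P g) -defP [in RHS](cardsD1 w) /=.
by have -> : w \in involutions 'C_G[w] by rewrite mem_involutions in_setI Gw cent1id ow.
Qed.

Section Abelem.
Variable P : {group gT}.
Hypotheses (sylP : 2.-Sylow(G) P) (abP : 2.-abelem P).

Lemma abelem_no_order4 : of_order G 4 = set0.
Proof.
apply/setP=> y; rewrite !inE; apply/andP=> -[Gy /eqP oy].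
have sYG : <[y]> \subset G by rewrite cycle_subG.
have pY : 2.-group <[y]> by rewrite /pgroup -orderE oy.
have [g Gg sy] := Sylow_Jsub sylP sYG pY.
have Py : y ^ g \in P by rewrite -cycle_subG cycleJ.
have ny : y ^ g != 1 by rewrite conjg_eq1 -order_gt1 oy.
by have := abelem_order_p abP Py ny; rewrite orderJ oy.
Qed.

Lemma card_involutions_abelem : #|involutions P| = #|P|.-1.
Proof.
rewrite [in RHS](cardsD1 1) group1 /=; apply: eq_card => y; rewrite !inE andbC.
apply: andb_id2r => Py; apply/eqP/idP => [oy | ny]; first by rewrite -order_gt1 oy.
exact: (abelem_order_p abP Py ny).
Qed.

(** The group [E] of [real_prime_card] lies in the centralizer of an involution, a
  Sylow 2-subgroup. It has exponent 2 and only one involution, hence order 2. *)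
Lemma abelem_real_prime_card r : r \in real_primes G ->
  [/\ prime r, 2 < r, r %| #|G| & (#|of_order G r| * (r * 2) = r.-1 * #|G|)%N].
Proof.
case/real_prime_card=> E [u [[pr_r r2 rG] eq _ [Ju sEC Eu uniq]]]; split=> //.
rewrite -eq; congr (_ * (_ * _))%N; have /setIdP[Gu /eqP ou] := Ju.
suffices -> : E :=: [set 1; u] by rewrite cards2 eq_sym -order_gt1 ou.
apply/eqP; rewrite eqEsubset subUset !sub1set group1 Eu !andbT.
apply/subsetP=> a Ea; rewrite !inE; have [// | na] := eqVneq a 1; apply/eqP/uniq => //=.
have /setIP[Ga _] := subsetP sEC a Ea.
have C2 := odp_cent_pgroup (isT : prime 2) D Gu ou.
have [/eqP | // | oa | [pr_a a2 _]] := order_split D Ga; first by rewrite (negPf na).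
  by have := in_set0 a; rewrite -abelem_no_order4 inE Ga oa.
have := mem_p_elt C2 (subsetP sEC a Ea); rewrite /p_elt pnatE // inE => /eqP e.
by rewrite e in a2.
Qed.

(** The equation of [involution_count], divided by the number of involutions. *)
Lemma abelem_count : 
  (#|involutions G| * 2 = #|P|.-1 * 2 + #|P| * \sum_(r <- real_primes G) r.-1)%N.
Proof.
have I0 : 0 < #|involutions G|.
  by rewrite card_gt0; apply/set0Pn; have [Gx ox _ _ _] := D; exists x; rewrite inE Gx ox.
have P1 : 1 < #|P|.
  have [Gx ox _ _ _] := D; have := deficient_cent_gt2 D Gx ox.
  by rewrite (card_Hall sylP) -(card_Hall (cent1_involution_Sylow D Gx ox)) => /ltnW.
apply/eqP; rewrite -(eqn_pmul2l I0); apply/eqP.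
have := involution_count D; rewrite (sum_inverters_involutions sylP).
rewrite abelem_no_order4 big_set0 addn0 card_involutions_abelem -mulnS.
have e : (\sum_(r <- real_primes G) #|of_order G r| * r * 2 = #|involutions G| * (#|P| * \sum_(r <- real_primes G) r.-1))%N.
  rewrite mulnA card_involutions // big_distrr /= big_seq [RHS]big_seq.
  apply: eq_bigr => r Lr; have [_ _ _ e] := abelem_real_prime_card Lr.
  by rewrite -mulnA e mulnC.
rewrite -big_distrl /= in e => cnt.
rewrite mulnA mulnn cnt mulnDl e mulnDr -!mulnA; congr (_ * (_ * _) + _)%N.
by move: P1; case: #|P| => [|[|n]].
Qed.

(** Elements of order [r] make up the fraction [r.-1 / (2 * r)] of [G]: a third for
  [r = 3], and at least two fifths for [r > 3]. Three primes leave no room for the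
  identity. *)
Lemma abelem_two_real : size (real_primes G) <= 2.
Proof.
rewrite leqNgt; apply/negP=> lt2; have := order_count D.
have bound r : r \in real_primes G ->
  r = 3 /\ #|G| <= 3 * #|of_order G r| \/ 3 < r /\ 2 * #|G| <= 5 * #|of_order G r|.
  move=> /abelem_real_prime_card[pr_r r2 _ e].
  have pos : 0 < r * 2 by lia.
  have [r3 | r3] := eqVneq r 3; [left | right]; split; try lia.
  have : r != 4 by apply: contraTneq pr_r => ->.
  by move=> r4; apply: (@order_fraction r 2 _ _ 2 5 pos e); lia.
have : uniq (real_primes G) by rewrite filter_uniq ?primes_uniq.
move: lt2 bound; case: (real_primes G) => [|r1 [|r2 [|r3 L]]] //= _ bound.
rewrite !inE !negb_or !big_cons => /and3P[/and3P[n12 n13 _] /andP[n23 _] _].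
have b1 := bound r1; have b2 := bound r2; have b3 := bound r3.
move: b1 b2 b3 {bound}; rewrite !inE !eqxx ?orbT => /(_ isT) b1 /(_ isT) b2 /(_ isT) b3.
have := cardG_gt0 G.
move: n12 n13 n23 b1 b2 b3.
set m := #|G|; set m1 := #|_|; lia.
Qed.
End Abelem.
End InvolutionCount.

(** * Two Diophantine equations *)

(** The equation of [abelem_count] for a single prime [r], where [n] is the order of
  [P] and [i] the number of involutions. It implies that [n.-1] divides [r.-1] and
  that [r] divides [n - 2]. *)
Lemma one_real_prime_absurd n r i : 3 < n -> prime r -> 2 < r -> coprime r n ->
  (i * 2 = n.-1 * 2 + n * r.-1)%N -> n.-1 %| i -> r %| i -> False.
Proof.
move=> n4 pr_r r2 co e dn dr.
have d1 : n.-1 %| r.-1.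
  have con : coprime n.-1 n by rewrite -{2}(ltn_predK n4) coprimenS.
  have : n.-1 %| n.-1 * 2 + n * r.-1 by rewrite -e dvdn_mulr.
  by rewrite (dvdn_addr _ (dvdn_mulr 2 (dvdnn _))) (Gauss_dvdr _ con).
have d2 : r %| n - 2.
  have e2 : (i * 2 = n * r + (n - 2))%N by rewrite e -{2}(prednK (ltnW (ltnW r2))) mulnS; lia.
  have : r %| n * r + (n - 2) by rewrite -e2 dvdn_mulr.
  by rewrite (dvdn_addr _ (dvdn_mull n (dvdnn r))).
have := dvdn_leq (_ : 0 < r.-1) d1; have := dvdn_leq (_ : 0 < n - 2) d2; lia.
Qed.

(** The case of [two_real_primes] in which [r1], but not [r2], divides [q = n.-1].
  Comparing sizes, [q = r1] and [r2 = r1 + 2]. One of [r1], [r1 + 1] and [r1 + 2] is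
  divisible by 3; it is not the power [r1 + 1] of 2, so it is a prime equal to 3,
  which can only be [r1]. *)
Lemma twin_real_primes q r1 r2 k : 2 < q -> 2.-nat q.+1 ->
  prime r1 -> prime r2 -> 2 < r1 -> 2 < r2 ->
  (q.+1 * (r1 + r2) = 2 * k * r1 * r2 + 2)%N -> q %| k * r1 * r2 ->
  q %| r1 + r2 - 2 -> r1 %| q -> ~~ (r2 %| q) -> [/\ q = 3, r1 = 3 & r2 = 5].
Proof.
move=> q2 qn p1 p2 r1_2 r2_2 e dv dvs /dvdnP[k' ek'] nr2.
have r1_0 : 0 < r1 by lia.
have /dvdnP[j ej] : k' %| k.
  have co : coprime k' r2.
    by rewrite coprime_sym prime_coprime //; apply: contra nr2 => d; rewrite ek' dvdn_mulr.
  have : k' * r1 %| k * r2 * r1 by rewrite -ek' mulnAC.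
  by rewrite dvdn_pmul2r // Gauss_dvdl.
have /dvdnP[m em] := dvs.
have e1 : (q.+1 * (r1 + r2) = 2 * j * q * r2 + 2)%N by rewrite e ej ek' !mulnA.
have j0 : 0 < j.
  by have := leq_pmull (r1 + r2) (ltn0Sn q); rewrite e1; case: (j) => [|?] //; lia.
have m0 : 0 < m by case: (m) em => //; lia.
(* If [k' > 1] then [r1 <= q / 2], so [r2] exceeds [q / 2] and the right-hand side
  of the equation is too large. *)
have [k1 | k1] := leqP k' 1; last first.
  have : 2 * r1 <= q by rewrite ek' leq_mul2r k1 orbT.
  have : q + 2 <= r1 + r2 by have := leq_pmull q m0; lia.
  have : 2 * q * r2 + 2 <= q.+1 * (r1 + r2) by have := leq_pmull (q * r2) j0; lia.
  move=> h3 h2 h1.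
  case: q q2 h1 h2 h3 {qn nr2 e dv dvs ek' em e1} => // q' _ h1 h2 h3.
  have h4 : (q'.+1 + 2) * q' <= (r1 + r2) * q' by rewrite leq_mul2r h2 orbT.
  have h5 : 2 * r1 * q'.+1 <= q'.+1 * q'.+1 by rewrite leq_mul2r h1 orbT.
  lia.
have eq : q = r1 by case: k' k1 ek' {ej} => [|[|k']] //; lia.
rewrite eq in q2 qn e1 em *.
case: m em m0 => [|[|m]] em _ //; first by lia.
(* The quotient of [r1 + r2 - 2] by [r1] is not 1, as [r2 > 2]; the next steps show
  that it is 2. *)
have er2 : r2 = (2 + m.+1 * r1)%N by lia.
have e2 : (m.+2 * r1 + m + 4 = 2 * j * r2)%N.
  by apply/eqP; rewrite -(eqn_pmul2l r1_0); apply/eqP; move: e1; rewrite er2; lia.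
have jr : r2 <= j * r2 by rewrite leq_pmull.
have mr : m * 3 <= m * r1 by rewrite leq_mul2l r1_2 orbT.
have {jr mr} m0 : m = 0 by lia.
rewrite m0 in er2.
have : 3 %| r1 \/ 3 %| r1.+1 \/ 3 %| r2 by lia.
case=> [| [d3 |]].
- by rewrite dvdn_prime2 // => /eqP e3; split; lia.
- by have := pnat_dvd d3 qn.
by rewrite dvdn_prime2 // => /eqP; lia.
Qed.

(** The equation of [abelem_count] for two primes, with [n] the order of [P] and
  [k * r1 * r2] the number of involutions. Modulo [q = n.-1], a divisor of that
  number, it says that [q] divides [r1 + r2 - 2]. If both primes divide [q], then
  [r1 * r2 <= r1 + r2 - 2]; if none does, then [q] divides [k]; both contradict the
  sizes. *)
Lemma two_real_primes n r1 r2 k : 3 < n -> 2.-nat n ->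
  prime r1 -> prime r2 -> 2 < r1 -> 2 < r2 -> r1 != r2 ->
  (n * (r1 + r2) = 2 * k * r1 * r2 + 2)%N -> n.-1 %| k * r1 * r2 ->
  n = 4 /\ (r1 = 3 /\ r2 = 5 \/ r1 = 5 /\ r2 = 3).
Proof.
case: n => // q; rewrite /= ltnS => q2 qn p1 p2 r1_2 r2_2 r12 e dv.
have dvs : q %| r1 + r2 - 2.
  have e2 : (2 * (k * r1 * r2) = q * (r1 + r2) + (r1 + r2 - 2))%N by lia.
  have : q %| q * (r1 + r2) + (r1 + r2 - 2) by rewrite -e2 dvdn_mull.
  by rewrite (dvdn_addr _ (dvdn_mulr (r1 + r2) (dvdnn q))).
have r12a : 3 * r1 <= r1 * r2 by rewrite mulnC leq_mul2l r2_2 orbT.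
have r12b : 3 * r2 <= r1 * r2 by rewrite leq_mul2r r1_2 orbT.
have [d1 | d1] := boolP (r1 %| q); have [d2 | d2] := boolP (r2 %| q).
- have co : coprime r1 r2 by rewrite prime_coprime // dvdn_prime2.
  have d12 : r1 * r2 %| q by rewrite Gauss_dvd // d1 d2.
  have q0 : 0 < q by lia.
  have s0 : 0 < r1 + r2 - 2 by rewrite subn_gt0 ltn_addr.
  have le1 := dvdn_leq q0 d12; have le2 := dvdn_leq s0 dvs.
  by move: {e dv dvs d1 d2 d12 co qn} r12a r12b le1 le2; lia.
- by have [-> -> ->] := twin_real_primes q2 qn p1 p2 r1_2 r2_2 e dv dvs d1 d2; auto.
- have := @twin_real_primes q r2 r1 k q2 qn p2 p1 r2_2 r1_2.
  rewrite addnC mulnAC (mulnAC k) => /(_ e dv dvs d2 d1)[-> -> ->]; auto.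
have dk : q %| k.
  move: dv; rewrite Gauss_dvdl ?Gauss_dvdl // coprime_sym prime_coprime //.
have k0 : 0 < k by case: (k) e => //; lia.
have qk := dvdn_leq k0 dk.
have h1 : q * (r1 * r2) <= k * (r1 * r2) by rewrite leq_mul2r qk orbT.
have h2 : q * (3 * r1) <= q * (r1 * r2) by rewrite leq_mul2l r12a orbT.
have h3 : q * (3 * r2) <= q * (r1 * r2) by rewrite leq_mul2l r12b orbT.
have h4 : 2 * r1 <= q * r1 by rewrite leq_mul2r ltnW ?orbT.
have h5 : 2 * r2 <= q * r2 by rewrite leq_mul2r ltnW ?orbT.
by move: {dv dvs dk d1 d2 qn} e h1 h2 h3 h4 h5; lia.
Qed.

Lemma two_primes_equation n k r1 r2 : 0 < n -> 0 < r1 -> 0 < r2 ->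
  (k * (r1 * r2) * 2 = n.-1 * 2 + n * (r1.-1 + r2.-1) -> n * (r1 + r2) = 2 * k * r1 * r2 + 2)%N.
Proof. by case: n r1 r2 => [|n] [|r1] [|r2] //= _ _ _; lia. Qed.

Lemma two_primes_cofactor k r1 r2 : (4 * (r1 + r2) = 2 * k * r1 * r2 + 2)%N ->
  r1 = 3 /\ r2 = 5 \/ r1 = 5 /\ r2 = 3 -> k = 1%N.
Proof. by move=> e [] [e1 e2]; rewrite e1 e2 in e; lia. Qed.

Section Order60.
Variable gT : finGroupType.
Implicit Types (a b c g h u v w y z : gT).
Variables (G : {group gT}) (x : gT).
Hypothesis D : one_deficient_prime 2 G x.

(** The number of involutions is divisible by [#|P|.-1], because [N_G(P)] has order
  [#|P| * #|P|.-1]. Without real primes, it equals [#|P|.-1] and [P] is normal;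
  otherwise [one_real_prime_absurd] and [two_real_primes] apply. *)
Lemma abelem_order60 (P : {group gT}) :
    2.-Sylow(G) P -> 2.-abelem P -> ~~ (P <| G) ->
  [/\ #|G| = 60, #|P| = 4 & 3 \in real_primes G].
Proof.
move=> sylP abP nP; have [sPG pP _] := and3P sylP; have [Gx ox _ _ _] := D.
have P2 : 2 < #|P|.
  have := deficient_cent_gt2 D Gx ox.
  by rewrite (card_Hall sylP) -(card_Hall (cent1_involution_Sylow D Gx ox)).
have P3 : 3 < #|P|.
  by rewrite ltn_neqAle P2 andbT; apply: contraTneq pP => e; rewrite /pgroup -e.
have ntP : P :!=: 1 by rewrite -cardG_gt1; lia.
have oG := card_involutions D sylP.
have oN := card_norm_abelem D sylP abP ntP.
have P0 := cardG_gt0 P.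
have dn : #|P|.-1 %| #|involutions G|.
  rewrite -(dvdn_pmul2r P0) oG mulnC -oN cardSg ?subsetIl //.
have cnt := abelem_count D sylP abP.
have coP r : prime r -> 2 < r -> coprime r #|P|.
  move=> pr_r r2; rewrite prime_coprime //; apply: contraTN pP => d.
  rewrite /pgroup; apply: contraL r2 => pn; have := pnat_dvd d pn.
  by rewrite pnatE // inE => /eqP ->.
have LI r : r \in real_primes G -> [/\ prime r, 2 < r & r %| #|involutions G|].
  move=> Lr; have [pr_r r2 d _] := abelem_real_prime_card D sylP abP Lr; split=> //.
  by move: d; rewrite -oG Gauss_dvdl ?coP.
have := abelem_two_real D sylP abP.
have : uniq (real_primes G) by rewrite filter_uniq ?primes_uniq.
move: LI cnt; case eL: (real_primes G) => [|r1 [|r2 [|//]]] LI cnt uq _.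
- case/negP: nP; rewrite big_nil muln0 addn0 in cnt.
  have eI : #|involutions G| = #|P|.-1 by lia.
  rewrite /normal sPG; apply/setIidPl/eqP; rewrite eqEcard subsetIl.
  by rewrite oN -oG eI mulnC leqnn.
- have [pr_r r_2 rI] := LI r1 (mem_head _ _).
  rewrite big_seq1 in cnt.
  by have := one_real_prime_absurd P3 pr_r r_2 (coP _ pr_r r_2) cnt dn rI.
have [p1 r1_2 r1I] := LI r1 (mem_head _ _).
have [|p2 r2_2 r2I] := LI r2; first by rewrite !inE eqxx orbT.
rewrite big_cons big_seq1 in cnt.
have r12 : r1 != r2 by move: uq; rewrite /= inE andbT.
have co : coprime r1 r2 by rewrite prime_coprime // dvdn_prime2.
have /dvdnP[k ek] : r1 * r2 %| #|involutions G| by rewrite Gauss_dvd // r1I r2I.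
have r1_0 : 0 < r1 := ltnW (ltnW r1_2); have r2_0 : 0 < r2 := ltnW (ltnW r2_2).
have e : (#|P| * (r1 + r2) = 2 * k * r1 * r2 + 2)%N.
  by apply: two_primes_equation P0 r1_0 r2_0 _; rewrite -ek.
rewrite mulnA in ek; rewrite ek in dn.
have [oP r12E] := two_real_primes P3 pP p1 p2 r1_2 r2_2 r12 e dn.
have k1 : k = 1%N by rewrite oP in e; apply: two_primes_cofactor e r12E.
split=> //.
  by rewrite -oG oP ek k1; case: r12E => [[-> ->] | [-> ->]].
by case: r12E => [[-> ->] | [-> ->]]; rewrite !inE.
Qed.
End Order60.

(** * The count for dihedral Sylow 2-subgroups *)

(** A real prime [r > 4] satisfies the hypothesis of [order_fraction] with the
  fraction [1 / 5]. *)
Lemma order4_fraction r e : 4 < r -> e = 2 \/ e = 4 -> 1 * (r * e) <= 5 * r.-1.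
Proof. by move=> r5 [] ->; lia. Qed.

(** Here and in [dihedral_two_real], [i] is the number of involutions in a group of
  order [8 * i]; [a3] counts the elements of order 3, and [a] those of order [r]. *)
Lemma dihedral_one_real i a3 : 0 < i ->
  (i * i = 13 * i + a3 * 3 -> a3 * (3 * 2) = 2 * (i * 8) -> i = 21)%N.
Proof. by move=> i0 e1 e2; apply/eqP; rewrite -(eqn_pmul2l i0); lia. Qed.

Lemma dihedral_two_real i a3 a r e : 0 < i -> 0 < r -> e = 2 \/ e = 4 ->
  (i * i = 13 * i + (a3 * 3 + a * r) -> a3 * (3 * 2) = 2 * (i * 8) ->
   a * (r * e) = r.-1 * (i * 8) -> e = 2 /\ i = 17 + 4 * r \/ e = 4 /\ i = 19 + 2 * r)%N.
Proof.
move=> i0 r0 eE e1 e2 e3.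
have er : (r.-1 * (i * 8) + i * 8 = r * (i * 8))%N by rewrite -{2}(prednK r0) mulSn addnC.
by case: eE => ee; rewrite ee in e3; [left | right]; split=> //;
  apply/eqP; rewrite -(eqn_pmul2l i0); lia.
Qed.

(** The elements of orders 1, 2, 4, 3 and of two more odd prime orders: the
  fractions of the group are [1 / 8], [1 / 4], [1 / 3] and twice at least [1 / 5],
  more than the whole. *)
Lemma too_many_elements m i a1 a2 a3 n2 n4 : 0 < i -> m = (i * 8)%N -> n2 = i -> (n4 * 4 = m)%N ->
  (a1 * (3 * 2) = 2 * m)%N -> 8 * i <= 5 * a2 -> 8 * i <= 5 * a3 -> m < 1 + n2 + n4 + (a1 + (a2 + a3)).
Proof. by move=> *; lia. Qed.

Section Dihedral8.
Variable gT : finGroupType.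
Implicit Types (a b c g h u v w y z : gT).
Variables (G : {group gT}) (x : gT).
Hypothesis D : one_deficient_prime 2 G x.
Variables (P : {group gT}) (h u : gT).
Hypotheses (sylP : 2.-Sylow(G) P) (oP : #|P| = 8) (Ph : h \in P) (Pu : u \in P).
Hypotheses (oh : #[h] = 4) (ou : #[u] = 2) (hu : h ^ u = h^-1).

Let sPG : P \subset G. Proof. by case/and3P: sylP. Qed.
Let Gh : h \in G. Proof. exact: (subsetP sPG). Qed.
Let Gu : u \in G. Proof. exact: (subsetP sPG). Qed.
Let u2 : u * u = 1. Proof. exact: order2_mul. Qed.
Let hV : h != h^-1.
Proof.
apply: contra_eq_neq oh => e; have : #[h] %| 2 by rewrite order_dvdn expg2 {1}e mulVg.
by apply: contraTneq => ->.
Qed.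

Let nhu : u \notin <[h]>.
Proof.
apply: contra hV => uh; rewrite -hu eq_sym; apply/eqP/conjg_fixP/commgP.
by have /cycleP[i ->] := uh; apply: commuteX.
Qed.

(** The coset [<[h]> u] consists of involutions. *)
Lemma dihedral8_elements y : y \in P -> y \in <[h]> \/ #[y] = 2 /\ h ^ y = h^-1.
Proof.
have -> : P :=: <[h]> :|: <[h]> :* u.
  apply/esym/eqP; rewrite eqEcard; apply/andP; split.
    rewrite subUset cycle_subG Ph; apply/subsetP=> _ /rcosetP[k hk ->].
    by rewrite groupM // (subsetP _ k hk) // cycle_subG.
  rewrite oP cardsU card_rcoset -orderE oh disjoint_setI0 ?cards0 //.
  apply/pred0P=> k /=; apply/negP=> /andP[hk /rcosetP[l hl e]].
  by case/negP: nhu; rewrite -(mulKg l u) -e groupM ?groupV.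
case/setUP=> [|/rcosetP[k hk ->]]; [by left | right].
have ku : k ^ u = k^-1 by have /cycleP[i ->] := hk; rewrite conjXg hu expgVn.
have hk1 : h ^ k = h by apply/conjg_fixP/commgP; have /cycleP[i ->] := hk; apply: commuteX.
split; last by rewrite conjgM hk1.
have /eqP ku2 : (k * u) ^+ 2 == 1 by rewrite -order_dvdn involution_pair_inverts.
apply: nt_prime_order => //; apply: contra nhu => /eqP e.
by rewrite -(mulKg k u) e mulg1 groupV.
Qed.

Lemma card_involutions_dihedral8 : #|involutions P| = 5.
Proof.
have -> : involutions P = P :\: [set 1; h; h^-1].
  apply/setP=> y; rewrite !inE; apply/andP/andP=> [[Py /eqP oy] | [ny Py]]; split=> //.
    rewrite !negb_or -order_gt1 oy /=; apply/andP; split; apply: contra_eq_neq oy => ->.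
      by rewrite oh.
    by rewrite orderV oh.
  move: ny; rewrite !negb_or => /andP[/andP[ny nyh nyV]].
  have [yh | [-> //]] := dihedral8_elements Py.
  have [e | e4] := Sylow2_order D sylP Py ny; first by rewrite e.
  by have [e | e] := cycle4_generator oh yh e4; rewrite e eqxx in nyh nyV.
rewrite cardsD oP (setIidPr _); last first.
  by rewrite !subUset !sub1set group1 Ph groupV Ph.
rewrite -setUA cardsU1 cards2 hV !inE [1 == h^-1]eq_sym invg_eq1 [1 == h]eq_sym.
by rewrite -order_eq1 oh.
Qed.

Lemma order4_conj y : y \in G -> #[y] = 4 -> y \in h ^: G.
Proof.
move=> Gy oy.
have sYG : <[y]> \subset G by rewrite cycle_subG.
have pY : 2.-group <[y]> by rewrite /pgroup -orderE oy.
have [g Gg sy] := Sylow_Jsub sylP sYG pY.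
have Py : y ^ g \in P by rewrite -cycle_subG cycleJ.
have [yh | [e _]] := dihedral8_elements Py; last by rewrite orderJ oy in e.
have -> : y = (y ^ g) ^ g^-1 by rewrite conjgK.
have [|-> | ->] := cycle4_generator oh yh; rewrite ?orderJ //.
  by rewrite memJ_class ?groupV.
by rewrite -hu -conjgM memJ_class ?groupM ?groupV.
Qed.

Lemma card_order4 : (#|of_order G 4| * 4 = #|G|)%N.
Proof.
have -> : of_order G 4 = h ^: G.
  apply/setP=> y; apply/setIdP/idP => [[Gy /eqP oy] | /imsetP[g Gg ->]].
    exact: order4_conj.
  by rewrite groupJ // orderJ oh.
rewrite -index_cent1 -oh orderE -(order4_cent D Gh oh) mulnC.
by rewrite Lagrange ?subsetIl.
Qed.

Lemma sum_inverters_order4 : (\sum_(w in of_order G 4) #|inverters G w| = #|G|)%N.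
Proof.
rewrite -card_order4 -sum_nat_const; apply: eq_bigr => w /setIdP[Gw /eqP ow].
have [g Gg ->] := imsetP (order4_conj Gw ow).
rewrite invertersJ // (@card_inverters_real _ _ _ u) ?oh //.
  exact: (order4_cent D Gh oh).
rewrite !inE Gu ou groupM //=; apply/eqP/nt_prime_order => //.
  have e : u * (h * u) = h^-1 by rewrite -hu /conjg (involution_inv u2).
  by rewrite expg2 mulgA -(mulgA u) e mulVg.
by apply: contra nhu => /eqP e; rewrite -(mulgK h u) e mul1g groupV cycle_id.
Qed.

(** The centralizer of an involution is conjugate to [P], with 5 involutions, so an
  involution is in 4 ways the product of two; an element of order 4 is inverted by
  an element of [P], so it is a product of two involutions in 4 ways. As there are
  twice as many elements of order 4 as involutions, these products number 4 and 8
  per involution. *)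
Lemma dihedral_count :
  (#|involutions G| ^ 2 = 13 * #|involutions G| + \sum_(r <- real_primes G) #|of_order G r| * r)%N.
Proof.
rewrite (involution_count D) (sum_inverters_involutions D sylP) sum_inverters_order4.
rewrite card_involutions_dihedral8 -(card_involutions D sylP) oP /=.
by congr (_ + _)%N; lia.
Qed.

(** The group [E] of [real_prime_card] has even order dividing 8, and only one
  involution; so it is not a Sylow 2-subgroup. *)
Lemma dihedral_real_prime r : r \in real_primes G -> exists e,
  [/\ prime r, 2 < r & r %| #|G|] /\ 
  [/\ (#|of_order G r| * (r * e) = r.-1 * #|G|)%N, e %| r.-1 & e = 2 \/ e = 4].
Proof.
case/(real_prime_card D)=> E [v [? cnt dv [Jv sEC Ev uniq]]]; exists #|E|; split=> //; split=> //.
have /setIdP[Gv /eqP ov] := Jv.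
have sylC := cent1_involution_Sylow D Gv ov.
have [g _ defP] := Sylow_trans sylP sylC.
have oC : #|'C_G[v]| = 8 by rewrite defP cardJg.
have d8 : #|E| %| 8 by rewrite -oC cardSg.
have d2 : 2 %| #|E| by rewrite -ov order_dvdG.
have n8 : #|E| != 8.
  apply/eqP=> e8; have defE : E :=: 'C_G[v] by apply/eqP; rewrite eqEcard sEC oC e8.
  have : #|involutions E| = 5.
    by rewrite defE -card_involutions_dihedral8 -(card_involutionsJ P g) -defP.
  have : involutions E \subset [set v].
    by apply/subsetP=> a /setIdP[Ea /eqP oa]; rewrite inE (uniq a).
  by move/subset_leq_card; rewrite cards1 => + e; rewrite e.
move: d8 d2 n8; case: #|E| => [|[|[|[|[|[|[|[|[|n]]]]]]]]] //; auto.
Qed.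

(** The four-group [<<[set z; u]>>], with [z = h ^+ 2], is normalized by [h * u],
  which swaps [u] and [z * u]. As [u] is conjugate to [z], it is the square of an
  element [h'] of order 4 that is inverted by [z], and [h' * z] swaps [z] and
  [z * u]. The product of these two involutions permutes the three involutions of
  the four-group cyclically, so its order is divisible by 3, hence equal to 3. *)
Lemma three_real : 3 \in real_primes G.
Proof.
pose z := h ^+ 2.
have oz : #[z] = 2 by rewrite orderXdiv oh.
have Gz : z \in G by rewrite groupX.
have z2 := order2_mul oz.
have nzu : z != u by apply: contraNneq nhu => <-; rewrite mem_cycle.
have hz : z ^ h = z by apply/conjg_fixP/commgP/commute_sym/commuteX.
have uz : z ^ u = z.
  by rewrite /z conjXg hu expgVn; apply: involution_inv.
have Czu : commute z u by apply/commgP/conjg_fixP.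
have uz' : u ^ z = u by apply/conjg_fixP/commgP/commute_sym.
have Cz : 'C_G[z] = P.
  have sPC : P \subset 'C_G[z].
    rewrite subsetI sPG; apply/subsetP=> y Py; rewrite cent1C; apply/cent1P/commgP/conjg_fixP.
    have [/cycleP[i ->] | [_ yu]] := dihedral8_elements Py.
      by apply/conjg_fixP/commgP/commuteX/commute_sym/commuteX.
    by rewrite /z conjXg yu expgVn; apply: involution_inv.
  apply/esym/eqP; rewrite eqEcard sPC.
  by rewrite (card_Hall sylP) (card_Hall (cent1_involution_Sylow D Gz oz)) leqnn.
have /imsetP[k Gk uk] : u \in z ^: G.
  have := odp_conj D Gu ou; rewrite -(class_eqP (odp_conj D Gz oz)) //.
pose h' := h ^ k.
have h'2 : h' ^+ 2 = u by rewrite uk /z conjXg.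
have h'z : h' ^ z = h'^-1.
  have Py : z ^ k^-1 \in P.
    rewrite -Cz inE groupJ ?groupV //= cent1C; apply/cent1P/commgP/conjg_fixP.
    apply: (conjg_inj k); rewrite conjJg -uk conjgKV.
    exact: uz'.
  have [zh | [_ hy]] := dihedral8_elements Py.
    have /(congr1 (conjg^~ k)) := cycle4_involution oh zh (etrans (orderJ _ _) oz).
    by rewrite /= conjgKV -uk => e; rewrite e eqxx in nzu.
  by rewrite -[z in _ ^ z](conjgKV k) /h' -conjJg hy conjVg.
have conj_of a b : a * a = 1 -> b ^ a = b^-1 -> a ^ b = a * b ^+ 2.
  move=> a2 ba; have e : a * (b * a) = b^-1 by rewrite -ba /conjg (involution_inv a2).
  by rewrite expg2 conjgE -e !mulgA -(mulgA _ a a) a2 mulg1.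
have zh' : z ^ h' = z * u by rewrite conj_of // h'2.
have uh : u ^ h = u * z by rewrite conj_of.
pose t := h * u; pose t' := h' * z.
have zt : z ^ t = z by rewrite conjgM hz.
have ut : u ^ t = u * z by rewrite conjgM uh conjMg uz conjgE mulKg.
have zt' : z ^ t' = z * u by rewrite conjgM zh' conjMg uz' conjgE mulKg.
have ut' : u ^ t' = u.
  have uh' : u ^ h' = u by rewrite -h'2; apply/conjg_fixP/commgP/commute_sym/commuteX.
  by rewrite conjgM uh'.
pose g := t * t'.
have zg : z ^ g = z * u by rewrite conjgM zt.
have ug : u ^ g = z by rewrite conjgM ut conjMg ut' zt' Czu mulgA u2 mul1g.
have zug : (z * u) ^ g = u by rewrite conjMg zg ug Czu -mulgA z2 mulg1.
have nu : u != 1 by rewrite -order_gt1 ou.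
have nzuz : z * u != z by apply: contra nu => /eqP e; apply/eqP/(mulgI z); rewrite mulg1.
have dvd3 g0 : z ^ g0 = z * u -> u ^ g0 = z -> (z * u) ^ g0 = u -> forall n, g0 ^+ n = 1 -> 3 %| n.
  move=> z0 u0 zu0 n gn.
  have g3 : g0 ^+ 3 \in 'C[z].
    rewrite cent1C; apply/cent1P/commgP/conjg_fixP.
    by rewrite !expgS expg0 mulg1 !conjgM z0 zu0 u0.
  have : g0 ^+ (n %% 3) \in 'C[z].
    move: gn; rewrite {1}(divn_eq n 3) expgD mulnC expgM => /(canRL (mulKg _)) ->.
    by rewrite mulg1 groupV groupX.
  have := ltn_pmod n (isT : 0 < 3); rewrite /dvdn.
  case: (n %% 3) => [|[|[|m]]] //= _; rewrite cent1C => /cent1P/commgP/conjg_fixP.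
    by rewrite expg1 z0 => e; rewrite e eqxx in nzuz.
  by rewrite expg2 conjgM z0 zu0 => e; rewrite e eqxx in nzu.
have Gt : t \in G by rewrite groupM.
have Gt' : t' \in G by rewrite groupM ?groupJ.
have Gg : g \in G by rewrite groupM.
have Jt : t \in involutions G.
  rewrite inE Gt; have [th | [-> //]] := dihedral8_elements (groupM Ph Pu).
  by rewrite groupMl ?cycle_id // (negPf nhu) in th.
have Jt' : t' \in involutions G.
  rewrite inE Gt'; apply/eqP/nt_prime_order => //.
    by apply/eqP; rewrite -order_dvdn involution_pair_inverts.
  apply/eqP=> e; have : #[h'^-1] = 2 by rewrite -(mulg1 h'^-1) -e mulKg.
  by rewrite orderV orderJ oh.
have og : #[g] = 3.
  have d3 := dvd3 g zg ug zug _ (expg_order g).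
  have [e | e | e | [pr_g _ _]] := order_split D Gg.
  - by rewrite e conjg1 in zg; rewrite -zg eqxx in nzuz.
  - by rewrite e in d3.
  - by rewrite e in d3.
  by apply/eqP; rewrite eq_sym -dvdn_prime2.
apply/real_primesP; exists g, t; rewrite og; split=> //.
rewrite inE Jt /= /g mulgA (order2_mul (_ : #[t] = 2)) ?mul1g //.
by case/setIdP: Jt => _ /eqP.
Qed.

(** The prime 3 is real by [three_real]. If it is the only real prime, the count
  gives [21 * 8] for the order. A second one, [r], would divide the number
  [17 + 4 * r] or [19 + 2 * r] of involutions, so be 17 or 19; but then 3 does not
  divide the order of the group, respectively 4 does not divide [r.-1]. With two
  more there are too many elements. *)
Lemma dihedral_order168 : #|G| = 168.
Proof.
have oG := card_involutions D sylP; rewrite oP in oG.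
have L3 := three_real; have cnt := dihedral_count.
have ocnt := order_count D; have oc4 := card_order4.
have I0 : 0 < #|involutions G| by have := cardG_gt0 G; rewrite -oG; case: #|_|.
have uq : uniq (real_primes G) by rewrite filter_uniq ?primes_uniq.
have [e3 [[_ _ dv3] [c3 d3 e3E]]] := dihedral_real_prime L3.
(* The normalizer of a subgroup of order 3 has order 6, since 4 does not divide
  2. *)
have e32 : e3 = 2 by case: e3E => // e; rewrite e in d3.
rewrite e32 in c3.
pose L := rem 3 (real_primes G).
have LP r : r \in L -> [/\ r \in real_primes G & r != 3].
  by rewrite mem_rem_uniq // inE => /andP[-> ->].
have sumL (f : nat -> nat) : (\sum_(r <- real_primes G) f r = f 3 + \sum_(r <- L) f r)%N.
  by rewrite (big_rem 3).
have bound r : r \in L -> 8 * #|involutions G| <= 5 * #|of_order G r|.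
  case/LP=> Lr r3; have [e [[pr_r r2 _] [c d eE]]] := dihedral_real_prime Lr.
  have r4 : r != 4 by apply: contraTneq pr_r => ->.
  have r5 : 4 < r by move: (r) r2 r3 r4 => [|[|[|[|[|?]]]]].
  have pos : 0 < r * e by rewrite muln_gt0 (prime_gt0 pr_r); case: eE => ->.
  by rewrite (mulnC 8) oG -[X in X <= _]mul1n (order_fraction pos c (order4_fraction r5 eE)).
rewrite -/(of_order G 2) !sumL in cnt ocnt.
have uqL : uniq L by rewrite rem_uniq.
rewrite involutions_of_order2 in ocnt.
case eL: L bound LP cnt ocnt uqL => [|r [|r' L']] bound LP cnt ocnt uqL.
- rewrite !big_nil !addn0 -mulnn in cnt; rewrite -oG in c3.
  by rewrite -oG (dihedral_one_real I0 cnt c3).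
- have [Lr r3] := LP r (mem_head _ _).
  have [e [[pr_r r2 dr] [c d eE]]] := dihedral_real_prime Lr.
  rewrite !big_seq1 in cnt ocnt.
  have coI : coprime r 8.
    apply: (@coprimeXr 3 r 2).
    by rewrite prime_coprime // dvdn_prime2 //; apply: contraTneq r2 => ->.
  have rI : r %| #|involutions G| by rewrite -(Gauss_dvdl _ coI) oG.
  have r_gt0 : 0 < r := prime_gt0 pr_r.
  rewrite -oG in c c3; rewrite -mulnn in cnt.
  have [[_ eI] | [e4 eI]] := dihedral_two_real I0 r_gt0 eE cnt c3 c.
    (* For [r = 17], the group has order [8 * 85], not divisible by 3. *)
    have : r %| 17 by rewrite eI dvdn_addl ?dvdn_mull in rI.
    by rewrite dvdn_prime2 // => /eqP r17; rewrite -oG eI r17 in dv3.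
  have : r %| 19 by rewrite eI dvdn_addl ?dvdn_mull in rI.
  by rewrite dvdn_prime2 // => /eqP r19; rewrite r19 e4 in d.
have b1 := bound r (mem_head _ _).
have L2 : r' \in [:: r, r' & L'] by rewrite !inE eqxx orbT.
have b2 := bound r' L2.
rewrite !big_cons in ocnt.
have many := too_many_elements I0 (esym oG) (erefl _) oc4 c3 b1 b2.
suffices /(leq_trans many) : 1 + #|involutions G| + #|of_order G 4| +
  (#|of_order G 3| + (#|of_order G r| + #|of_order G r'|)) <= #|G| by rewrite ltnn.
by apply: leq_trans ocnt; rewrite !leq_add2l leq_addr.
Qed.
End Dihedral8.

(** * The cubic relation *)

Section Cubic.
Variable gT : finGroupType.
Implicit Types (a g m n u v w y z : gT).
Variables (G N U : {group gT}) (b t u : gT).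
Hypotheses (sNG : N \subset G) (Nb : b \in N) (ob : #[b] = 3) (Gt : t \in G).
Hypotheses (t2 : t * t = 1) (bt : b ^ t = b^-1) (Cb : 'C_G[b] = <[b]>) (nNt : t \notin N).
Hypotheses (sUN : U \subset N) (Uu : u \in U) (nbu : u \notin <[b]>).
Hypothesis NNt : {in N, forall n, n ^ t \in N -> n \in <[b]>}.
Hypothesis coverG : {in G, forall g, g \in N \/ exists n v, [/\ n \in N, v \in U & g = n * t * v]}.
Hypothesis coverU : {in U, forall v, v != 1 -> exists i, v = u ^ (b ^+ i) \/ v = u^-1 ^ (b ^+ i)}.
Hypothesis oddN : odd #|N| \/ u^-1 = u.

(** The elements [s i = t * b ^- i] of the coset [<[b]> t] are all involutions
  inverting [b]. Since [t u t] is not in [N], it is [n t v] with [v] a conjugate of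
  [u] or [u^-1] by a power of [b], and for a suitable [r = s i] one gets
  [r u r = m r u^-1] with [m] in [N]. So [r] conjugates [u m] to [m u], both in [N],
  and [u m] is a power [c] of [b]; then [(r u) ^+ 3 = c^-1]. If [c != 1], then [r u]
  centralizes [b], hence lies in [<[b]>], and [r] would be in [N]. *)
Lemma cubic_relation :
  exists i, [/\ b ^+ i * t \in G, (b ^+ i * t) * (b ^+ i * t) = 1,
               b ^ (b ^+ i * t) = b^-1 & (b ^+ i * t * u) ^+ 3 = 1].
Proof.
have Nu := subsetP sUN u Uu; have Gu := subsetP sNG u Nu.
have tV := involution_inv t2.
have bXt i : b ^+ i * t = t * (b ^+ i)^-1 by rewrite conjgC conjXg bt expgVn.
pose s i := t * (b ^+ i)^-1.
have Nbi i : b ^+ i \in N by rewrite groupX.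
have s2 i : s i * s i = 1 by rewrite {1}/s -bXt /s -mulgA (mulgA t t) t2 mul1g mulgV.
have Ns i : s i \notin N by rewrite /s groupMr ?groupV ?Nbi.
have ns i : s i != 1 by apply: contraNneq (Ns i) => ->.
have Gs i : s i \in G by rewrite groupM // groupV (subsetP sNG).
have bs i : b ^ s i = b^-1.
  by rewrite conjgM bt conjVg; congr _^-1; apply/conjg_fixP/commgP/commuteV/commuteX.
have Gtut : t * u * t \in G by rewrite !groupM.
have [Ntut | [n [v [Nn Uv e]]]] := coverG Gtut.
  by case/negP: nbu; apply: NNt; rewrite // conjgE tV mulgA.
have nv : v != 1.
  apply: contraNneq nNt => v1; rewrite v1 mulg1 in e.
  by rewrite -(groupMr _ Nu) (mulIg t _ _ e).
(* If [v] is conjugate to [u] itself, an involution [s i] is conjugate to an element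
  of [N], which is excluded unless [u] is an involution. *)
have [i ei] : exists i, v = u^-1 ^ (b ^+ i).
  have [i [ei | ei]] := coverU Uv nv; last by exists i.
  case: oddN => [oN | uV]; last by exists i; rewrite uV.
  have Nsi : s i ^ (u^-1 * t) \in N.
    have -> : s i ^ (u^-1 * t) = n * b ^+ i.
      rewrite conjgE invMg tV invgK.
      have -> : t * u = n * t * v * t by rewrite -e -mulgA t2 mulg1.
      rewrite ei /s conjgE.
      rewrite !mulgA -(mulgA _ t t) t2 mulg1 mulgK mulgK.
      by rewrite -!mulgA (mulgA t) -bXt -mulgA t2 mulg1.
    by rewrite groupM.
  have : odd #[s i ^ (u^-1 * t)] by apply: oddSg oN; rewrite cycle_subG.
  have os : #[s i] = 2 by apply: nt_prime_order; rewrite ?expg2.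
  by rewrite orderJ os.
have e1 : s i * u * s i = b ^+ i * n * s i * u^-1.
  rewrite {1}/s -bXt /s.
  have -> : b ^+ i * t * u * (t * (b ^+ i)^-1) = b ^+ i * (t * u * t) * (b ^+ i)^-1.
    by rewrite !mulgA.
  by rewrite e ei conjgE !mulgA mulgK.
have NNs m : m \in N -> m ^ s i \in N -> m \in <[b]>.
  move=> Nm; rewrite /s -bXt conjgM => Nmt.
  by have := NNt (groupJ Nm (Nbi i)) Nmt; rewrite groupJr ?mem_cycle.
have bsV c : c \in <[b]> -> c ^ s i = c^-1.
  by case/cycleP=> k ->; rewrite conjXg bs expgVn.
exists i; rewrite bXt -/(s i); split=> //.
set n' := b ^+ i * n in e1; have Nn' : n' \in N by rewrite groupM.
move: (s i) (s2 i) (Ns i) (ns i) (Gs i) e1 NNs bsV => r r2 nNr nr Gr e1 NNr bV.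
have rV := involution_inv r2.
have en : n' = r * u * r * u * r by rewrite e1 mulgKV -mulgA r2 mulg1.
have [c bc n'E] : exists2 c, c \in <[b]> & n' = u^-1 * c.
  exists (u * n'); last by rewrite mulKg.
  rewrite -groupV; apply: NNr; first by rewrite groupV groupM.
  suffices -> : (u * n')^-1 ^ r = (n' * u)^-1 by rewrite groupV groupM.
  by rewrite conjgE rV en !invMg rV !mulgA r2 mul1g.
(* Put [w = r u]. As [r u r u r = n' = u^-1 c], the square of [w] is [w^-1 c^-1]. *)
pose w := r * u; have w3 : w ^+ 3 = c^-1.
  have wV : w^-1 = u^-1 * r by rewrite invMg rV.
  have w2 : w * w = w^-1 * c^-1.
    have -> : w * w = n' * r by rewrite en -[RHS]mulgA r2 mulg1 /w !mulgA.
    by rewrite n'E wV -!mulgA; congr (_ * _); rewrite (conjgC c r) bV.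
  by rewrite expgS expg2 w2 mulKVg.
have [c1 | nc] := eqVneq c 1; first by rewrite -/w w3 c1 invg1.
have pr_b : prime #[b] by rewrite ob.
have : w \in <[b]>.
  rewrite -Cb inE (groupM Gr Gu) /=.
  have : w \in 'C[c].
    by rewrite cent1C -groupV -w3 groupX // cent1id.
  by rewrite -!cent_cycle (prime_cycle_eq pr_b bc nc).
have sbN : <[b]> \subset N by rewrite cycle_subG.
by move/(subsetP sbN); rewrite groupMr // (negPf nNr).
Qed.
End Cubic.

(** * Groups determined by relations *)

Section Bound.
Variable gT : finGroupType.
Implicit Types (a g m n u v w y z : gT).
Variables (U : {group gT}) (b t u : gT).
Hypotheses (b3 : b ^+ 3 = 1) (t2 : t ^+ 2 = 1) (bt : b ^ t = b^-1) (tu3 : (t * u) ^+ 3 = 1).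
Hypotheses (nUb : b \in 'N(U)) (Uu : u \in U).
Hypothesis coverU : {in U, forall v, v != 1 -> exists i, v = u ^ (b ^+ i) \/ v = u^-1 ^ (b ^+ i)}.

(** Let [N = <[b]> U]. The union of [N] and [N t U] contains 1 and is stable under
  right multiplication by [u], [b] and [t]. For [t], this is the relation
  [t u t = u^-1 t u^-1], equivalent to [(t u) ^+ 3 = 1], conjugated by powers of
  [b]. *)
Lemma card_gen_bound : #|<<[set u; b; t]>>| <= #|U| * 3 * #|U|.+1.
Proof.
pose N := <[b]> <*> U.
have nUB : <[b]> \subset 'N(U) by rewrite cycle_subG.
have cN : #|N| <= #|U| * 3.
  rewrite /N norm_joinEl // mulnC.
  have b_le3 : #|<[b]>| <= 3 by rewrite -orderE dvdn_leq // order_dvdn b3.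
  apply: leq_trans (leq_mul b_le3 (leqnn #|U|)).
  by rewrite mul_cardG leq_pmulr ?cardG_gt0.
pose S := N :|: [set p.1 * t * p.2 | p in setX N U].
have cS : #|S| <= #|U| * 3 * #|U|.+1.
  rewrite mulnS (leq_trans (leq_card_setU _ _)) // leq_add //.
  by rewrite (leq_trans (leq_imset_card _ _)) // cardsX leq_mul.
apply: leq_trans cS; apply: subset_leq_card.
have NbX i : b ^+ i \in N by rewrite groupX // (subsetP (joing_subl _ _)) ?cycle_id.
have NU v : v \in U -> v \in N by apply/subsetP/joing_subr.
have NS n : n \in N -> n \in S by move=> Nn; rewrite inE Nn.
have NtU n v : n \in N -> v \in U -> n * t * v \in S.
  move=> Nn Uv; rewrite inE; apply/orP; right.
  by apply/imsetP; exists (n, v); rewrite // inE /= Nn.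
have Sx g y : g \in S -> y \in [set u; b; t] -> g * y \in S.
  have tt : t * t = 1 by rewrite -expg2.
  have tV := involution_inv tt.
  have bXt i : b ^+ i * t = t * (b ^+ i)^-1 by rewrite conjgC conjXg bt expgVn.
  move=> Sg Ty; have /or3P eqy : [|| y == u, y == b | y == t].
    by move: Ty; rewrite !inE -!orbA.
  case/setUP: Sg => [Nn | /imsetP[[n v] /setXP[/= Nn Uv] ->]]; case: eqy => /eqP->.
  - by apply: NS; rewrite groupM // NU.
  - by apply: NS; rewrite groupM // (NbX 1%N).
  - by rewrite -[g * t]mulg1 NtU.
  - by rewrite -mulgA NtU // groupM.
  - have -> : n * t * v * b = n * b^-1 * t * v ^ b.
      have Vbt : b^-1 * t = t * b by rewrite conjgC conjVg bt invgK.
      by rewrite conjgE -(mulgA n b^-1) Vbt !mulgA mulgK.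
    by rewrite NtU ?memJ_norm // groupM ?groupV // (NbX 1%N).
  have [-> | nv] := eqVneq v 1; first by rewrite mulg1 -mulgA tt mulg1 NS.
  have tut : t * u * t = u^-1 * t * u^-1.
    apply: (mulIg (u * t * u)); rewrite !mulgA mulgKV -(mulgA _ t t) tt mulg1 mulVg.
    by rewrite -[RHS]tu3 !expgS expg0 mulg1 !mulgA.
  have tuVt : t * u^-1 * t = u * t * u by apply: invg_inj; rewrite !invMg tV invgK !mulgA tut.
  have key v' i : v' \in U -> t * v' * t = v'^-1 * t * v'^-1 -> n * t * (v' ^ (b ^+ i)) * t \in S.
    move=> Uv' e.
    have -> : n * t * (v' ^ (b ^+ i)) * t = (n * b ^+ i * v'^-1 * b ^+ i) * t * (v'^-1 ^ (b ^+ i)^-1).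
      have ct := bXt i; set c := b ^+ i in ct *.
      have ctc : c * t * c = t by rewrite ct mulgKV.
      have tc : t * c^-1 = c * t by [].
      rewrite !conjgE invgK; transitivity (n * (t * c^-1) * v' * (c * t)).
        by rewrite !mulgA.
      rewrite ct {1}tc; transitivity (n * c * (t * v' * t) * c^-1); first by rewrite !mulgA.
      rewrite e; transitivity (n * c * v'^-1 * (c * t * c) * v'^-1 * c^-1).
        by rewrite ctc !mulgA.
      by rewrite !mulgA.
    rewrite NtU ?memJ_norm ?groupV // ?(subsetP nUB) ?mem_cycle //.
    have Nv : v'^-1 \in N by rewrite groupV NU.
    by rewrite !groupM ?NbX.
  have [i [-> | ->]] := coverU Uv nv; apply: key; rewrite ?groupV // invgK //.
apply/subsetP=> g /gen_prodgP[k [c Tc ->]].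
elim: k c Tc => [|k IHk] c Tc; first by rewrite big_ord0 NS // group1.
by rewrite big_ord_recr /= Sx // IHk.
Qed.
End Bound.

Section Graph.
Variables (R : forall rT : finGroupType, rT -> rT -> rT -> Prop) (m : nat).
Hypothesis boundR : forall (rT : finGroupType) (u b t : rT), R u b t -> #|<<[set u; b; t]>>| <= m.
Hypothesis pairR : forall (rT1 rT2 : finGroupType) (u1 b1 t1 : rT1) (u2 b2 t2 : rT2),
  R u1 b1 t1 -> R u2 b2 t2 ->
  @R (prod rT1 rT2 : finGroupType) (u1, u2) (b1, b2) (t1, t2).

(** Let [D] be generated by the pairs of corresponding generators. Both projections
  map it onto [G1] and [G2], and [D] satisfies the relations as well, so its order
  is at most [m]. *)
Lemma presented_isog (gT1 gT2 : finGroupType) (G1 : {group gT1}) (G2 : {group gT2}) u1 b1 t1 u2 b2 t2 :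
  R u1 b1 t1 -> G1 :=: <<[set u1; b1; t1]>> -> m <= #|G1| ->
  R u2 b2 t2 -> G2 :=: <<[set u2; b2; t2]>> -> m <= #|G2| -> G1 \isog G2.
Proof.
move=> R1 g1 m1 R2 g2 m2.
pose T := [set (u1, u2); (b1, b2); (t1, t2)].
have bD : #|<<T>>| <= m by apply: boundR; apply: pairR.
have im1 : fst @* <<T>> = G1.
  rewrite morphim_gen ?subsetT // g1; congr <<_>>; rewrite morphimEsub ?subsetT //.
  by rewrite !imsetU !imset_set1.
have im2 : snd @* <<T>> = G2.
  rewrite morphim_gen ?subsetT // g2; congr <<_>>; rewrite morphimEsub ?subsetT //.
  by rewrite !imsetU !imset_set1.
have iso1 : G1 \isog <<T>>.
  by rewrite isogEcard (leq_trans bD m1) andbT -im1 morphim_homg ?subsetT.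
have iso2 : G2 \isog <<T>>.
  by rewrite isogEcard (leq_trans bD m2) andbT -im2 morphim_homg ?subsetT.
by rewrite (isog_trans iso1) // isog_sym.
Qed.
End Graph.

(** * Recognition from a split subgroup *)

Section Recognition.
Variable gT : finGroupType.
Implicit Types (a g m n v w y z : gT).
Variables (G N U : {group gT}).
Hypotheses (sNG : N \subset G) (sUN : U \subset N) (oG : #|G| = (#|N| * #|U|.+1)%N).

(** The elements [n * t * v] are pairwise distinct, so they account for
  [#|N| * #|U|] elements outside [N]. *)
Lemma double_coset_cover t :
    t \in G -> t * t = 1 -> t \notin N -> {in U, forall v, v ^ t \in N -> v = 1} ->
  {in G, forall g, g \in N \/ exists n v, [/\ n \in N, v \in U & g = n * t * v]}.
Proof.
move=> Gt t2 nNt TIt; pose f (p : gT * gT) := p.1 * t * p.2.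
have tV := involution_inv t2.
have injf : {in setX N U &, injective f}.
  move=> [n v] [n' v'] /setXP[/= Nn Uv] /setXP[/= Nn' Uv'] e.
  have vv : v * v'^-1 = 1.
    have Uvv : v * v'^-1 \in U by rewrite groupM ?groupV.
    apply: (TIt _ Uvv).
    suffices -> : (v * v'^-1) ^ t = n^-1 * n' by rewrite groupM ?groupV.
    rewrite conjgE tV; apply: (mulgI n); apply: (mulIg t); apply: (mulIg v').
    rewrite mulKVg -/(f (n', v')) -e /f /= !mulgA.
    by rewrite -(mulgA _ t t) t2 mulg1 mulgKV.
  have ev : v = v' by apply/eqP; rewrite eq_mulgV1 vv.
  by move: e; rewrite /f /= ev => /mulIg/mulIg->.
have dis : N :&: f @: setX N U = set0.
  apply/setP=> g; rewrite !inE; apply/andP=> -[Ng /imsetP[[n v] /setXP[/= Nn Uv] eg]].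
  by case/negP: nNt; rewrite -(groupMl _ Nn) -(groupMr _ (subsetP sUN v Uv)) -/(f (n, v)) -eg.
have eG : N :|: f @: setX N U = G.
  apply/eqP; rewrite eqEcard; apply/andP; split.
    rewrite subUset sNG; apply/subsetP=> _ /imsetP[[n v] /setXP[/= Nn Uv] ->].
    by rewrite !groupM // (subsetP sNG) // (subsetP sUN).
  by rewrite cardsU dis cards0 subn0 card_in_imset // cardsX oG mulnS.
move=> g; rewrite -[in X in X -> _]eG => /setUP[Ng | /imsetP[[n v] /setXP[/= Nn Uv] ->]]; first by left.
by right; exists n, v.
Qed.

Variables (b t u : gT).
Hypotheses (Nb : b \in N) (ob : #[b] = 3) (nUb : b \in 'N(U)) (oN : #|N| = (#|U| * 3)%N).
Hypotheses (Gt : t \in G) (t2 : t * t = 1) (bt : b ^ t = b^-1) (Cb : 'C_G[b] = <[b]>) (nNt : t \notin N).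
Hypothesis TIt : {in U, forall v, v ^ t \in N -> v = 1}.
Hypotheses (Uu : u \in U) (nu : u != 1).
Hypothesis coverU : {in U, forall v, v != 1 -> exists i, v = u ^ (b ^+ i) \/ v = u^-1 ^ (b ^+ i)}.
Hypothesis oddN : odd #|N| \/ u^-1 = u.

Let TIb : <[b]> :&: U = 1.
Proof.
have pr_b : prime #[b] by rewrite ob.
apply: prime_TIg; first by rewrite -orderE.
rewrite cycle_subG; apply/negP=> Ub.
have b1 : b = 1 by apply: TIt => //; rewrite bt groupV.
by move: ob; rewrite b1 order1.
Qed.

(** An element of [N] that [t] conjugates into [N] lies in [N :&: N :^ t], which
  contains [b] and meets [U] trivially, so it is [<[b]>]; this allows the use of
  [cubic_relation]. *)
Lemma split_recognition : exists s,
  [/\ s * s = 1, b ^ s = b^-1, (s * u) ^+ 3 = 1 & G :=: <<[set u; b; s]>>].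
Proof.
have sbN : <[b]> \subset N by rewrite cycle_subG.
have nUbs : <[b]> \subset 'N(U) by rewrite cycle_subG.
have NNt : {in N, forall n, n ^ t \in N -> n \in <[b]>}.
  move=> n Nn Nnt; pose M := N :&: N :^ t^-1.
  have MU : U :&: M = 1.
    apply/trivgP/subsetP=> v /setIP[Uv /setIP[_]]; rewrite mem_conjgV inE => Nvt.
    by apply/eqP/TIt.
  have Mn : n \in M by rewrite inE Nn mem_conjgV.
  have Mb : <[b]> \subset M by rewrite cycle_subG inE Nb mem_conjgV bt groupV.
  suffices -> : <[b]> = M by [].
  apply/eqP; rewrite eqEcard Mb -orderE ob -(leq_pmul2l (cardG_gt0 U)) -oN.
  rewrite -TI_cardMg //; apply: subset_leq_card.
  by rewrite mul_subG // subsetIl.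
have nbu : u \notin <[b]>.
  by apply: contra nu => bu; rewrite -in_set1 -[[set 1]]TIb inE bu.
have cov := double_coset_cover Gt t2 nNt TIt.
have [i [Gs s2 bs su3]] := cubic_relation sNG Nb ob Gt t2 bt Cb nNt sUN Uu nbu NNt cov coverU oddN.
exists (b ^+ i * t); split=> //.
set s := b ^+ i * t in Gs s2 bs su3 *.
have Nbi : b ^+ i \in N by rewrite groupX.
have nNs : s \notin N by rewrite groupMl.
have TIs : {in U, forall v, v ^ s \in N -> v = 1}.
  move=> v Uv; rewrite conjgM => Nvs; apply: (conjg_inj (b ^+ i)); rewrite conj1g.
  by apply: TIt => //; rewrite memJ_norm // groupX.
have covs := double_coset_cover Gs s2 nNs TIs.
apply/eqP; rewrite eqEsubset; apply/andP; split; last first.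
  by rewrite gen_subG !subUset !sub1set Gs !(subsetP sNG) // (subsetP sUN).
set T := [set u; b; s].
have Tu : u \in <<T>> by rewrite mem_gen // !inE eqxx.
have Tb : b \in <<T>> by rewrite mem_gen // !inE eqxx orbT.
have Ts : s \in <<T>> by rewrite mem_gen // !inE eqxx orbT.
have sUT : U \subset <<T>>.
  apply/subsetP=> v Uv; have [-> | nv] := eqVneq v 1; first by rewrite group1.
  by have [j [-> | ->]] := coverU Uv nv; rewrite groupJ ?groupV ?groupX.
have sNT : N \subset <<T>>.
  suffices -> : N :=: <[b]> * U by rewrite mul_subG // cycle_subG.
  apply/esym/eqP; rewrite eqEcard mul_subG //= TI_cardMg // oN -orderE ob mulnC //.
apply/subsetP=> g /covs[/(subsetP sNT) // | [n [v [Nn Uv ->]]]].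
exact: groupM (groupM (subsetP sNT n Nn) Ts) (subsetP sUT v Uv).
Qed.
End Recognition.

(** * Relations for the groups of order 60 and 168 *)

(** With [b] of order 3, [<[b]>] and [t] generate a symmetric group of degree 3; the
  last relation ties it to [u]. *)
Definition dihedral_cubic (rT : finGroupType) (u b t : rT) :=
  [/\ b ^+ 3 = 1, t ^+ 2 = 1, b ^ t = b^-1 & (t * u) ^+ 3 = 1].

(** The first two relations and [b ^+ 3 = 1] define the Frobenius group of order
  21. *)
Definition relations168 (rT : finGroupType) (u b t : rT) :=
  [/\ u ^+ 7 = 1, u ^ b = u ^+ 2 & dihedral_cubic u b t].

(** The first three relations and [b ^+ 3 = 1] define the alternating group of
  degree 4. *)
Definition relations60 (rT : finGroupType) (u b t : rT) :=
  [/\ u ^+ 2 = 1, commute u (u ^ b), u ^ (b ^+ 2) = u * u ^ b & dihedral_cubic u b t].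

(** The conjugates of [u] by the powers of [b] are [u], [u ^+ 2] and [u ^+ 4], the
  squares modulo 7, and -1 is not a square. *)
Lemma cover7 (rT : finGroupType) (u b : rT) : u ^+ 7 = 1 -> u ^ b = u ^+ 2 ->
  {in <[u]>, forall v, v != 1 -> exists i, v = u ^ (b ^+ i) \/ v = u^-1 ^ (b ^+ i)}.
Proof.
move=> u7 ub v /cycleP[k ->]; rewrite -(expg_mod k u7).
have ub2 : u ^ (b ^+ 2) = u ^+ 4 by rewrite conjgM ub conjXg ub -expgM.
have uV i : u ^+ (7 - i) = (u ^+ i)^-1 \/ 7 < i.
  have [le | ] := leqP i 7; [left | by right].
  by apply: (mulIg (u ^+ i)); rewrite -expgD subnK // mulVg.
have := ltn_pmod k (isT : 0 < 7); case: (k %% 7) => [|[|[|[|[|[|[|m]]]]]]] // _.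
- by rewrite eqxx.
- by exists 0; left; rewrite expg0 conjg1.
- by exists 1%N; left; rewrite expg1.
- by exists 2; right; rewrite conjVg ub2; case: (uV 4).
- by exists 2; left.
- by exists 1%N; right; rewrite conjVg expg1 ub; case: (uV 2).
by exists 0; right; rewrite expg0 conjg1; case: (uV 1%N).
Qed.

Lemma bound168 (rT : finGroupType) (u b t : rT) :
  relations168 u b t -> #|<<[set u; b; t]>>| <= 168.
Proof.
case=> u7 ub [b3 t2 bt tu3].
have ou : #|<[u]>| <= 7 by rewrite -orderE dvdn_leq // order_dvdn u7.
have nub : b \in 'N(<[u]>) by rewrite inE -cycleJ cycle_subG ub mem_cycle.
apply: leq_trans (card_gen_bound b3 t2 bt tu3 nub (cycle_id u) (cover7 u7 ub)) _.
by rewrite (@leq_mul _ _ 21 8) // (@leq_mul _ _ 7 3).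
Qed.

(** The first two relations make [u] and [u ^ b] generate a four-group, normalized
  by [b]. *)
Lemma bound60 (rT : finGroupType) (u b t : rT) :
  relations60 u b t -> #|<<[set u; b; t]>>| <= 60.
Proof.
case=> u2 cub ub2 [b3 t2 bt tu3].
pose U := <[u]> <*> <[u ^ b]>.
have ub_2 : (u ^ b) ^+ 2 = 1 by rewrite -conjXg u2 conj1g.
have cUU : <[u ^ b]> \subset 'C(<[u]>) by rewrite cycle_subG /= cent_cycle; apply/cent1P.
have defU : U = <[u]> * <[u ^ b]> by rewrite /U cent_joinEr.
have cU : #|U| <= 4.
  rewrite defU; apply: leq_trans (_ : #|<[u]>| * #|<[u ^ b]>| <= 4).
    by rewrite mul_cardG leq_pmulr ?cardG_gt0.
  by rewrite (@leq_mul _ _ 2 2) // -orderE dvdn_leq // order_dvdn ?u2 ?ub_2.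
have Uu : u \in U by rewrite (subsetP (joing_subl _ _)) ?cycle_id.
have Uub : u ^ b \in U by rewrite (subsetP (joing_subr _ _)) ?cycle_id.
have nub : b \in 'N(U).
  rewrite inE /U conjYg -!cycleJ join_subG !cycle_subG -/U Uub -conjgM.
  by rewrite -[b * b]/(b ^+ 2) ub2 groupM.
have cov : {in U, forall v, v != 1 -> exists i, v = u ^ (b ^+ i) \/ v = u^-1 ^ (b ^+ i)}.
  move=> v; rewrite defU => /mulsgP[_ _ /cycleP[i ->] /cycleP[j ->] ->].
  rewrite -(expg_mod i u2) -(expg_mod j ub_2) !modn2.
  case: (odd i) (odd j) => -[] /=; rewrite ?expg0 ?expg1 ?mulg1 ?mul1g ?eqxx // => _.
  - by exists 2; left.
  - by exists 0; left; rewrite expg0 conjg1.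
  by exists 1%N; left; rewrite expg1.
apply: leq_trans (card_gen_bound b3 t2 bt tu3 nub Uu cov) _.
by rewrite (@leq_mul _ _ 12 5) // (@leq_mul _ _ 4 3).
Qed.

Section Pairs.
Variables (rT1 rT2 : finGroupType).
Implicit Types (a c : rT1) (b d : rT2).

Lemma pairX a b n : ((a, b) : (rT1 * rT2)%type) ^+ n = (a ^+ n, b ^+ n).
Proof. by elim: n => // n IHn; rewrite !expgS IHn. Qed.

Lemma pairM a b c d : ((a, b) : (prod rT1 rT2 : finGroupType)) * ((c, d) : (prod rT1 rT2 : finGroupType)) = (a * c, b * d).
Proof. by []. Qed.

Lemma pairJ a b c d : ((a, b) : (rT1 * rT2)%type) ^ (c, d) = (a ^ c, b ^ d).
Proof. by []. Qed.

Lemma dihedral_cubic_pair (u1 b1 t1 : rT1) (u2 b2 t2 : rT2) :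
  dihedral_cubic u1 b1 t1 -> dihedral_cubic u2 b2 t2 ->
  @dihedral_cubic (rT1 * rT2 : finGroupType)%type (u1, u2) (b1, b2) (t1, t2).
Proof.
case=> [h1 h2 h3 h4] [k1 k2 k3 k4]; split; rewrite ?pairX ?pairJ ?h1 ?h2 ?h3 ?k1 ?k2 ?k3 //.
by rewrite /= h4 k4.
Qed.

Lemma relations168_pair (u1 b1 t1 : rT1) (u2 b2 t2 : rT2) :
  relations168 u1 b1 t1 -> relations168 u2 b2 t2 ->
  @relations168 (rT1 * rT2 : finGroupType)%type (u1, u2) (b1, b2) (t1, t2).
Proof.
case=> [h1 h2 h3] [k1 k2 k3]; split; rewrite ?pairX ?pairJ ?h1 ?h2 ?k1 ?k2 //.
exact: dihedral_cubic_pair.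
Qed.

Lemma relations60_pair (u1 b1 t1 : rT1) (u2 b2 t2 : rT2) :
  relations60 u1 b1 t1 -> relations60 u2 b2 t2 ->
  @relations60 (rT1 * rT2 : finGroupType)%type (u1, u2) (b1, b2) (t1, t2).
Proof.
case=> [h1 h2 h3 h4] [k1 k2 k3 k4]; split; last exact: dihedral_cubic_pair.
- by rewrite pairX h1 k1.
- by rewrite /commute pairJ; congr (_, _).
by rewrite pairX !pairJ pairM h3 k3.
Qed.
End Pairs.

(** * Generators satisfying the relations *)

Lemma order21 m k : (m * 7 * k = 168 -> k %% 7 = 1 -> m * 7 <= 42 -> m * 7 = 21)%N.
Proof.
move=> e k1 le; have {le} : m <= 6 by rewrite -(leq_pmul2r (isT : 0 < 7)).
by case: m e => [|[|[|[|[|[|[|m]]]]]]] // e _; lia.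
Qed.

Section Generators.
Variable gT : finGroupType.
Implicit Types (a b c g h t u v w y z : gT).
Variables (G : {group gT}) (x : gT).
Hypothesis D : one_deficient_prime 2 G x.

Lemma real_prime_inverter b : b \in G -> prime #[b] -> #[b] != 2 -> #[b] \in real_primes G ->
  exists t, [/\ t \in G, #[t] = 2 & b ^ t = b^-1].
Proof.
move=> Gb pr_b b2 /real_primesP[w [t [Gw pr_w w2 e It]]].
have sylb := odp_Sylow D Gb pr_b b2; have := odp_Sylow D Gw pr_w w2.
rewrite e => sylw; have [g Gg eg] := Sylow_trans sylw sylb.
have /andP[Gt /eqP ot] : (t \in G) && (#[t] == 2) by move: It; rewrite !inE => /andP[].
exists (t ^ g); rewrite groupJ // orderJ; split=> //.
have /cycleP[i ->] : b \in <[w ^ g]> by rewrite cycleJ -eg cycle_id.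
by rewrite conjXg -conjJg (inverts_of_pair It) conjVg expgVn.
Qed.

(** Here [U] is the Sylow 2-subgroup [P], and [N] its normalizer, of order 12. If
  [v] and [v ^ t] are involutions of [P], then [t] normalizes [P], the centralizer
  of both; but [t] is not in [N], for otherwise [t] is in [P], and so is
  [b^-1 * b ^ t = b]. *)
Lemma abelem_generators (P : {group gT}) :
    2.-Sylow(G) P -> 2.-abelem P -> ~~ (P <| G) ->
  exists u b t, relations60 u b t /\ G :=: <<[set u; b; t]>>.
Proof.
move=> sylP abP nP; have [oG oP L3] := abelem_order60 D sylP abP nP.
have [sPG pP _] := and3P sylP.
have ntP : P :!=: 1 by rewrite -cardG_gt1 oP.
have := card_norm_abelem D sylP abP ntP; rewrite oP /=; set N := 'N_G(P) => oN.
have sNG : N \subset G by apply: subsetIl.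
have sPN : P \subset N by rewrite subsetI sPG normG.
have nsPN : P <| N by rewrite /normal sPN subsetIr.
have sylPN : 2.-Sylow(N) P by apply: pHall_subl sylP.
have N2 v : v \in N -> #[v] = 2 -> v \in P.
  by move=> Nv ov; rewrite (mem_normal_Hall sylPN) // /p_elt ov pnat_id.
have [b Nb ob] : {b | b \in N & #[b] = 3} by apply: Cauchy; rewrite // oN.
have [Gb nPb] := setIP Nb.
have nb : b != 1 by rewrite -order_gt1 ob.
have Cb : 'C_G[b] = <[b]> by apply: (odp_cent D); rewrite ?ob.
have [t [Gt ot bt]] : exists t, [/\ t \in G, #[t] = 2 & b ^ t = b^-1].
  by apply: real_prime_inverter; rewrite ?ob.
have t2 := order2_mul ot.
have nPb1 : b \notin P by apply/negP=> /order_dvdG; rewrite ob oP.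
have b3 : b ^+ 3 = 1 by rewrite -ob expg_order.
have bV : b^-1 = b * b by apply/eqP; rewrite eq_invg_mul; apply/eqP.
have nNt : t \notin N.
  apply: contra nPb1 => Nt; have Pt := N2 t Nt ot.
  have : (t^-1) ^ b * t \in P by rewrite groupM ?memJ_norm ?groupV.
  have -> : (t^-1) ^ b * t = b^-1 * b ^ t by rewrite !conjgE !mulgA.
  by rewrite bt -invMg groupV -bV groupV.
have TIt : {in P, forall v, v ^ t \in N -> v = 1}.
  move=> v Pv Nvt; apply/eqP; apply: contraR nNt => nv.
  have P1v : v \in P^# by rewrite !inE nv.
  have ov := abelem_involution abP P1v.
  have Pvt : v ^ t \in P by apply: N2; rewrite ?orderJ.
  have P1vt : v ^ t \in P^# by rewrite !inE conjg_eq1 nv.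
  rewrite inE Gt; apply/normP; rewrite -{1}(abelem_cent1 D sylP abP P1v).
  by rewrite -(abelem_cent1 D sylP abP P1vt) conjIg conjGid // -normJ conjg_set1.
have /trivgPn[u Pu nu] := ntP.
have Puc k : k \in N -> u ^ k \in P by case/setIP=> _ nPk; rewrite memJ_norm.
have P1u : u \in P^# by rewrite !inE nu.
have nub : u ^ b != u.
  apply: contra nPb1 => /eqP e; rewrite -(abelem_cent1 D sylP abP P1u) inE Gb.
  by rewrite cent1C; apply/cent1P/commgP/conjg_fixP.
have nub2 : u ^ (b ^+ 2) != u.
  apply: contra nub => /eqP e; apply/eqP; rewrite expg2 -bV in e.
  by rewrite -{1}e conjgKV.
have nubb : u ^ (b ^+ 2) != u ^ b.
  by rewrite expgS conjgM (inj_eq (conjg_inj b)).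
have defP : P^# = [set u; u ^ b; u ^ (b ^+ 2)].
  apply/esym/eqP; rewrite eqEcard; apply/andP; split.
    apply/subsetP=> v; rewrite !inE => /orP[/orP[]|] /eqP->; rewrite ?conjg_eq1 nu //=.
      exact: Puc.
    by rewrite Puc // groupX.
  have -> : #|P^#| = 3 by move: oP; rewrite (cardsD1 1) group1 => -[].
  by rewrite -setUA cardsU1 cards2 !inE negb_or ![u == _]eq_sym nub nub2 [u ^ b == _]eq_sym nubb.
have u2 : u * u = 1 by apply/order2_mul/(abelem_involution abP).
have cov : {in P, forall v, v != 1 -> exists i, v = u ^ (b ^+ i) \/ v = u^-1 ^ (b ^+ i)}.
  move=> v Pv nv; have : v \in P^# by rewrite !inE nv.
  rewrite defP !inE => /orP[/orP[]|] /eqP->.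
  - by exists 0; left; rewrite conjg1.
  - by exists 1%N; left.
  by exists 2; left.
have oG2 : #|G| = (#|N| * #|P|.+1)%N by rewrite oG oN oP.
have oN2 : #|N| = (#|P| * 3)%N by rewrite oN oP.
have [s [s2 bs su3 gen]] := split_recognition sNG sPN oG2 Nb ob nPb oN2 Gt t2 bt Cb nNt TIt
  Pu nu cov (or_intror (involution_inv u2)).
exists u, b, s; split=> //.
have Pub : u ^ b \in P by apply: Puc.
split=> //.
- by apply: (centsP (abelem_abelian abP)).
- have : u * u ^ b \in P^#.
    rewrite !inE groupM // andbT; apply: contra nub => /eqP e.
    by apply/eqP/(mulgI u); rewrite e u2.
  rewrite defP !inE => /orP[/orP[]|] /eqP //.
    by rewrite -[RHS]mulg1 => /mulgI/eqP; rewrite conjg_eq1 (negPf nu).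
  by rewrite -[RHS]mul1g => /mulIg/eqP; rewrite (negPf nu).
Qed.

(** Here [U] is a Sylow 7-subgroup, and [N] its normalizer, of order 21 since the
  number of Sylow subgroups is 1 modulo 7 and [N / U] acts faithfully on [U]. An
  element of order 3 of [N] acts on [U] as squaring or as its inverse. *)
Lemma dihedral_generators (P : {group gT}) h u :
    2.-Sylow(G) P -> #|P| = 8 -> h \in P -> u \in P -> #[h] = 4 -> #[u] = 2 -> h ^ u = h^-1 ->
  exists u b t, relations168 u b t /\ G :=: <<[set u; b; t]>>.
Proof.
move=> sylP oP Ph Pu oh ou hu.
have oG := dihedral_order168 D sylP oP Ph Pu oh ou hu.
have L3 := three_real D sylP oP Ph Pu oh ou hu.
have [c Gc oc] : {c | c \in G & #[c] = 7} by apply: Cauchy; rewrite // oG.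
have nc : c != 1 by rewrite -order_gt1 oc.
have pr_c : prime #[c] by rewrite oc.
have Cc : 'C_G[c] = <[c]> by apply: (odp_cent D); rewrite ?oc.
have sylC : 7.-Sylow(G) <[c]> by rewrite -oc; apply: (odp_Sylow D); rewrite ?oc.
pose N := 'N_G(<[c]>).
have sNG : N \subset G by apply: subsetIl.
have Nc : c \in N by rewrite inE Gc -cycle_subG normG.
have sCN : <[c]> \subset N by rewrite cycle_subG.
have oN : #|N| = 21.
  have iN := card_Syl sylC; have modN := card_Syl_mod G (isT : prime 7).
  have := Lagrange sNG; rewrite -iN oG => lag.
  have d7 : 7 %| #|N| by rewrite -oc order_dvdG.
  have le42 : #|N| <= 42.
    have -> : #|N| = (#|'C_N[c]| * #|c ^: N|)%N by rewrite -index_cent1 Lagrange ?subsetIl.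
    apply: (@leq_mul _ _ 7 6).
      by rewrite -oc orderE -Cc subset_leq_card // setSI.
    have <- : #|<[c]>^#| = 6 by have := cardsD1 1 <[c]>; rewrite group1 -orderE oc => -[].
    apply/subset_leq_card/subsetP=> _ /imsetP[g /setIP[_ ncg] ->].
    by rewrite !inE conjg_eq1 nc memJ_norm ?cycle_id.
  have [m em] := dvdnP d7; rewrite em in lag le42 *.
  exact: order21 lag modN le42.
have nsCN : <[c]> <| N by rewrite /normal sCN subsetIr.
have sylCN : 7.-Sylow(N) <[c]> by apply: pHall_subl sylC.
have N7 v : v \in N -> #[v] = 7 -> v \in <[c]>.
  by move=> Nv ov; rewrite (mem_normal_Hall sylCN) // /p_elt ov pnat_id.
have [b [Nb ob cb]] : exists b, [/\ b \in N, #[b] = 3 & c ^ b = c ^+ 2].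
  have [b Nb ob] : {b | b \in N & #[b] = 3} by apply: Cauchy; rewrite // oN.
  have [Gb ncb] := setIP Nb; have b3 : b ^+ 3 = 1 by rewrite -ob expg_order.
  have c7 : c ^+ 7 = 1 by rewrite -oc expg_order.
  have /cycleP[i ci] : c ^ b \in <[c]> by rewrite memJ_norm ?cycle_id.
  rewrite -(expg_mod i c7) in ci.
  have cX k : (c ^+ k) ^ b = c ^+ (i %% 7 * k) by rewrite conjXg ci -expgM.
  have : c ^ (b ^+ 3) = c ^+ (i %% 7 * (i %% 7 * (i %% 7))).
    by rewrite !expgSr expg0 mul1g !conjgM ci !cX.
  rewrite b3 conjg1 -{1}[c]expg1 => /eqP; rewrite eq_expg_mod_order oc.
  have := ltn_pmod i (isT : 0 < 7).
  case: (i %% 7) ci cX => [|[|[|[|[|[|[|j]]]]]]] //= ci cX _ _.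
  - have : b \in <[c]> by rewrite -Cc inE Gb cent1C; apply/cent1P/commgP/conjg_fixP.
    by move/order_dvdG; rewrite ob -orderE oc.
  - by exists b.
  exists (b ^+ 2); rewrite groupX // orderXgcd ob; split=> //.
  by rewrite conjgM ci cX -(expg_mod _ c7).
have [Gb ncb] := setIP Nb.
have nb : b != 1 by rewrite -order_gt1 ob.
have Cb : 'C_G[b] = <[b]> by apply: (odp_cent D); rewrite ?ob.
have [t [Gt ot bt]] : exists t, [/\ t \in G, #[t] = 2 & b ^ t = b^-1].
  by apply: real_prime_inverter; rewrite ?ob.
have t2 := order2_mul ot.
have b3 : b ^+ 3 = 1 by rewrite -ob expg_order.
have nNt : t \notin N.
  by apply/negP=> /order_dvdG; rewrite ot oN.
have TIt : {in <[c]>, forall v, v ^ t \in N -> v = 1}.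
  move=> v cv Nvt; apply/eqP; apply: contraR nNt => nv.
  have ev := prime_cycle_eq pr_c cv nv.
  have ov : #[v] = 7 by rewrite orderE ev -orderE.
  have cvt : v ^ t \in <[c]> by apply: N7; rewrite ?orderJ.
  rewrite inE Gt; apply/normP; rewrite -{1}ev -cycleJ; apply: prime_cycle_eq => //.
  by rewrite conjg_eq1.
have oG2 : #|G| = (#|N| * #|<[c]>|.+1)%N by rewrite oG oN -orderE oc.
have oN2 : #|N| = (#|<[c]>| * 3)%N by rewrite oN -orderE oc.
have c7 : c ^+ 7 = 1 by rewrite -oc expg_order.
have oddN : odd #|N| by rewrite oN.
have [s [s2 bs su3 gen]] := split_recognition sNG sCN oG2 Nb ob ncb oN2 Gt t2 bt Cb nNt TIt
  (cycle_id c) nc (cover7 c7 cb) (or_introl oddN).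
by exists c, b, s.
Qed.
End Generators.

(** * A criterion for a single deficient class *)

Section Criterion.
Variable gT : finGroupType.
Implicit Types (G P A B : {group gT}) (a b c g h k t u v w x y z : gT).

(** A solvable [G] has a non-trivial elementary abelian normal subgroup [K]. If it
  is a 2-group, it contains all 21 involutions, too many for a 2-subgroup. Otherwise
  it is cyclic of prime order and equal to its centralizer, so [G / K] is abelian;
  but [h * u] and [u * h] differ by an element of order 2, not in [K]. *)
Lemma dihedral_not_solvable G x P h u : one_deficient_prime 2 G x ->
    2.-Sylow(G) P -> #|P| = 8 -> h \in P -> u \in P -> #[h] = 4 -> #[u] = 2 -> h ^ u = h^-1 ->
  ~~ solvable G.
Proof.
move=> D sylP oP Ph Pu oh ou hu; apply/negP=> solG.
have [sPG pP _] := and3P sylP.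
have oG := dihedral_order168 D sylP oP Ph Pu oh ou hu.
have ntG : G :!=: 1 by rewrite -cardG_gt1 oG.
have [K [sKG nsKG ntK /is_abelemP[r pr_r abK]]] := solvable_norm_abelem solG (normal_refl G) ntG.
have pK := abelem_pgroup abK.
have [_ dv _] := pgroup_pdiv pK ntK.
have [k Kk ok] := Cauchy pr_r dv.
have Gk := subsetP sKG k Kk.
have nk : k != 1 by rewrite -order_gt1 ok prime_gt1.
have [r2 | r2] := eqVneq r 2.
  rewrite r2 in ok pK.
  have sJK : involutions G \subset K.
    rewrite (involutions_class D) -(class_eqP (odp_conj D Gk ok)).
    by rewrite class_sub_norm ?normal_norm.
  have cJ := card_involutions D sylP; rewrite oP oG in cJ.
  have [Q sylQ sKQ] := Sylow_superset sKG pK.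
  have := leq_trans (subset_leq_card sJK) (subset_leq_card sKQ).
  rewrite (card_Hall sylQ) -(card_Hall sylP) oP.
  by rewrite -(leq_pmul2r (isT : 0 < 8)) cJ.
have Ck : 'C_G[k] = <[k]> by apply: (odp_cent D); rewrite ?ok.
have nKG := normal_norm nsKG.
have sKk : K \subset <[k]>.
  by rewrite -Ck subsetI sKG sub_cent1 (subsetP (abelem_abelian abK)).
have kX g : g \in G -> exists i, k ^ g = k ^+ i.
  move=> Gg; apply/cycleP; apply: (subsetP sKk).
  by rewrite memJ_norm // (subsetP nKG).
have Gh := subsetP sPG h Ph; have Gu := subsetP sPG u Pu.
have [[i ki] [j kj]] := (kX h Gh, kX u Gu).
have : h * u * (u * h)^-1 \in <[k]>.
  rewrite -Ck inE; apply/andP; split; first by rewrite groupM ?groupV ?groupM.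
  rewrite cent1C; apply/cent1P/commgP/conjg_fixP.
  have e : k ^ (h * u) = k ^ (u * h).
    by rewrite !conjgM ki kj !conjXg ki kj -!expgM mulnC.
  by rewrite conjgM e conjgK.
have -> : h * u * (u * h)^-1 = h ^+ 2.
  have uhV : u * h^-1 * u^-1 = h.
    by apply: (canLR (mulgK _)); rewrite -hu conjgE mulKVg.
  by rewrite invMg mulgA -(mulgA h) -mulgA uhV.
move/order_dvdG; rewrite orderXdiv oh // -orderE ok dvdn_prime2 // eq_sym.
by rewrite (negPf r2).
Qed.

(** An element that does not generate its centralizer has order 2: if a power of [y]
  has odd prime order, then [y] lies in the group this power generates; if [y] is a
  2-element of order at least 4, a conjugate [v] lies in [P], and [C_G(v)] is a
  2-group, because [v] is not in the group generated by an element of odd prime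
  order, so that a conjugate of it lies in [P]. *)
Lemma one_deficient_criterion G P :
    2.-Sylow(G) P -> 2 < #|P| ->
    {in G, forall y, prime #[y] -> odd #[y] -> 'C_G[y] = <[y]>} ->
    {in P &, forall u v, #[u] = 2 -> #[v] = 2 -> v \in u ^: G} ->
    {in P, forall y, 2 < #[y] -> 'C_P[y] = <[y]>} ->
  exists x, one_deficient_prime 2 G x.
Proof.
move=> sylP P2 selfC conj2 selfP.
have [sPG pP _] := and3P sylP.
have ntP : P :!=: 1 by rewrite -cardG_gt1 ltnW.
have ntZ: 'Z(P) != 1 by rewrite center_nil_eq1 ?(pgroup_nil pP).
have [_ dvZ _] := pgroup_pdiv (pgroupS (center_sub P) pP) ntZ.
have [z /setIP[Pz Cz] oz] := Cauchy (isT : prime 2) dvZ.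
have Gz := subsetP sPG z Pz.
have sPC : P \subset 'C_G[z] by rewrite subsetI sPG sub_cent1.
have toP y : y \in G -> 2.-elt y -> exists2 g, g \in G & y ^ g \in P.
  move=> Gy y2; have [|g Gg sy] := Sylow_Jsub sylP _ y2; first by rewrite cycle_subG.
  by exists g; rewrite // -cycle_subG cycleJ.
have CJ y g : g \in G -> 'C_G[y ^ g] = 'C_G[y] :^ g.
  by move=> Gg; rewrite conjIg conjGid // -normJ conjg_set1.
exists z; split=> //.
- rewrite properEcard -orderE oz (leq_trans P2 (subset_leq_card sPC)) andbT.
  by apply: sub_cent1_cycle.
- move=> y Gy oy; have [|g Gg Pyg] := toP y Gy; first by rewrite /p_elt oy.
  have : y ^ g \in z ^: G by apply: conj2; rewrite ?orderJ.
  case/imsetP=> a Ga e; apply/imsetP; exists (a * g^-1); first by rewrite groupM ?groupV.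
  by rewrite conjgM -e conjgK.
move=> y Gy ny oy.
have [y2 | ] := boolP (2.-elt y); last first.
  rewrite /p_elt /pnat order_gt0 /= => /allPn[r]; rewrite mem_primes => /and3P[pr_r _ ry] r2.
  have [w yw ow] : {w | w \in <[y]> & #[w] = r} := Cauchy pr_r ry.
  have Gw : w \in G by apply: subsetP yw; rewrite cycle_subG.
  have oddr : odd r by have [e|//] := even_prime pr_r; rewrite e in r2.
  have Cw : 'C_G[w] = <[w]> by apply: selfC; rewrite ?ow.
  have cyw : <[y]> = <[w]>.
    apply/eqP; rewrite eqEsubset !cycle_subG yw andbT /= -Cw inE Gy cent1C.
    by apply: subsetP yw; rewrite cycle_subG cent1id.
  by rewrite -cent_cycle cyw cent_cycle.
have [g Gg Pyg] := toP y Gy y2.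
suffices C : 'C_G[y ^ g] = <[y ^ g]>.
  by apply: (@conjsg_inj _ g); rewrite -CJ // C cycleJ.
have oyg : 2 < #[y ^ g].
  by rewrite orderJ ltn_neqAle eq_sym oy order_gt1.
have Gyg := subsetP sPG _ Pyg.
have Cp : 2.-group 'C_G[y ^ g].
  apply/pgroupP=> r pr_r dv; have [w /setIP[Gw Cw] ow] := Cauchy pr_r dv.
  rewrite !inE; apply: contraT => r2.
  have oddr : odd r by have [e|//] := even_prime pr_r; rewrite e in r2.
  have : y ^ g \in <[w]> by rewrite -(selfC w) ?ow // inE Gyg cent1C.
  move/order_dvdG; rewrite -orderE ow => d.
  have e : #[y ^ g] = r by apply/prime_nt_dvdP; rewrite // neq_ltn (ltnW oyg) orbT.
  by have := mem_p_elt pP Pyg; rewrite /p_elt e pnatE // inE (negPf r2).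
have [a Ga sC] := Sylow_Jsub sylP (subsetIl G 'C[y ^ g]) Cp.
rewrite -CJ // in sC; have Gya : (y ^ g) ^ a \in G by rewrite groupJ.
have Pya : (y ^ g) ^ a \in P by apply: (subsetP sC); rewrite inE Gya cent1id.
apply: (@conjsg_inj _ a); rewrite -CJ // -cycleJ -(selfP _ Pya) ?orderJ //.
  by apply/eqP; rewrite eqEsubset subsetI sC subsetIr setSI.
by rewrite -(orderJ _ g).
Qed.

Lemma inD1_criterion G P :
    2.-Sylow(G) P -> 2 < #|P| ->
    {in G, forall y, prime #[y] -> odd #[y] -> 'C_G[y] = <[y]>} ->
    {in P &, forall u v, #[u] = 2 -> #[v] = 2 -> v \in u ^: G} ->
    {in P, forall y, 2 < #[y] -> 'C_P[y] = <[y]>} ->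
  inD 1 G.
Proof.
move=> sylP P2 selfC conj2 selfP; apply/inD1_structure; exists 2.
by have [x D] := one_deficient_criterion sylP P2 selfC conj2 selfP; exists x.
Qed.

(** Both elements generate Sylow subgroups, which are conjugate. *)
Lemma self_cent_prime_order G b y : b \in G -> prime #[b] -> 'C_G[b] = <[b]> ->
  y \in G -> #[y] = #[b] -> 'C_G[y] = <[y]>.
Proof.
move=> Gb pr_b Cb Gy oy; have sylb := self_cent_prime_Sylow Gb pr_b Cb.
have pY : #[b].-group <[y]> by rewrite /pgroup -orderE oy pnat_id.
have [|g Gg sy] := Sylow_Jsub sylb _ pY; first by rewrite cycle_subG.
have eY : <[y ^ g]> = <[b]> by apply/eqP; rewrite cycleJ eqEcard sy cardJg -!orderE oy leqnn.
apply: (@conjsg_inj _ g); rewrite conjIg (conjGid Gg) -normJ conjg_set1 -cycleJ eY -Cb.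
by rewrite -!cent_cycle eY.
Qed.
End Criterion.

(** * The solvable groups on the list *)

Section SmallGroups.
Variable gT : finGroupType.
Implicit Types (G P A B : {group gT}) (a b c g h k t u v w x y z : gT).

Lemma inD1_2group G t : 2.-group G -> 2 < #|G| ->
    (forall u, u \in G -> #[u] = 2 -> u = t) ->
    {in G, forall y, 2 < #[y] -> 'C_G[y] = <[y]>} -> inD 1 G.
Proof.
move=> pG G2 uniq self.
have sylG : 2.-Sylow(G) G by rewrite /pHall subxx indexgg pG.
apply: (inD1_criterion sylG) => //.
  move=> y Gy pr_y; have := mem_p_elt pG Gy.
  by rewrite /p_elt pnatE // inE => /eqP ->.
by move=> u v Gu Gv ou ov; rewrite (uniq u) // (uniq v) // class_refl.
Qed.

Lemma cyclic4_inD1 G : is_cyclic_of_order 4 G -> inD 1 G.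
Proof.
case=> /cyclicP[y defG] oG; have oy : #[y] = 4 by rewrite orderE -defG.
apply: (@inD1_2group _ (y ^+ 2)); rewrite ?oG //.
- by rewrite /pgroup oG.
- by rewrite defG => u; apply: cycle4_involution.
move=> z Gz z2; have dv : #[z] %| 4 by rewrite -oG order_dvdG.
have oz : #[z] = 4 by move: z2 dv; case: #[z] => [|[|[|[|[|n]]]]] // _ /dvdn_leq.
have eG : <[z]> = G by apply/eqP; rewrite eqEcard cycle_subG Gz oG -orderE oz.
rewrite eG; apply/setIidPl; rewrite sub_cent1.
by have cG : abelian G by [rewrite defG cycle_abelian]; apply: (subsetP cG).
Qed.

Lemma dvd8_leq (c d : nat) : c %| 8 -> c != 8 -> d %| c -> 2 < d -> c <= d.
Proof.
move=> dc c8 dd d2; have := dvdn_leq (isT : 0 < 8) dc.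
move: dc c8 dd; case: c => [|[|[|[|[|[|[|[|[|c]]]]]]]]] // _ _ dd _.
- by have := dvdn_leq (isT : 0 < 1) dd; rewrite leqNgt (ltnW d2).
- by have := dvdn_leq (isT : 0 < 2) dd; rewrite leqNgt d2.
by case: d dd d2 => [|[|[|[|]]]].
Qed.

Lemma quaternion8_inD1 G : G \isog 'Q_8 -> inD 1 G.
Proof.
move=> isoG; have n3 : 2 < 3 by [].
have [[h y] genG _] := generators_quaternion n3 isoG.
have [_ _ [defZ oZ uniq _ _] _ _] := quaternion_structure n3 genG isoG.
have oG : #|G| = 8 by case: genG.
apply: (@inD1_2group _ (h ^+ 2)); rewrite ?oG //.
  by rewrite /pgroup oG.
move=> z Gz z2; apply/eqP; rewrite eq_sym eqEcard sub_cent1_cycle // -orderE.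
have dC : #|'C_G[z]| %| 8 by rewrite -oG cardSg ?subsetIl.
have dz : #[z] %| #|'C_G[z]| by rewrite order_dvdG // inE Gz cent1id.
have C8 : #|'C_G[z]| != 8.
  apply/eqP=> C8; have : z \in 'Z(G).
    rewrite inE Gz -sub_cent1; apply/setIidPl/eqP.
    by rewrite eqEcard subsetIl oG C8.
  by move/order_dvdG; rewrite oZ => /(dvdn_leq (isT : 0 < 2)); rewrite leqNgt z2.
exact: dvd8_leq dC C8 dz z2.
Qed.

Lemma Frobenius_complement_cent1 G A B y : [Frobenius G = A ><| B] -> y \in B^# -> 'C_G[y] = 'C_B[y].
Proof.
move=> FrobG B1y; have [_ By] := setD1P B1y.
have [_ tiB] := andP (FrobeniusWcompl FrobG).
have := cent1_normedTI tiB B1y => sC.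
have [defG _ _ _ pBG] := Frobenius_context FrobG.
apply/eqP; rewrite eqEsubset subsetI sC subsetIr /=.
by rewrite setSI // proper_sub.
Qed.

(** The kernel and the conjugates of the complement cover a Frobenius group. *)
Lemma Frobenius_elements G A B y : [Frobenius G = A ><| B] -> y \in G ->
  y \in A \/ exists2 g, g \in G & y ^ g \in B^#.
Proof.
move=> FrobG Gy; have [nyA | yA] := boolP (y \in A); first by left.
right; have [defG _ _ pAG _] := Frobenius_context FrobG.
have := Frobenius_partition FrobG => /and3P[/eqP cov _ _].
have : y \in cover (gval A |: (B^# :^: A)) by rewrite cov.
case/bigcupP=> C /setU1P[-> | /imsetP[a Aa ->]]; first by rewrite (negPf yA).
rewrite mem_conjg => By; exists a^-1 => //.
by rewrite groupV (subsetP (proper_sub pAG)).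
Qed.

(** The complement, of order [#|A|.-1], is regular on the involutions. An element of
  odd order is conjugate to an element of the complement. *)
Lemma Frobenius_abelem_inD1 G A B s q :
    0 < s -> q = (2 ^ s - 1)%N -> prime q -> is_elementary_abelian 2 s A ->
  is_cyclic_of_order q B -> [Frobenius G = A ><| B] -> inD 1 G.
Proof.
move=> s0 eq pr_q [abA oA] [cycB oB] FrobG.
have [defG ntA ntB pAG pBG] := Frobenius_context FrobG.
have [nsAG sBG _ nAB _] := sdprod_context defG; have sAG := proper_sub pAG.
have odd_q : odd q by rewrite eq oddB ?expn_gt0 // oddX; case: (s) s0.
have q2 : 2 < q by rewrite ltn_neqAle prime_gt1 // andbT; apply: contraTneq odd_q => <-.
have cop := Frobenius_coprime FrobG.
have sylA : 2.-Sylow(G) A.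
  rewrite /pHall sAG (abelem_pgroup abA) /= -divgS // -(sdprod_card defG).
  by rewrite mulKn ?cardG_gt0 // -odd_2'nat oB.
have oA1 : #|A^#| = q by rewrite eq -oA (cardsD1 1 A) group1 addKn.
apply: (inD1_criterion sylA).
- by rewrite oA (leq_trans q2) // eq leq_subr.
- move=> y Gy pr_y odd_y; have ny : y != 1 by rewrite -order_gt1 prime_gt1.
  have [Ay | [g Gg Byg]] := Frobenius_elements FrobG Gy.
    by rewrite (abelem_order_p abA Ay ny) in odd_y.
  have [nyg By] := setD1P Byg.
  have eB : <[y ^ g]> = B.
    apply/eqP; rewrite eqEcard cycle_subG By /= oB.
    have := order_dvdG By; rewrite oB => d.
    by rewrite -orderE; move/primeP: pr_q => [_ /(_ _ d)]; rewrite order_eq1 (negPf nyg) => /eqP->.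
  apply: (@conjsg_inj _ g).
  have -> : 'C_G[y] :^ g = 'C_G[y ^ g] by rewrite conjIg conjGid // -normJ conjg_set1.
  rewrite (Frobenius_complement_cent1 FrobG Byg) -cycleJ eB; apply/setIidPl.
  by rewrite sub_cent1 (subsetP (cyclic_abelian cycB)).
- move=> u v Au Av ou ov.
  have nu : u != 1 by rewrite -order_gt1 ou.
  suffices : A^# \subset u ^: B.
    move/subsetP/(_ v); rewrite !inE Av -order_gt1 ov => /(_ isT).
    by apply/subsetP/imsetS.
  rewrite subEproper; apply/orP; left; rewrite eq_sym eqEcard oA1.
  apply/andP; split.
    apply/subsetP=> _ /imsetP[g Bg ->]; rewrite !inE conjg_eq1 nu memJ_norm //.
    by rewrite (subsetP nAB).
  rewrite -index_cent1.
  have -> : 'C_B[u] = 1.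
    by apply: (Frobenius_reg_compl FrobG); rewrite !inE nu.
  by rewrite indexg1 oB.
move=> y Ay y2; have ny : y != 1 by rewrite -order_gt1 ltnW.
by rewrite (abelem_order_p abA Ay ny) in y2.
Qed.

Lemma Frobenius_cyclic4_inD1 G A B q : prime q -> is_cyclic_of_order q A ->
  is_cyclic_of_order 4 B -> [Frobenius G = A ><| B] -> inD 1 G.
Proof.
move=> pr_q [cycA oA] [cycB oB] FrobG.
have [defG ntA ntB pAG pBG] := Frobenius_context FrobG.
have [nsAG sBG _ nAB _] := sdprod_context defG; have sAG := proper_sub pAG.
have cop := Frobenius_coprime FrobG.
have oddA : odd #|A| by move: cop; rewrite oB -[4]/(2 ^ 2)%N coprime_pexpr // coprimen2.
have sylB : 2.-Sylow(G) B.
  rewrite /pHall sBG /pgroup oB /= -divgS // -(sdprod_card defG) mulnK ?cardG_gt0 //.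
  by rewrite -odd_2'nat.
have B1cent y : y \in B^# -> 'C_G[y] = B.
  move=> B1y; have [_ By] := setD1P B1y.
  rewrite (Frobenius_complement_cent1 FrobG B1y); apply/setIidPl.
  by rewrite sub_cent1 (subsetP (cyclic_abelian cycB)).
apply: (inD1_criterion sylB); rewrite ?oB //.
- move=> y Gy pr_y odd_y; have ny : y != 1 by rewrite -order_gt1 prime_gt1.
  have [Ay | [g Gg Byg]] := Frobenius_elements FrobG Gy.
    have eA : <[y]> = A.
      apply/eqP; rewrite eqEcard cycle_subG Ay /= oA.
      have := order_dvdG Ay; rewrite oA => d.
      by rewrite -orderE; move/primeP: pr_q => [_ /(_ _ d)]; rewrite order_eq1 (negPf ny) => /eqP->.
    have A1y : y \in A^# by rewrite !inE ny.
    apply/eqP; rewrite eqEsubset sub_cent1_cycle // andbT eA.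
    exact: (Frobenius_cent1_ker FrobG).
  have [_ By] := setD1P Byg; have := order_dvdG By; rewrite orderJ oB.
  by case: #[y] pr_y odd_y => [|[|[|[|[|n]]]]] // _ _ /dvdn_leq.
- have [b defB] := cyclicP cycB.
  have ob : #[b] = 4 by rewrite orderE -defB.
  rewrite defB => u v Bu Bv ou ov.
  by rewrite (cycle4_involution ob Bu ou) (cycle4_involution ob Bv ov) class_refl.
move=> y By y2; have dv : #[y] %| 4 by rewrite -oB order_dvdG.
have oy : #[y] = 4 by move: y2 dv; case: #[y] => [|[|[|[|[|n]]]]] // _ /dvdn_leq.
have eB : <[y]> = B by apply/eqP; rewrite eqEcard cycle_subG By oB -orderE oy.
rewrite eB; apply/setIidPl; rewrite sub_cent1.
exact: (subsetP (cyclic_abelian cycB)).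
Qed.
End SmallGroups.

Section D18.
Variable gT : finGroupType.
Implicit Types (G P A B : {group gT}) (a b c g h k t u v w x y z : gT).

(** The elements of order 3 are [x ^+ 3] and its inverse, conjugate under a
  reflection. Commuting reflections are equal, because their product is a rotation
  of odd order equal to its own inverse. *)
Lemma dihedral18_inD1 G : G \isog 'D_18 -> inD 1 G.
Proof.
have GrpD : 'D_18 \isog Grp (x : y : x ^+ 9, y ^+ 2, x ^ y = x^-1). exact: (@Grp_dihedral 9).
case/(isoGrpP _ GrpD); rewrite (@card_dihedral 9) // => oG.
case/existsP=> -[x y] /= /eqP[defG x9 y2 xy].
have {}defG : <[x]> * <[y]> = G.
  by rewrite -norm_joinEr // norms_cycle xy groupV cycle_id.
have le9 : #[x] <= 9 by rewrite dvdn_leq // order_dvdn x9.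
have le2 : #[y] <= 2 by rewrite dvdn_leq // order_dvdn y2.
have ge18 : 18 <= #[x] * #[y].
  by rewrite -[18]/(9.*2) -oG -defG !orderE mul_cardG leq_pmulr ?cardG_gt0.
have ox : #[x] = 9.
  apply/eqP; rewrite eqn_leq le9 -(leq_pmul2r (isT : 0 < 2)) (leq_trans ge18) //.
  by rewrite leq_mul2l le2 orbT.
have oy : #[y] = 2.
  by apply/eqP; rewrite eqn_leq le2 -(leq_pmul2l (isT : 0 < 9)) -[X in _ <= X * _]ox; exact: ge18.
have Gx : x \in G by rewrite -defG (subsetP (mulG_subl _ _)) ?cycle_id.
have Gy : y \in G by rewrite -defG (subsetP (mulG_subr _ _)) ?cycle_id.
have sKG : <[x]> \subset G by rewrite cycle_subG.
have ky k : k \in <[x]> -> k ^ y = k^-1.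
  by case/cycleP=> i ->; rewrite conjXg xy expgVn.
have Kabel : abelian <[x]> := cycle_abelian x.
have cases g : g \in G -> g \in <[x]> \/ exists2 k, k \in <[x]> & g = k * y.
  rewrite -defG => /mulsgP[k u Kk]; rewrite cycle2g // !inE.
  by case/orP=> /eqP -> ->; [left; rewrite mulg1 | right; exists k].
have kg k l : k \in <[x]> -> l \in <[x]> -> k ^ (l * y) = k^-1.
  move=> Kk Kl; rewrite conjgM (_ : k ^ l = k) ?ky //.
  by apply/conjg_fixP/commgP/(centsP Kabel).
have odd_fix k : k \in <[x]> -> k^-1 = k -> k = 1.
  move=> Kk e; apply/eqP; rewrite -order_eq1.
  have d2 : #[k] %| 2 by rewrite order_dvdn expg2 -{1}e mulVg.
  have d9 : #[k] %| 9 by rewrite -ox order_dvdG.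
  by rewrite -dvdn1 (dvdn_gcd _ 2 9 : #[k] %| 1 = _) d2.
have oKy k : k \in <[x]> -> #[k * y] = 2.
  move=> Kk; apply: nt_prime_order => //.
    by apply/eqP; rewrite -order_dvdn involution_pair_inverts // ky.
  apply/eqP=> e; have : y \in <[x]> by rewrite -(mulKg k y) e mulg1 groupV.
  by move/order_dvdG; rewrite oy -orderE ox.
apply/inD1_structure; exists 3, (x ^+ 3); split=> //.
have oz : #[x ^+ 3] = 3 by rewrite orderXdiv ox.
have Cx k : k \in <[x]> -> <[x]> \subset 'C_G[k].
  by move=> Kk; rewrite subsetI sKG sub_cent1 (subsetP Kabel).
split=> //; first exact: groupX.
- rewrite properEcard sub_cent1_cycle ?groupX //= -orderE oz.
  by apply: leq_trans (subset_leq_card (Cx _ (mem_cycle x 3))); rewrite -orderE ox.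
- move=> g Gg og; have [Kg | [k Kk eg]] := cases g Gg; last by rewrite eg oKy in og.
  have : <[g]> == <[x ^+ 3]>.
    by rewrite (eq_subG_cyclic (cycle_cyclic x)) ?cycle_subG ?mem_cycle // -!orderE og oz.
  move/eqP=> eg; have : g \in <[x ^+ 3]> by rewrite -eg cycle_id.
  case/cyclePmin=> i; rewrite oz => lt3 gi; case: i lt3 gi => [|[|[|i]]] // _ gi.
  - by rewrite gi expg0 order1 in og.
  - by rewrite gi expg1 class_refl.
  apply/imsetP; exists y => //; rewrite ky ?mem_cycle // gi; apply/eqP.
  by rewrite eq_sym eq_invg_mul -expgS -expgM x9.
move=> g Gg ng og; apply/eqP; rewrite eqEsubset sub_cent1_cycle // andbT.
apply/subsetP=> w /setIP[Gw Cw]; have gw : g ^ w = g.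
  by apply/conjg_fixP/commgP/cent1P; rewrite cent1C.
have [Kg | [k Kk eg]] := cases g Gg.
  have eK : <[g]> = <[x]>.
    apply/eqP; rewrite eqEcard cycle_subG Kg -!orderE ox /=.
    have : #[g] %| 9 by rewrite -ox order_dvdG.
    move: og ng; rewrite -order_eq1; case: #[g] => [|[|[|[|[|[|[|[|[|n]]]]]]]]] //.
  have [Kw | [l Kl ew]] := cases w Gw; first by rewrite eK.
  by rewrite ew kg // in gw; rewrite (odd_fix g) ?eqxx in ng.
have [Kw | [l Kl ew]] := cases w Gw.
  have wg : w ^ g = w by apply/conjg_fixP/commgP/cent1P.
  by rewrite eg kg // in wg; rewrite (odd_fix w) ?group1.
have Kwg : w * g \in <[x]>.
  have tt : y * y = 1 by [].
  have -> : w * g = l * k^-1; last by rewrite groupM ?groupV.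
  by rewrite -(ky k Kk) ew eg conjgE (involution_inv tt) !mulgA.
have wg1 : w * g = 1.
  have wg : w ^ g = w by apply/conjg_fixP/commgP/cent1P.
  by apply: odd_fix => //; rewrite -(kg _ k) // -eg conjMg wg conjgE mulKg.
have -> : w = g^-1 by apply: (mulIg g); rewrite mulVg.
by rewrite groupV cycle_id.
Qed.
End D18.

(** * Matrices of order two over the field of seven elements *)

Lemma card_count (T : finType) (s : seq T) (P : pred T) :
  uniq s -> (forall x, x \in s) -> #|P| = count P s.
Proof.
move=> us sT; rewrite -size_filter -(card_uniqP (filter_uniq _ us)).
by apply: eq_card => x; rewrite mem_filter sT andbT.
Qed.

Section Quadruples.
Import GRing.Theory.
Local Notation F := 'F_7.
(** Matrices [[a, b; c, d]] over the field of seven elements as quadruples, on which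
  matrix computations reduce to values; statements about all matrices can be checked
  on a list. *)
Definition quad := (F * F * F * F)%type.

Definition quad_mx (x : quad) : 'M[F]_2 :=
  let: (a, b, c, d) := x in
  (\matrix_(i, j) (if i == 0 then if j == 0 then a else b else if j == 0 then c else d))%R.
Definition quad_mul (x y : quad) : quad :=
  let: (a, b, c, d) := x in let: (a', b', c', d') := y in
  (a * a' + b * c', a * b' + b * d', c * a' + d * c', c * b' + d * d')%R.
Definition quad_det (x : quad) : F := let: (a, b, c, d) := x in (a * d - b * c)%R.
Definition quad_opp (x : quad) : quad := let: (a, b, c, d) := x in (- a, - b, - c, - d)%R.

Definition elements7 : seq F := [seq inZp i | i <- iota 0 7].
Definition quads : seq quad :=
  [seq (p, d) | p <- [seq (p, c) | p <- [seq (a, b) | a <- elements7, b <- elements7], c <- elements7], d <- elements7].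

Lemma mem_quads x : x \in quads.
Proof.
have mF (a : F) : a \in elements7 by apply/mapP; exists (val a); rewrite ?valZpK // mem_iota /= ltn_ord.
case: x => [[[a b] c] d].
by do 3!(apply: allpairs_f => //).
Qed.

Lemma quad_forall (P : pred quad) : all P quads -> forall x, P x.
Proof. by move/allP=> h x; apply: h; apply: mem_quads. Qed.

Lemma quad_mx_mul x y : (quad_mx x *m quad_mx y = quad_mx (quad_mul x y))%R.
Proof.
case: x y => [[[a b] c] d] [[[a' b'] c'] d'].
apply/matrixP=> i j; rewrite !mxE !big_ord_recl big_ord0 !mxE /= addr0.
by case: (i == 0)%R; case: (j == 0)%R.
Qed.

Lemma quad_mx_det x : (\det (quad_mx x) = quad_det x)%R.
Proof.
case: x => [[[a b] c] d].
rewrite (expand_det_row _ 0%R) !big_ord_recl big_ord0 /cofactor !det_mx11 !mxE /= addr0.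
by rewrite /bump /= expr0 expr1 mul1r mulN1r mulrN.
Qed.

Lemma quad_mx_inj : injective quad_mx.
Proof.
case=> [[[a b] c] d] [[[a' b'] c'] d'] /matrixP e.
have := (e 0 0, e 0 1, (e 1 0, e 1 1))%R; rewrite !mxE /=.
by case=> [[-> ->] [-> ->]].
Qed.

Lemma quad_mx_onto M : exists x, M = quad_mx x.
Proof.
exists (M 0 0, M 0 1, M 1 0, M 1 1)%R.
by apply/matrixP=> -[[|[|i]] ?] -[[|[|j]] ?] //; rewrite mxE /=; congr (M _ _); apply: val_inj.
Qed.

Lemma uniq_quads : uniq quads.
Proof.
have uF : uniq elements7 by [].
by do 3!(apply: allpairs_uniq => //; last by move=> [? ?] [? ?] _ _ /= [-> ->]).
Qed.
Lemma card_quads : count (fun x => quad_det x == 1%R) quads = 336.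
Proof. by lazy. Qed.

(** Meaningful for quadruples of determinant 1; the default value 1 makes it
  total. *)
Definition quad_GL (x : quad) : {'GL_2[F]} := insubd (1%g : {'GL_2[F]}) (quad_mx x).

Lemma quad_GLE x : quad_det x = 1%R -> GLval (quad_GL x) = quad_mx x.
Proof.
move=> dx; rewrite -[GLval _]/(val (quad_GL x)) val_insubd.
by rewrite -[_ \is a GRing.unit]/(quad_mx x \in unitmx) unitmxE quad_mx_det dx unitr1.
Qed.

Lemma quad_GL_SL x : quad_det x = 1%R -> quad_GL x \in SL 2 F.
Proof. by move=> dx; rewrite inE quad_GLE // quad_mx_det dx. Qed.

Lemma SL_quad_GL u : u \in SL 2 F -> exists2 x, quad_det x = 1%R & u = quad_GL x.
Proof.
rewrite inE; have [x e] := quad_mx_onto (GLval u); rewrite e quad_mx_det => /eqP dx.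
by exists x => //; apply: val_inj; rewrite /= -[LHS]/(GLval u) e -quad_GLE.
Qed.

Lemma quad_det_mul x y : quad_det (quad_mul x y) = (quad_det x * quad_det y)%R.
Proof. by rewrite -!quad_mx_det -quad_mx_mul det_mulmx. Qed.

Lemma quad_GLM x y : quad_det x = 1%R -> quad_det y = 1%R ->
  quad_GL (quad_mul x y) = quad_GL x * quad_GL y.
Proof.
move=> dx dy; apply: val_inj; rewrite -[LHS]/(GLval _) -[RHS]/(GLval _) GL_ME.
by rewrite !quad_GLE ?quad_det_mul ?dx ?dy ?mulr1 // -quad_mx_mul.
Qed.

Lemma quad_GL_inj x y : quad_det x = 1%R -> quad_det y = 1%R -> quad_GL x = quad_GL y -> x = y.
Proof. by move=> dx dy e; apply: quad_mx_inj; rewrite -!quad_GLE // e. Qed.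

(** By enumeration of the quadruples of determinant 1. *)
Lemma card_SL : #|SL 2 F| = 336.
Proof.
have <- : #|[set x : quad | quad_det x == 1%R]| = 336.
  by rewrite -card_quads cardsE (card_count _ uniq_quads mem_quads).
rewrite -(card_in_imset (f := quad_GL)); last first.
  by move=> x y; rewrite !inE => /eqP dx /eqP dy; apply: quad_GL_inj.
apply: eq_card => u; apply/idP/imsetP => [/SL_quad_GL[x dx ->] | [x]].
  by exists x; rewrite ?inE ?dx.
by rewrite inE => /eqP dx ->; apply: quad_GL_SL.
Qed.

Definition quad1 : quad := (1, 0, 0, 1)%R.

Lemma quad_GL1 : quad_GL quad1 = 1.
Proof.
apply: val_inj; rewrite -[LHS]/(GLval _) -[RHS]/(GLval _) GL_1E quad_GLE; last by apply/eqP.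
by apply/matrixP=> -[[|[|i]] ?] -[[|[|j]] ?] //; rewrite !mxE.
Qed.

Lemma quad_mul_opp x y : quad_mul (quad_opp x) y = quad_opp (quad_mul x y).
Proof.
by case: x y => [[[a b] c] d] [[[a' b'] c'] d']; rewrite /= !mulNr -!opprD.
Qed.

Lemma quad_mulN x y : quad_mul x (quad_opp y) = quad_opp (quad_mul x y).
Proof.
by case: x y => [[[a b] c] d] [[[a' b'] c'] d']; rewrite /= !mulrN -!opprD.
Qed.

Lemma quad_mulr1 x : quad_mul x quad1 = x.
Proof. by case: x => [[[a b] c] d]; rewrite /= !mulr1 !mulr0 !addr0 !add0r. Qed.

Lemma quad_mul1 x : quad_mul quad1 x = x.
Proof. by case: x => [[[a b] c] d]; rewrite /= !mul1r !mul0r !addr0 !add0r. Qed.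

Lemma quad_det_opp x : quad_det (quad_opp x) = quad_det x.
Proof. by case: x => [[[a b] c] d]; rewrite /= !mulrNN. Qed.

Definition quadU : quad := (1, 1, 0, 1)%R.
Definition quadL : quad := (1, 0, 1, 1)%R.

Lemma quad_det1 : quad_det quad1 = 1%R.
Proof. exact/eqP. Qed.

Lemma quad_detN1 : quad_det (quad_opp quad1) = 1%R.
Proof. exact/eqP. Qed.

(** A matrix of determinant 1 that commutes with the transvections [quadU] and
  [quadL] is scalar, and the square of the scalar is 1. *)
Lemma quad_center : 'Z(SL 2 F) = [set 1; quad_GL (quad_opp quad1)].
Proof.
have d1 : quad_det quad1 = 1%R by apply/eqP.
have dN : quad_det (quad_opp quad1) = 1%R by rewrite quad_det_opp.
apply/setP=> z; apply/centerP/set2P=> [[/SL_quad_GL[x dx ->] cz] | [] -> ].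
- have cx y : quad_det y = 1%R -> quad_mul x y = quad_mul y x.
    move=> dy; apply: quad_GL_inj; rewrite ?quad_det_mul ?dx ?dy ?mulr1 //.
    by rewrite !quad_GLM // (cz _ (quad_GL_SL dy)).
  have: [==> quad_det x == 1, quad_mul x quadU == quad_mul quadU x, quad_mul x quadL == quad_mul quadL x => (x == quad1) || (x == quad_opp quad1)]%R.
    by move: x {dx cx cz}; apply: quad_forall; lazy.
  rewrite !cx ?dx ?eqxx //=; try by apply/eqP.
  by case/orP=> /eqP ->; [left; rewrite quad_GL1 | right].
- by rewrite group1; split=> // y _; apply: commute_sym; apply: commute1.
split=> [|y /SL_quad_GL[x dx ->]]; first exact: quad_GL_SL.
by rewrite /commute -(quad_GLM dN dx) -(quad_GLM dx dN) quad_mul_opp quad_mulN quad_mul1 quad_mulr1.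
Qed.

Lemma card_PSL : #|PSL 2 F| = 168.
Proof.
have nZ := normal_norm (center_normal (SL_group 2 F)).
rewrite /PSL card_quotient //.
have oZ : #|'Z(SL 2 F)| = 2.
  rewrite quad_center cards2; case: eqP => // e.
  by have := quad_GL_inj quad_det1 quad_detN1 (etrans quad_GL1 e).
by rewrite -divgS ?center_sub //= oZ card_SL.
Qed.

Definition quad_PSL (x : quad) : coset_of 'Z(SL 2 F) := coset _ (quad_GL x).

Lemma PSL_quad g : g \in PSL 2 F -> exists2 x, quad_det x = 1%R & g = quad_PSL x.
Proof.
by case/morphimP=> u _ /SL_quad_GL[x dx ->] ->; exists x.
Qed.

Lemma quad_PSL_in x : quad_det x = 1%R -> quad_PSL x \in PSL 2 F.
Proof.
move=> dx; apply: mem_quotient; exact: quad_GL_SL.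
Qed.

Lemma quad_norm x : quad_det x = 1%R -> quad_GL x \in 'N('Z(SL 2 F)).
Proof.
by move=> dx; apply: (subsetP (normal_norm (center_normal (SL_group 2 F)))); apply: quad_GL_SL.
Qed.

Lemma quad_PSLM x y : quad_det x = 1%R -> quad_det y = 1%R ->
  quad_PSL (quad_mul x y) = quad_PSL x * quad_PSL y.
Proof.
move=> dx dy; rewrite /quad_PSL (quad_GLM dx dy).
by rewrite (coset_morphM (quad_norm dx) (quad_norm dy)).
Qed.

Lemma quad_PSL_opp x : quad_det x = 1%R -> quad_PSL (quad_opp x) = quad_PSL x.
Proof.
move=> dx; rewrite -{1}(quad_mul1 x) -quad_mul_opp (quad_PSLM quad_detN1 dx).
suff -> : quad_PSL (quad_opp quad1) = 1 by apply: mul1g.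
have zN : quad_GL (quad_opp quad1) \in 'Z(SL 2 F) by rewrite quad_center set22.
exact: coset_id zN.
Qed.

Lemma quad_PSL_inj x y : quad_det x = 1%R -> quad_det y = 1%R ->
  quad_PSL x = quad_PSL y -> x = y \/ x = quad_opp y.
Proof.
move=> dx dy /(rcoset_kercosetP (quad_norm dx) (quad_norm dy)).
have dN : quad_det (quad_opp y) = 1%R by rewrite quad_det_opp.
case/rcosetP=> z; rewrite /= quad_center => /set2P[] ->.
  by rewrite mul1g => /(quad_GL_inj dx dy); left.
rewrite -(quad_GLM quad_detN1 dy) quad_mul_opp quad_mul1.
by move/(quad_GL_inj dx dN); right.
Qed.

End Quadruples.

(** * The simple group of order 168 *)

Lemma card_dihedral8_join (gT : finGroupType) (h u : gT) :
  #[h] = 4 -> #[u] = 2 -> h ^ u = h^-1 -> #|<[h]> <*> <[u]>| = 8.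
Proof.
move=> oh ou hu.
have nhu : <[u]> \subset 'N(<[h]>) by rewrite cycle_subG inE -cycleJ hu cycleV.
rewrite norm_joinEr // TI_cardMg -?orderE ?oh ?ou //.
rewrite setIC; apply: prime_TIg; rewrite -?orderE ?ou // cycle_subG.
apply/negP=> /cycleP[i ui].
have ch : h ^ u = h by apply/conjg_fixP/commgP; rewrite ui; apply: commuteX.
have : #[h] %| 2 by rewrite order_dvdn expg2 -{1}ch hu mulVg.
by rewrite oh.
Qed.

Lemma inverts_of_product (gT : finGroupType) (h u : gT) :
  u * u = 1 -> (h * u) ^+ 2 = 1 -> h ^ u = h^-1.
Proof.
move=> u2 e; rewrite conjgE (involution_inv u2); apply/esym/eqP.
by rewrite eq_invg_mul; apply/eqP; rewrite -[RHS]e expg2 !mulgA.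
Qed.

(** The subgroup generated by [h] and [u] is dihedral of order 8. *)
Lemma dihedral8_Sylow (gT : finGroupType) (G : {group gT}) (h u : gT) :
    h \in G -> u \in G -> (#|G|`_2)%N = 8 -> #[h] = 4 -> #[u] = 2 -> h ^ u = h^-1 ->
  exists P : {group gT}, [/\ 2.-Sylow(G) P, #|P| = 8, h \in P & u \in P].
Proof.
move=> Gh Gu oG oh ou hu; exists (<[h]> <*> <[u]>)%G.
have oP := card_dihedral8_join oh ou hu.
rewrite pHallE oG oP /= join_subG !cycle_subG Gh Gu.
by split=> //; rewrite -cycle_subG ?joing_subl ?joing_subr.
Qed.

(** By Sylow's theorem it is enough to test one element of each odd prime order, and
  the elements of order 4 of [P] lie in [<[h]>]. *)
Lemma order168_one_deficient (gT : finGroupType) (G P : {group gT}) (h u b3 b7 j : gT) :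
    #|G| = 168 -> 2.-Sylow(G) P -> #|P| = 8 -> h \in P -> u \in P ->
    #[h] = 4 -> #[u] = 2 -> h ^ u = h^-1 -> 'C_G[h] = <[h]> ->
    [/\ b3 \in G, #[b3] = 3 & 'C_G[b3] = <[b3]>] ->
    [/\ b7 \in G, #[b7] = 7 & 'C_G[b7] = <[b7]>] ->
    (forall v, v \in G -> #[v] = 2 -> v \in j ^: G) ->
  exists x, one_deficient_prime 2 G x.
Proof.
move=> oG sylP oP Ph Pu oh ou hu Ch [G3 o3 C3] [G7 o7 C7] JG.
have [sPG _ _] := and3P sylP.
apply: (one_deficient_criterion sylP); rewrite ?oP //.
- move=> y Gy pr_y odd_y.
  have : #[y] \in primes 168 by rewrite mem_primes pr_y /= -oG order_dvdG.
  rewrite -[primes 168]/[:: 2; 3; 7] !inE => /or3P[] /eqP oy; first by move: odd_y; rewrite oy.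
    by apply: (self_cent_prime_order G3) Gy _; rewrite ?o3.
  by apply: (self_cent_prime_order G7) Gy _; rewrite ?o7.
- move=> v1 v2 /(subsetP sPG) Gv1 /(subsetP sPG) Gv2 o1 o2.
  by rewrite (class_eqP (JG v1 Gv1 o1)) JG.
move=> y Py oy; have [yh | [e _]] := dihedral8_elements oP Ph Pu oh ou hu Py; last by rewrite e in oy.
have yh4 : <[y]> = <[h]>.
  apply/eqP; rewrite eqEcard cycle_subG yh -!orderE oh.
  have : #[y] %| 4 by rewrite -oh order_dvdG.
  by case: #[y] oy => [|[|[|[|]]]].
have : 'C(<[y]>) = 'C(<[h]>) by rewrite yh4.
rewrite !cent_cycle yh4 => ->; apply/eqP; rewrite eqEsubset -{1}Ch setSI //=.
by rewrite sub_cent1_cycle.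
Qed.

Section PSL27.
Import GRing.Theory.
Local Notation F := 'F_7.
Local Notation G := (PSL_group 2 F).
Local Notation g := quad_PSL.

Definition quad_pow (b : quad) k := iter k (quad_mul b) quad1.

Definition quad_commute (x y : quad) :=
  (quad_mul x y == quad_mul y x) || (quad_mul x y == quad_opp (quad_mul y x)).

Lemma quad_PSL1 : g quad1 = 1.
Proof. by rewrite /quad_PSL quad_GL1 morph1. Qed.

Lemma quad_det_pow b k : quad_det b = 1%R -> quad_det (quad_pow b k) = 1%R.
Proof. by move=> db; elim: k => [|k IHk] //=; [exact/eqP | rewrite quad_det_mul db IHk mulr1]. Qed.

Lemma quad_PSLX b k : quad_det b = 1%R -> g (quad_pow b k) = g b ^+ k.
Proof.
move=> db; elim: k => [|k IHk] /=; first exact: quad_PSL1.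
by rewrite (quad_PSLM db (quad_det_pow k db)) IHk expgS.
Qed.

Lemma quad_PSL_eq1 x : quad_det x = 1%R -> g x = 1 -> (x == quad1) || (x == quad_opp quad1).
Proof.
by move=> dx; rewrite -quad_PSL1 => /(quad_PSL_inj dx quad_det1)[] ->; rewrite eqxx ?orbT.
Qed.

Lemma quad_PSL_neq1 x : quad_det x = 1%R -> ~~ ((x == quad1) || (x == quad_opp quad1)) -> g x != 1.
Proof. by move=> dx; apply: contra => /eqP /(quad_PSL_eq1 dx). Qed.

Lemma quad_PSL_powE b k : quad_det b = 1%R ->
  (quad_pow b k == quad1) || (quad_pow b k == quad_opp quad1) -> g b ^+ k = 1.
Proof.
move=> db; rewrite -(quad_PSLX k db) => /orP[] /eqP ->; first exact: quad_PSL1.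
by rewrite (quad_PSL_opp quad_det1) quad_PSL1.
Qed.

Lemma quad_PSL_commute x y : quad_det x = 1%R -> quad_det y = 1%R ->
  commute (g x) (g y) -> quad_commute x y.
Proof.
move=> dx dy; rewrite /commute -(quad_PSLM dx dy) -(quad_PSLM dy dx).
have dxy u v : quad_det u = 1%R -> quad_det v = 1%R -> quad_det (quad_mul u v) = 1%R.
  by move=> du dv; rewrite quad_det_mul du dv mulr1.
rewrite /quad_commute => /(quad_PSL_inj (dxy _ _ dx dy) (dxy _ _ dy dx))[] ->.
  by rewrite eqxx.
by rewrite eqxx orbT.
Qed.

(** Two elements of the projective group commute when their matrices commute up to
  sign, and their equality is equality of matrices up to sign; the exponents below 7
  suffice for elements of order at most 7. *)
Definition self_centralizing (b : quad) :=
  all (fun x => [==> quad_det x == 1%R, quad_commute x b =>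
     has (fun k => (x == quad_pow b k) || (x == quad_opp (quad_pow b k))) (iota 0 7)]) quads.

Lemma quad_cent b : quad_det b = 1%R -> self_centralizing b -> 'C_G[g b] = <[g b]>.
Proof.
move=> db sb; apply/eqP; rewrite eqEsubset sub_cent1_cycle ?quad_PSL_in // andbT.
apply/subsetP=> y /setIP[/PSL_quad[x dx ->] /cent1P /(quad_PSL_commute dx db) cx].
have /implyP/(_ (introT eqP dx)) := quad_forall sb x; rewrite cx => /hasP[k _].
by case/orP=> /eqP ->; rewrite ?quad_PSL_opp ?quad_det_pow // quad_PSLX // mem_cycle.
Qed.

(** Elements of orders 3, 2, 4 and 2 in the projective group: [quad4] has square
  [quadJ], and [quadW] inverts it. The element of order 7 is [quadU]. *)
Definition quad3 : quad := (2%:R, 0, 0, 4%:R)%R.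
Definition quadJ : quad := (0, 1, -1, 0)%R.
Definition quad4 : quad := (2%:R, 2%:R, -2%:R, 2%:R)%R.
Definition quadW : quad := (2%:R, 3%:R, 3%:R, -2%:R)%R.

Lemma cent7 : self_centralizing quadU. Proof. by lazy. Qed.
Lemma cent3 : self_centralizing quad3. Proof. by lazy. Qed.
Lemma cent4 : self_centralizing quad4. Proof. by lazy. Qed.

(** A matrix [y] with [quadJ y = y x] conjugates [quadJ] to [x]. *)
Lemma involutions_conjugate :
  all (fun x => [==> quad_det x == 1%R, ~~ ((x == quad1) || (x == quad_opp quad1)),
     (quad_pow x 2 == quad1) || (quad_pow x 2 == quad_opp quad1)
   => has (fun y => (quad_det y == 1%R) && (quad_mul quadJ y == quad_mul y x)) quads]) quads.
Proof. by lazy. Qed.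

Lemma quad_involution x : quad_det x = 1%R -> #[g x] = 2 ->
  exists2 y, quad_det y = 1%R & g x = g quadJ ^ g y.
Proof.
move=> dx ox.
have dJ : quad_det quadJ = 1%R by apply/eqP.
have dxx : quad_det (quad_pow x 2) = 1%R by apply: quad_det_pow.
have x2 : g (quad_pow x 2) = 1 by rewrite (quad_PSLX 2 dx); have := expg_order (g x); rewrite ox.
have nx : g x != 1 by rewrite -order_gt1 ox.
have := quad_PSL_eq1 dxx x2.
have nx1 : ~~ ((x == quad1) || (x == quad_opp quad1)).
  by apply: contra nx => /orP[] /eqP ->; rewrite ?(quad_PSL_opp quad_det1) quad_PSL1.
move=> e; have /implyP/(_ (introT eqP dx)) := quad_forall involutions_conjugate x.
move=> /implyP/(_ nx1) /implyP/(_ e) /hasP[y _ /andP[/eqP dy /eqP ey]].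
exists y => //.
by rewrite conjgE -(quad_PSLM dJ dy) ey (quad_PSLM dy dx) mulKg.
Qed.

Let dw : quad_det quadW = 1%R. Proof. exact/eqP. Qed.
Let d3 : quad_det quad3 = 1%R. Proof. exact/eqP. Qed.
Let d4 : quad_det quad4 = 1%R. Proof. exact/eqP. Qed.
Let d7 : quad_det quadU = 1%R. Proof. exact/eqP. Qed.

Lemma quad_order3 : #[g quad3] = 3.
Proof. by apply: nt_prime_order => //; [apply: quad_PSL_powE | apply: quad_PSL_neq1]. Qed.

Lemma quad_order7 : #[g quadU] = 7.
Proof. by apply: nt_prime_order => //; [apply: quad_PSL_powE | apply: quad_PSL_neq1]. Qed.

Lemma quad_orderw : #[g quadW] = 2.
Proof. by apply: nt_prime_order => //; [apply: quad_PSL_powE | apply: quad_PSL_neq1]. Qed.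

Lemma quad_order4 : #[g quad4] = 4.
Proof.
apply: (@orderXprime _ 2 2) => //; apply: nt_prime_order => //.
  by rewrite -expgM; apply: quad_PSL_powE.
by rewrite -(quad_PSLX 2 d4); apply: quad_PSL_neq1; first exact: quad_det_pow.
Qed.

Lemma quad_invert : g quad4 ^ g quadW = (g quad4)^-1.
Proof.
have dm : quad_det (quad_mul quad4 quadW) = 1%R by apply/eqP.
have e : g (quad_mul quad4 quadW) ^+ 2 = 1 by apply: quad_PSL_powE.
rewrite (quad_PSLM d4 dw) in e.
exact: inverts_of_product (order2_mul quad_orderw) e.
Qed.

Lemma PSL_dihedral_Sylow : exists (P : {group _}) h u, [/\ 2.-Sylow(G) P, #|P| = 8,
  h \in P, u \in P & [/\ #[h] = 4, #[u] = 2, h ^ u = h^-1 & 'C_G[h] = <[h]>]].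
Proof.
have oG2 : (#|PSL 2 F|`_2)%N = 8 by rewrite card_PSL p_part.
have [P [sylP oP P4 Pw]] :=
  dihedral8_Sylow (quad_PSL_in d4) (quad_PSL_in dw) oG2 quad_order4 quad_orderw quad_invert.
have Ch := quad_cent d4 cent4.
have C4 := And4 quad_order4 quad_orderw quad_invert Ch.
by exists P, (g quad4), (g quadW); apply: And5 sylP oP P4 Pw C4.
Qed.

Lemma PSL_one_deficient : exists x, one_deficient_prime 2 G x.
Proof.
have [P [h [u [sylP oP Ph Pu [oh ou hu Ch]]]]] := PSL_dihedral_Sylow.
apply: (order168_one_deficient card_PSL sylP oP Ph Pu oh ou hu Ch (b3 := g quad3) (b7 := g quadU) (j := g quadJ)).
- split; [exact: quad_PSL_in d3 | exact: quad_order3 | exact: quad_cent d3 cent3].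
- split; [exact: quad_PSL_in d7 | exact: quad_order7 | exact: quad_cent d7 cent7].
move=> v /PSL_quad[x dx ->] /(quad_involution dx)[y dy ->].
exact/memJ_class/quad_PSL_in.
Qed.
End PSL27.

(** * The simple group of order 60 *)

Lemma klein_join (gT : finGroupType) (u v : gT) :
    #[u] = 2 -> #[v] = 2 -> u != v -> commute u v ->
  [/\ #|<[u]> <*> <[v]>| = 4, 2.-abelem (<[u]> <*> <[v]>)
    & forall y, y \in <[u]> <*> <[v]> -> [\/ y = 1, y = u, y = v | y = u * v]].
Proof.
move=> ou ov nuv cuv.
have [u2 v2] := (order2_mul ou, order2_mul ov).
have cUV : <[v]> \subset 'C(<[u]>) by rewrite cycle_subG /= cent_cycle; apply/cent1P.
have E y : y \in <[u]> <*> <[v]> -> [\/ y = 1, y = u, y = v | y = u * v].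
  rewrite cent_joinEr //= (cycle2g ou) (cycle2g ov) => /mulsgP[a c /set2P[] -> /set2P[] -> ->].
  - by constructor 1; rewrite mulg1.
  - by constructor 3; rewrite mul1g.
  - by constructor 2; rewrite mulg1.
  by constructor 4.
split=> //.
  rewrite cent_joinEr // TI_cardMg -?orderE ?ou ?ov //.
  rewrite setIC; apply: prime_TIg; rewrite -?orderE ?ov // cycle_subG /= (cycle2g ou).
  by rewrite !inE negb_or -order_gt1 ov eq_sym.
apply/abelemP=> //; split=> [|y /E[] ->]; rewrite ?expg1n ?expg2 //.
  by rewrite abelianY !cycle_abelian.
by rewrite -mulgA (mulgA v) -cuv -mulgA v2 mulg1.
Qed.

Section Alt5.
Local Notation T := 'I_5.
Definition pt k (h : k < 5) : T := Ordinal h.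
Local Notation o0 := (pt (isT : 0 < 5)).
Local Notation o1 := (pt (isT : 1 < 5)).
Local Notation o2 := (pt (isT : 2 < 5)).
Local Notation o3 := (pt (isT : 3 < 5)).
Local Notation o4 := (pt (isT : 4 < 5)).

Lemma perm5_eq (p q : {perm T}) : [/\ p o0 = q o0, p o1 = q o1, p o2 = q o2, p o3 = q o3 & p o4 = q o4] -> p = q.
Proof.
case=> e0 e1 e2 e3 e4; apply/permP; case=> [[|[|[|[|[|?]]]]] h] //.
- by rewrite (_ : Ordinal h = o0) //; apply/val_inj.
- by rewrite (_ : Ordinal h = o1) //; apply/val_inj.
- by rewrite (_ : Ordinal h = o2) //; apply/val_inj.
- by rewrite (_ : Ordinal h = o3) //; apply/val_inj.
by rewrite (_ : Ordinal h = o4) //; apply/val_inj.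
Qed.

(** The cycles (0 1 2) and (0 1 2 3 4), and two double transpositions that generate
  a four-group normalized by the first cycle; a product of permutations applies its
  left factor first. *)
Definition rot3 : {perm T} := tperm o1 o2 * tperm o0 o1.
Definition rot5 : {perm T} := tperm o3 o4 * tperm o2 o3 * tperm o1 o2 * tperm o0 o1.
Definition swap1 : {perm T} := tperm o0 o1 * tperm o2 o3.
Definition swap2 : {perm T} := tperm o0 o2 * tperm o1 o3.

Ltac point := case=> [[|[|[|[|[|?]]]]] ?] //; rewrite ?permM !permE /=; apply/val_inj.

Ltac pointE := case=> [[|[|[|[|[|?]]]]] ?] //; apply/val_inj.

Lemma rot3E i : rot3 i = nth o0 [:: o1; o2; o0; o3; o4] i.
Proof. by move: i; point. Qed.
Lemma rot5E i : rot5 i = nth o0 [:: o1; o2; o3; o4; o0] i.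
Proof. by move: i; point. Qed.
Lemma swap1E i : swap1 i = nth o0 [:: o1; o0; o3; o2; o4] i.
Proof. by move: i; point. Qed.
Lemma swap2E i : swap2 i = nth o0 [:: o2; o3; o0; o1; o4] i.
Proof. by move: i; point. Qed.
Lemma generators_even : [/\ rot3 \in 'Alt_T, rot5 \in 'Alt_T, swap1 \in 'Alt_T & swap2 \in 'Alt_T].
Proof. by split; rewrite Alt_even !odd_permM !odd_tperm. Qed.

Lemma rot3_order : #[rot3] = 3.
Proof.
apply: nt_prime_order => //; first by apply/permP=> i; rewrite !expgS !(permM rot3) expg0 !perm1 !rot3E; move: i; pointE.
by apply/eqP=> /permP/(_ o0); rewrite perm1 rot3E.
Qed.
Lemma rot5_order : #[rot5] = 5.
Proof.
apply: nt_prime_order => //; first by apply/permP=> i; rewrite !expgS !(permM rot5) expg0 !perm1 !rot5E; move: i; pointE.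
by apply/eqP=> /permP/(_ o0); rewrite perm1 rot5E.
Qed.
Lemma swap1_order : #[swap1] = 2.
Proof.
apply: nt_prime_order => //; first by apply/permP=> i; rewrite !expgS !(permM swap1) expg0 !perm1 !swap1E; move: i; pointE.
by apply/eqP=> /permP/(_ o0); rewrite perm1 swap1E.
Qed.
Lemma swap2_order : #[swap2] = 2.
Proof.
apply: nt_prime_order => //; first by apply/permP=> i; rewrite !expgS !(permM swap2) expg0 !perm1 !swap2E; move: i; pointE.
by apply/eqP=> /permP/(_ o0); rewrite perm1 swap2E.
Qed.
Lemma swap12_commute : commute swap1 swap2.
Proof. by apply/permP=> i; rewrite (permM swap1) (permM swap2) !swap2E !swap1E; move: i; pointE. Qed.
Lemma swap12_rot3 : swap1 * rot3 = rot3 * (swap1 * swap2).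
Proof. by apply/permP=> i; rewrite (permM swap1) (permM rot3) (permM swap1) swap2E !swap1E !rot3E; move: i; pointE. Qed.
Lemma swap2_rot3 : swap2 * rot3 = rot3 * swap1.
Proof. by apply/permP=> i; rewrite (permM swap2) (permM rot3) swap2E swap1E !rot3E; move: i; pointE. Qed.

(** A permutation commuting with a transitive cycle is determined by the image of
  one point, as is a power of the cycle. *)
Lemma cent_rot5 : 'C_('Alt_T)[rot5] = <[rot5]>.
Proof.
have [_ A5 _ _] := generators_even.
apply/eqP; rewrite eqEsubset sub_cent1_cycle // andbT.
apply/subsetP=> z /setIP[_ /cent1P cz].
have orb i : exists k, i = (rot5 ^+ k) o0.
  case: i => [[|[|[|[|[|?]]]]] h] //;
    [exists 0 | exists 1%N | exists 2 | exists 3 | exists 4];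
    by rewrite ?expgS ?(permM rot5) expg0 perm1 ?rot5E; apply/val_inj.
have [k zk] := orb (z o0).
suff -> : z = rot5 ^+ k by apply: mem_cycle.
apply/permP=> i; have [m ->] := orb i.
have czm : commute z (rot5 ^+ m) by apply: commuteX.
by rewrite -[LHS]permM -czm [LHS]permM zk -!permM -!expgD addnC.
Qed.

(** A permutation commuting with (0 1 2) preserves the set of its fixed points 3 and
  4. Multiplying it by a power of the cycle, one may assume that it fixes 0, hence 1
  and 2; being even it cannot exchange 3 and 4. *)
Lemma cent_rot3 : 'C_('Alt_T)[rot3] = <[rot3]>.
Proof.
have [A3 _ _ _] := generators_even.
apply/eqP; rewrite eqEsubset sub_cent1_cycle // andbT.
apply/subsetP=> z /setIP[Az /cent1P cz].
have zE (w : {perm T}) i : commute w rot3 -> w (rot3 i) = rot3 (w i) by move=> cw; rewrite -!permM cw.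
have fixE i : rot3 i = i -> i = o3 \/ i = o4.
  by rewrite rot3E; case: i => [[|[|[|[|[|?]]]]] h] // e; [left | right]; apply/val_inj.
have orb i : rot3 i != i -> exists k, i = (rot3 ^+ k) o0.
  rewrite rot3E; case: i => [[|[|[|[|[|?]]]]] h] // _; [exists 0 | exists 1%N | exists 2];
    by rewrite ?expgS ?(permM rot3) expg0 perm1 ?rot3E; apply/val_inj.
have [|k zk] := orb (z o0).
  by rewrite -(zE z) // (inj_eq perm_inj) rot3E.
pose w := z * rot3 ^- k.
have cw : commute w rot3 by apply/commute_sym/commuteM; [apply: commute_sym | apply/commuteV/commuteX].
have w0 : w o0 = o0 by rewrite permM zk permK.
have w1 : w o1 = o1 by have := zE w o0 cw; rewrite w0 !rot3E.
have w2 : w o2 = o2 by have := zE w o1 cw; rewrite w1 !rot3E.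
have Aw : w \in 'Alt_T by rewrite groupM ?groupV ?groupX.
suff w_1 : w = 1 by rewrite (canRL (mulgK _) w_1) invgK mul1g mem_cycle.
have w34 i : rot3 i = i -> w i = o3 \/ w i = o4.
  by move=> ci; apply: fixE; have := zE w i cw; rewrite ci.
have [rot3o3 rot3o4] : rot3 o3 = o3 /\ rot3 o4 = o4 by rewrite !rot3E.
have [w3 | w3] := w34 o3 rot3o3; have [w4 | w4] := w34 o4 rot3o4.
- by have /perm_inj/eqP := etrans w4 (esym w3).
- by apply: perm5_eq; rewrite !perm1.
- move: Aw; suff -> : w = tperm o3 o4 by rewrite Alt_even odd_tperm.
  by apply: perm5_eq; rewrite tpermL tpermR !tpermD.
by have /perm_inj/eqP := etrans w4 (esym w3).
Qed.

Lemma card_Alt5 : #|'Alt_T| = 60.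
Proof. by apply/eqP; rewrite -(eqn_pmul2l (isT : 0 < 2)) card_Alt card_ord. Qed.

(** The four-group generated by the double transpositions [swap1] and [swap2]. *)
Lemma Alt5_Sylow : exists P : {group {perm T}}, [/\ 2.-Sylow('Alt_T) P, #|P| = 4, 2.-abelem P
  & forall y, y \in P -> [\/ y = 1, y = swap1, y = swap2 | y = swap1 * swap2]].
Proof.
have n12 : swap1 != swap2 by apply/eqP=> /permP/(_ o0)/eqP; rewrite swap1E swap2E.
have [oP abP elP] := klein_join swap1_order swap2_order n12 swap12_commute.
have [_ _ Ak1 Ak2] := generators_even.
exists (<[swap1]> <*> <[swap2]>)%G; split=> //.
by rewrite pHallE card_Alt5 oP /= join_subG !cycle_subG Ak1 Ak2 p_part.
Qed.

Lemma Alt5_one_deficient : exists x, one_deficient_prime 2 'Alt_T x.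
Proof.
have [P [sylP oP abP elP]] := Alt5_Sylow.
have [A3 A5 _ _] := generators_even.
have swap1J (v : {perm T}) : v \in P -> #[v] = 2 -> v \in swap1 ^: 'Alt_T.
  move=> /elP[] -> => [|_|_|_]; first by rewrite order1.
  - exact: class_refl.
  - have -> : swap2 = swap1 ^ rot3^-1 by apply: (canRL (conjgK _)); rewrite conjgE swap2_rot3 mulKg.
    by rewrite memJ_class ?groupV.
  have -> : swap1 * swap2 = swap1 ^ rot3 by rewrite conjgE swap12_rot3 mulKg.
  by rewrite memJ_class.
apply: (one_deficient_criterion sylP); rewrite ?oP //.
- move=> y Ay pr_y odd_y.
  have : #[y] \in primes 60 by rewrite mem_primes pr_y /= -card_Alt5 order_dvdG.
  rewrite -[primes 60]/[:: 2; 3; 5] !inE => /or3P[] /eqP oy; first by move: odd_y; rewrite oy.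
    by apply: (self_cent_prime_order A3) Ay _; rewrite ?rot3_order // cent_rot3.
  by apply: (self_cent_prime_order A5) Ay _; rewrite ?rot5_order // cent_rot5.
- by move=> u v Pu Pv ou ov; rewrite (class_eqP (swap1J u Pu ou)) swap1J.
move=> y Py; rewrite ltnNge dvdn_leq // order_dvdn.
by have /abelemP[] := abP => // _ ->.
Qed.

Lemma Alt5_not_solvable : ~~ solvable 'Alt_T.
Proof. by rewrite solvable_AltF ?card_ord. Qed.

Lemma Alt5_Sylow_not_normal (P : {group {perm T}}) : #|P| = 4 -> ~~ (P <| 'Alt_T).
Proof.
move=> oP; apply/negP=> nP; have /simpleP[_ simA] : simple 'Alt_T by rewrite simple_Alt5 ?card_ord.
by have [e | e] := simA _ nP; move: oP; rewrite e ?cards1 ?card_Alt5.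
Qed.
End Alt5.

(** * The classification *)

Lemma one_deficient_isog (gT rT : finGroupType) (G : {group gT}) (H : {group rT}) p :
    G \isog H -> (exists x, one_deficient_prime p G x) ->
  exists x, one_deficient_prime p H x.
Proof.
case/isogP=> f injf imf [x [Gx ox prop cx selfC]].
have defH : H = (f @* G)%G by apply/val_inj; rewrite /= imf.
rewrite {imf}defH.
have C y : y \in G -> 'C_(f @* G)[f y] = f @* 'C_G[y] by move=> Gy; rewrite injm_subcent1.
have oC y : y \in G -> #[f y] = #[y] by move=> Gy; apply: order_injm.
have onto z : z \in f @* G -> exists2 y, y \in G & z = f y by case/morphimP=> y _ Gy ->; exists y.
exists (f x); split; rewrite ?mem_morphim ?oC //.
- by rewrite C // -morphim_cycle // injm_proper ?cycle_subG ?subsetIl.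
- move=> z /onto[y Gy ->]; rewrite oC // => /(cx y Gy)/imsetP[g Gg ->].
  by rewrite morphJ // memJ_class ?mem_morphim.
move=> z /onto[y Gy ->]; rewrite oC // => ny oy.
rewrite C // selfC ?morphim_cycle //.
by apply: contra ny => /eqP ->; rewrite morph1.
Qed.

Lemma inD1_isog (gT rT : finGroupType) (G : {group gT}) (H : {group rT}) :
  G \isog H -> (exists x, one_deficient_prime 2 H x) -> inD 1 G.
Proof.
move=> isoGH defH; apply/inD1_structure; exists 2.
have isoHG : H \isog G by rewrite isog_sym.
by have [x D] := one_deficient_isog isoHG defH; exists x.
Qed.

(** Both groups satisfy the relations [relations60] and have order 60. *)
Lemma nonnormal_abelem_Alt5 (gT : finGroupType) (G P : {group gT}) x :
    one_deficient_prime 2 G x -> 2.-Sylow(G) P -> 2.-abelem P -> ~~ (P <| G) ->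
  G \isog 'Alt_('I_5).
Proof.
move=> D sylP abP nP; have [oG _ _] := abelem_order60 D sylP abP nP.
have [u [b [t [R1 g1]]]] := abelem_generators D sylP abP nP.
have [y DA] := Alt5_one_deficient; have [Q [sylQ oQ abQ _]] := Alt5_Sylow.
have [u' [b' [t' [R2 g2]]]] := abelem_generators DA sylQ abQ (Alt5_Sylow_not_normal oQ).
by apply: (presented_isog bound60 relations60_pair R1 g1 _ R2 g2); rewrite ?oG ?card_Alt5.
Qed.

(** Both groups satisfy the relations [relations168] and have order 168. *)
Lemma dihedral_PSL27 (gT : finGroupType) (G P : {group gT}) x h u :
    one_deficient_prime 2 G x -> 2.-Sylow(G) P -> #|P| = 8 -> h \in P -> u \in P ->
    #[h] = 4 -> #[u] = 2 -> h ^ u = h^-1 ->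
  G \isog PSL 2 'F_7.
Proof.
move=> D sylP oP Ph Pu oh ou hu; have oG := dihedral_order168 D sylP oP Ph Pu oh ou hu.
have [a [b [t [R1 g1]]]] := dihedral_generators D sylP oP Ph Pu oh ou hu.
have [y DS] := PSL_one_deficient.
have [Q [k [v [sylQ oQ Qk Qv [ok ov kv _]]]]] := PSL_dihedral_Sylow.
have [a' [b' [t' [R2 g2]]]] := dihedral_generators DS sylQ oQ Qk Qv ok ov kv.
apply: (presented_isog bound168 relations168_pair R1 g1 _ R2 g2); first by rewrite oG.
by rewrite card_PSL.
Qed.

Unset Implicit Arguments.

Theorem theorem2 (gT : finGroupType) (G : {group gT}) :
  inD 1 G <->
  [\/ nilpotent G /\ (is_cyclic_of_order 4 G \/ G \isog 'Q_8),
      [/\ ~~ nilpotent G, solvable G &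
       [\/ exists (s q : nat) (A B : {group gT}),
             [/\ 0 < s, q = (2 ^ s - 1)%N, prime q,
                 is_elementary_abelian 2 s A /\ is_cyclic_of_order q B &
                 [Frobenius G = A ><| B]],
           exists (q : nat) (A B : {group gT}),
             [/\ prime q, q = 1 %[mod 4],
                 is_cyclic_of_order q A /\ is_cyclic_of_order 4 B &
                 [Frobenius G = A ><| B]]
         | G \isog 'D_18]] |
      ~~ solvable G /\ (G \isog 'Alt_('I_5) \/ G \isog PSL 2 'F_7)].
Proof.
split=> [/inD1_structure[p [x [pr_p D]]] | ].
  have [p2 | odd_p] := even_prime pr_p; last first.
    have [nilG solG isoG] := odd_deficient_order pr_p D odd_p.
    by constructor 2; split=> //; constructor 3.
  rewrite {p pr_p}p2 in D.
  have [P sylP] := Sylow_exists 2 G.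
  have [[t [Pt ot uniq_t]] | abP | [oP [h [u [Ph Pu oh ou hu]]]]] := Sylow2_shape D sylP.
  - have [nilG | [nilG solG FG]] := unique_involution_case D sylP Pt ot uniq_t.
      by constructor 1.
    by constructor 2; split=> //; constructor 2.
  - have [nP | nP] := boolP (P <| G).
      have [nilG solG FG] := normal_abelem_case D sylP abP nP.
      by constructor 2; split=> //; constructor 1.
    have isoG := nonnormal_abelem_Alt5 D sylP abP nP.
    by constructor 3; rewrite (isog_sol isoG) Alt5_not_solvable; split=> //; left.
  constructor 3; rewrite (dihedral_not_solvable D sylP oP Ph Pu oh ou hu).
  by split=> //; right; apply: dihedral_PSL27 D sylP oP Ph Pu oh ou hu.
case=> [[_ [C4 | Q8]] | [_ _ [[s [q [A [B [s0 eq pr_q [elA cycB] FG]]]]] | [q [A [B [pr_q _ [cycA cycB] FG]]]] | D18]] | [_ [A5 | L27]]].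
- exact: cyclic4_inD1.
- exact: quaternion8_inD1.
- exact: Frobenius_abelem_inD1 s0 eq pr_q elA cycB FG.
- exact: Frobenius_cyclic4_inD1 pr_q cycA cycB FG.
- exact: dihedral18_inD1.
- exact: inD1_isog A5 Alt5_one_deficient.
exact: inD1_isog L27 PSL_one_deficient.
Qed.
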